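(* Let $d=1$, $V=0$, $(x,v)\in\mathbb{T}\times\mathbb{R}$. Consider either of the two equations $$\partial_t f+v\,\partial_x f=-(-\partial_v+v)\partial_v f\qquad\text{(FP)},$$ $$\partial_t f+v\,\partial_x f=r-f,\quad r(t,x)=\int_{\mathbb{R}} f(t,x,v)\,d\nu(v)\qquad\text{(BL)}.$$ There exist explicit constants $\kappa>0$ and $C>0$ (independent of $f_0$) such that for every $f_0\in L^2(d\mu d\nu)$ with $\langle f_0\rangle=0$, the solution $f$ of (FP), respectively (BL), with initial datum $f_0$ satisfies $$\|f(t)\|\le C e^{-\kappa t}\|f_0\|\qquad\text{for all } t\ge 0 .$$
   Context: $\mathbb{T}$ is the one-dimensional torus. $d\mu$ is the normalized (probability) Lebesgue measure on $\mathbb{T}$ and $d\nu=(2\pi)^{-1/2}e^{-v^2/2}\,dv$ is the standard Gaussian measure on $\mathbb{R}$. $\|\cdot\|$ is the norm of $L^2(d\mu d\nu)=L^2(\mathbb{T}\times\mathbb{R},d\mu\otimes d\nu)$, and $\langle f_0\rangle=\iint f_0\,d\mu d\nu$. Solutions: write the equation as $\partial_t f+Pf=0$ with $P=v\partial_x-L$, where $Lf=-(-\partial_v+v)\partial_v f$ for (FP) and $Lf=\int f\,d\nu-f$ for (BL). It is a standing convention that $P$ is equipped with an appropriate domain $D(P)\subset L^2(d\mu d\nu)$ (for instance its closure from $C_c^\infty(\mathbb{T}\times\mathbb{R})$) to which the Hille–Yosida theorem applies; ''the solution with initial datum $f_0$'' means $f(t)=e^{-tP}f_0$. *)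

(* Defs.v *)
From HB Require Import structures.
From mathcomp Require Import all_boot all_order all_algebra.
From mathcomp Require Import all_classical all_reals all_analysis.

Set Implicit Arguments.
Unset Strict Implicit.
Unset Printing Implicit Defensive.

Import Order.TTheory GRing.Theory Num.Theory.
Import numFieldNormedType.Exports.

Local Open Scope classical_set_scope.
Local Open Scope ring_scope.

(* The torus is R / ell Z for an arbitrary length ell > 0. A function on
   torus * R is a function of (x, v) in R * R. Up to null sets only its values
   for x in [0, ell] matter, since mu is the uniform probability on that
   interval; periodicity in x is required of the test functions below. *)
Section PhaseSpace.
Context {R : realType} {ell : R} (ell_gt0 : 0 < ell).

Definition torus_prob := uniform_prob ell_gt0.

Definition gauss_prob := @normal_prob R 0 1.

Definition phase_prob := (torus_prob \x gauss_prob)%E.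

(* Square-integrable functions, as representatives: equality in
   L^2(dmu dnu) is equality almost everywhere. *)
Definition L2 := LfunType phase_prob (lee1n 2).

Definition L2norm (f : R * R -> R) : \bar R :=
  ('N[phase_prob]_(2%:E)[EFin \o f])%E.

Definition mean (f : R * R -> R) : R := \int[phase_prob]_z f z.

End PhaseSpace.

Section KineticOperators.
Context {R : realType}.

Definition dx (f : R * R -> R) : R * R -> R :=
  fun z => derive1 (fun x : R => f (x, z.2)) z.1.

Definition dv (f : R * R -> R) : R * R -> R :=
  fun z => derive1 (fun v : R => f (z.1, v)) z.2.

Fixpoint Cn (n : nat) (f : R * R -> R) : Prop :=
  match n with
  | 0 => continuous f
  | m.+1 => [/\ forall z : R * R, derivable (fun x : R => f (x, z.2)) z.1 1,
                forall z : R * R, derivable (fun v : R => f (z.1, v)) z.2 1,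
                Cn m (dx f) & Cn m (dv f)]
  end.

(* C_c^oo(torus * R); the torus being compact, only the velocity support is
   restricted. *)
Definition test_function (ell : R) (f : R * R -> R) : Prop :=
  [/\ forall n, Cn n f,
      forall x v, f (x + ell, v) = f (x, v) &
      exists K : R, forall x v, K < `|v| -> f (x, v) = 0].

Inductive collision := FP | BL.

Definition collision_op (c : collision) (f : R * R -> R) : R * R -> R :=
  match c with
  | FP => fun z => - (- dv (dv f) z + z.2 * dv f z)
  | BL => fun z => \int[gauss_prob]_v f (z.1, v) - f z
  end.

Definition kinetic_op (c : collision) (f : R * R -> R) : R * R -> R :=
  fun z => z.2 * dx f z - collision_op c f z.

End KineticOperators.

Section Semigroup.
Context {R : realType} {ell : R} (ell_gt0 : 0 < ell).
Local Notation L2 := (L2 ell_gt0).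
Local Notation norm := (L2norm ell_gt0).
Local Notation P := (phase_prob ell_gt0).

(* The graph of the closure in L^2 of the kinetic operator initially defined on
   test functions: f is in D(P) and P f = g. *)
Definition kinetic_graph (c : collision) (f g : L2) : Prop :=
  exists phi : nat -> R * R -> R,
    [/\ forall n, test_function ell (phi n),
        norm (phi n \- f) @[n --> \oo] --> 0%E &
        norm (kinetic_op c (phi n) \- g) @[n --> \oo] --> 0%E].

(* Strongly continuous semigroup (S t)_(t >= 0) of bounded linear operators on
   L^2; the values of S at negative times are irrelevant. *)
Record C0_semigroup (S : R -> L2 -> L2) : Prop := {
  C0_linear : forall t, 0 <= t -> forall (a : R) (f g : L2),
    (S t (a *: f + g) : _ -> R) = (a *: S t f + S t g : L2) %[ae P];
  C0_bounded : forall t, 0 <= t -> exists M : R, forall f : L2,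
    (norm (S t f) <= M%:E * norm f)%E;
  C0_id : forall f : L2, (S 0 f : _ -> R) = f %[ae P];
  C0_comp : forall s t, 0 <= s -> 0 <= t -> forall f : L2,
    (S (s + t) f : _ -> R) = S s (S t f) %[ae P];
  C0_continuous : forall f : L2, norm (S t f \- f) @[t --> 0^'+] --> 0%E }.

(* f is in the domain of the generator of S, which maps f to g. *)
Definition generator_graph (S : R -> L2 -> L2) (f g : L2) : Prop :=
  norm (h^-1 *: (S h f - f) - g : L2) @[h --> 0^'+] --> 0%E.

(* S t = exp (- t P), i.e. S is the strongly continuous semigroup generated
   by - P. *)
Definition kinetic_semigroup (c : collision) (S : R -> L2 -> L2) : Prop :=
  C0_semigroup S /\
  forall f g : L2, generator_graph S f (- g) <-> kinetic_graph c f g.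

End Semigroup.

(* Main.v *)
Require Import Defs.
From mathcomp Require Import all_boot all_order all_algebra.
From mathcomp Require Import all_classical all_reals all_analysis.
From mathcomp Require Import measurable_realfun.
From mathcomp Require Import ring lra.

Set Implicit Arguments.
Unset Strict Implicit.
Unset Printing Implicit Defensive.

Import Order.TTheory GRing.Theory Num.Theory.
Import numFieldNormedType.Exports.

Local Open Scope classical_set_scope.
Local Open Scope ring_scope.

(* Hypocoercivity by a modified entropy. Write r for the velocity average of f, j for its
   flux (the velocity average of v f) and k(x, y) for the mean-zero primitive kernel of the
   torus. The collisions dissipate |f - r|^2 only (Gaussian Poincare inequality for FP). To the
   variance of f one adds - 2 eps ell b(f, f), where b(f, g) couples the flux of f to the
   primitive of the density of g; since dr/dt = - dj/dx and dj/dt = - dr/dx + terms in f - r,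
   the derivative of the new term contains - eps |r - <f>|^2. For small eps the result Q is
   equivalent to the variance and satisfies Q(f, P f) >= k Q(f, f) on test functions, hence on
   the closed graph of P. As S is only assumed strongly continuous at 0, the local boundedness
   that differentiating Q(S t f) requires comes from the Baire theorem; a Gronwall argument on
   the domain followed by density concludes. The same argument applied to the form <f><g> with
   k = 0 shows that the mean is conserved. Density of the domain: products of the smooth steps
   exp(- 1/x), evaluated on sines (to be periodic) and on velocity windows, approximate
   indicators of quadrants, and a Dynkin argument gives the indicators of measurable sets. *)

(** * Decay of a quadratic form along a semigroup *)

(** The domain of [P] is known only through a closure, and a test function need not remain one under
    [S], so the flow cannot be followed on test functions. Each estimate is therefore an inequality
    between forms bounded in L2, checked on test functions and carried over by approximation. This
    is why [b] is built from a primitive: it gains back the derivative lost in transport and is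
    bounded by plain L2 norms. The form Q lives on all of L2, vanishes on constants, and controls
    the norm of mean-zero functions only; hence the separate argument on the mean. Constants: the
    Poincare constant 10 comes from an elementary weight (the optimal one is 1). With m4 the fourth
    Gaussian moment and B = 1 + m4 + ell, the choice eps = 1 / (16 (1 + B^2)) gives eps ell <= 1/32,
    so Q stays within a 32nd of the variance, and makes the cross term eps B |f - r| |r - <f>| small
    enough for the dissipation |f - r|^2 / 10 and half of eps |r - <f>|^2 to absorb it. The norm
    then decays at rate eps / 4. *)

Section RealInduction.
Context {R : realType}.

(** Supremum argument with a slack slope [d]: the set [A] of times up to which [g s <= g 0 + d * s]
    contains its supremum by the left condition, and the right condition extends it beyond any point
    before [T]. The left condition only excludes upward jumps. *)
Lemma real_induction_le (g : R -> R) (T : R) :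
  (forall t e, 0 <= t -> 0 < e -> \forall h \near 0^'+, g (t + h) <= g t + e * h) ->
  (forall t e, 0 < t -> 0 < e -> \forall h \near 0^'+, g t <= g (t - h) + e) ->
  0 <= T -> g T <= g 0.
Proof.
move=> gr gl T0; apply/ler_addgt0Pr => e e0.
suff H d : 0 < d -> g T <= g 0 + d * T.
  have d0 : 0 < e / (T + 1) by rewrite divr_gt0// ltr_wpDl.
  apply: (le_trans (H _ d0)); rewrite lerD2l mulrAC ler_pdivrMr ?ltr_wpDl//.
  by rewrite ler_wpM2l ?ltW//; lra.
move=> {e e0} d0.
pose A := [set t | 0 <= t <= T /\ forall s, 0 <= s <= t -> g s <= g 0 + d * s].
have A0 : A 0.
  split; first by rewrite lexx T0.
  by move=> s; rewrite -eq_le => /eqP <-; rewrite mulr0 addr0.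
have Aub : ubound A T by move=> t [/andP[]].
have hA : has_sup A by split; [exists 0 | exists T].
pose s := sup A.
have sT : s <= T by apply: ge_sup => //; exists 0.
have s0 : 0 <= s by apply: ub_le_sup => //; exists T.
have ltA u : 0 <= u -> u < s -> g u <= g 0 + d * u.
  move=> u0 us.
  have [t [_ At] ut] := sup_adherent (eq_rect _ is_true us _ (esym (subr_gt0 u s))) hA.
  by apply: At; rewrite u0/= ltW// (le_lt_trans _ ut)// /s; lra.
have As : A s.
  split; first by rewrite s0.
  move=> u /andP[u0]; rewrite le_eqVlt => /predU1P[->{u u0}|]; last exact: ltA.
  have [s00|sp] := leP s 0.
    by have -> : s = 0; [apply/eqP; rewrite eq_le s00|rewrite mulr0 addr0].
  apply/ler_addgt0Pr => e e0.
  have /filter_ex [h [[h0 hs] gh]] :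
      \forall h \near 0^'+, (0 < h /\ h < s) /\ g s <= g (s - h) + e.
    near=> h; split; [split|]; near: h.
    - exact: nbhs_right_gt.
    - exact: nbhs_right_lt.
    - exact: gl.
  apply: (le_trans gh); rewrite lerD2r.
  apply: le_trans (ltA (s - h) _ _) _; [lra|lra|].
  by rewrite lerD2l ler_wpM2l ?ltW//; lra.
have [sT'|] := ltP s T; last first.
  by move=> Ts; have [_ ->] := As => //; rewrite T0.
have H1 := gr s d s0 d0.
have /nbhs_right0P : \forall h \near s^'+, h < T by exact: nbhs_right_lt.
move=> H2.
have [r /= r0 Hr] := filterI H1 H2.
have : A (s + r / 2).
  have r2 : 0 < r / 2 by rewrite divr_gt0.
  have Hr' h : 0 < h -> h <= r / 2 -> g (s + h) <= g s + d * h /\ s + h < T.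
    move=> h0 hr; have := Hr h; rewrite /ball/= sub0r normrN gtr0_norm//.
    by case=> //; lra.
  split.
    by have [_ /ltW ->] := Hr' _ r2 (lexx _); rewrite andbT addr_ge0// ltW.
  move=> u /andP[u0 ur]; have [us|su] := leP u s.
    by have [_ ->] := As => //; rewrite u0.
  have := (Hr' (u - s)); rewrite subrKC => -[||Hu _]; [lra|lra|].
  apply: (le_trans Hu); have [_ As'] := As; have := As' s.
  by rewrite s0 lexx => /(_ isT); lra.
move=> /(ub_le_sup _) => /(_ (ex_intro _ T Aub)); rewrite -/s => ss.
have : 0 < r / 2 by rewrite divr_gt0.
by lra.
Unshelve. all: by end_near. Qed.

(** Multiplication by [expR (k * t)] reduces to the previous lemma, since
    [1 - k * h <= expR (- (k * h))]. The hypotheses are one-sided because orbits of the semigroup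
    are differentiated from the right only. *)
Lemma right_gronwall (phi : R -> R) (k T : R) :
  (forall t, 0 <= t -> 0 <= phi t) ->
  (forall t e, 0 <= t -> 0 < e ->
    \forall h \near 0^'+, phi (t + h) <= phi t - k * phi t * h + e * h) ->
  (forall t e, 0 < t -> 0 < e -> \forall h \near 0^'+, phi t <= phi (t - h) + e) ->
  0 <= k -> 0 <= T -> phi T <= expR (- k * T) * phi 0.
Proof.
move=> p0 pr pl k0 T0.
suff : expR (k * T) * phi T <= expR (k * 0) * phi 0.
  rewrite mulr0 expR0 mul1r => H.
  by rewrite mulNr expRN [leRHS]mulrC ler_pdivlMr ?expR_gt0// mulrC.
apply: (real_induction_le (g := fun t => expR (k * t) * phi t)) => // t e t0 e0.
  have E0 := expR_gt0 (k * (t + 1)).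
  near=> h.
  have h0 : 0 < h by near: h; exact: nbhs_right_gt.
  have h1 : h < 1 by near: h; exact: nbhs_right_lt.
  (* For [h < 1] the factor [expR (k * (t + h))] is at most [expR (k * (t + 1))], so the error is
     still at most [e * h] after multiplication. *)
  have H : phi (t + h) <= phi t - k * phi t * h + e / expR (k * (t + 1)) * h.
    by near: h; apply: pr => //; rewrite divr_gt0.
  have H2 : phi (t + h) <= expR (- (k * h)) * phi t + e / expR (k * (t + 1)) * h.
    apply: (le_trans H); rewrite lerD2r.
    have := ler_wpM2r (p0 t t0) (expR_ge1Dx (- (k * h))); lra.
  apply: le_trans (ler_wpM2l (expR_ge0 _) H2) _.
  rewrite mulrDr mulrA -expRD mulrDr addrK lerD2l.
  rewrite mulrA ler_wpM2r//.
  rewrite mulrA ler_pdivrMr// [leLHS]mulrC (ler_wpM2l (ltW e0))//.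
  by rewrite ler_expR -mulrDr ler_wpM2l//; lra.
have E0 := expR_gt0 (k * t).
have pt := p0 t (ltW t0).
(* One [b] pays for the variation of [phi] on the left, the other for replacing [expR (k * (t - h))]
   by [expR (k * t)]; the bound [c] on [h] ensures [h * (k * phi t) <= b]. *)
pose b := e / expR (k * t) / 2.
have b0 : 0 < b by rewrite !divr_gt0.
pose c := b / (k * phi t + 1).
have kp : 0 <= k * phi t by rewrite mulr_ge0.
have c0 : 0 < c by rewrite divr_gt0// ltr_wpDl.
near=> h.
have h0 : 0 < h by near: h; exact: nbhs_right_gt.
have hc : h < c by near: h; exact: nbhs_right_lt.
have hk : h < (k + 1)^-1 by near: h; apply: nbhs_right_lt; rewrite invr_gt0 ltr_wpDl.
have H : phi t <= phi (t - h) + b by near: h; exact: pl.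
have kh1 : k * h <= 1.
  by move: hk; rewrite -[_^-1]mul1r ltr_pdivlMr ?ltr_wpDl//; nra.
have hkp : h * (k * phi t) <= b.
  by move: hc; rewrite /c ltr_pdivlMr ?ltr_wpDl//; nra.
rewrite mulrBr expRD.
have : e = expR (k * t) * (b + b).
  by rewrite /b -mulr2n -[_ *+ 2]mulr_natr divfK// mulrC divfK// gt_eqF.
move=> ->; rewrite -mulrA -mulrDr ler_wpM2l ?ltW//.
have H1 : 1 - k * h <= expR (- (k * h)) by have := expR_ge1Dx (- (k * h)); lra.
have H3 : phi t - b <= phi (t - h) by lra.
have [pb|pb] := leP 0 (phi t - b).
  have := ler_pM _ pb H1 H3; rewrite subr_ge0 => /(_ kh1).
  have : 0 <= k * h by rewrite mulr_ge0// ltW.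
  by nra.
have ht : h < t by near: h; exact: nbhs_right_lt.
have : 0 <= expR (- (k * h)) * phi (t - h).
  by rewrite mulr_ge0 ?expR_ge0// p0// subr_ge0 ltW.
by lra.
Unshelve. all: by end_near. Qed.
End RealInduction.

(** * Decay of a bounded form along a strongly continuous semigroup *)

Section AbstractDecay.
Context {R : realType} {V : lmodType R} (n : V -> R) (S : R -> V -> V).
Hypothesis n_ge0 : forall f, 0 <= n f.
Hypothesis nD : forall f g, n (f + g) <= n f + n g.
Hypothesis nZ : forall a f, n (a *: f) = `|a| * n f.
Hypothesis S_lin : forall t, 0 <= t -> forall a f g,
  n (S t (a *: f + g) - (a *: S t f + S t g)) = 0.
Hypothesis S_bnd : forall t, 0 <= t -> exists M, forall f, n (S t f) <= M * n f.
Hypothesis S_id : forall f, n (S 0 f - f) = 0.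
Hypothesis S_comp : forall s t, 0 <= s -> 0 <= t -> forall f,
  n (S (s + t) f - S s (S t f)) = 0.
Hypothesis S_cont : forall f e, 0 < e -> \forall h \near 0^'+, n (S h f - f) < e.

Let nN f : n (- f) = n f.
Proof. by rewrite -scaleN1r nZ normrN1 mul1r. Qed.

Let nBC f g : n (f - g) = n (g - f).
Proof. by rewrite -nN opprB. Qed.

Let nleB f g : n f <= n g + n (f - g).
Proof. by rewrite -{1}(subrKC g f) nD. Qed.

Let nB3 f g h : n (f - h) <= n (f - g) + n (g - h).
Proof. by apply: le_trans (nD _ _); rewrite addrA subrK. Qed.

Let n_eq f g : n (f - g) = 0 -> n f = n g.
Proof.
move=> fg; apply/eqP; rewrite eq_le.
have := nleB f g; have := nleB g f; rewrite (nBC g) fg !addr0.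
by move=> -> ->.
Qed.

Let S_bnd0 t : 0 <= t -> exists2 M, 0 <= M & forall f, n (S t f) <= M * n f.
Proof.
move=> /S_bnd[M HM]; exists `|M| => // f.
by apply: (le_trans (HM f)); rewrite ler_wpM2r// ler_norm.
Qed.

Let S_sub t : 0 <= t -> forall f g, n (S t (f - g) - (S t f - S t g)) = 0.
Proof.
move=> t0 f g; have := S_lin t0 (-1) g f.
by rewrite !scaleN1r [- g + f]addrC [- S t g + _]addrC.
Qed.

(** The function [n] plays the role of a seminorm and the laws of [S] hold up to [n]-null
    differences only, as elements of L2 are representatives; composition and linearity are thus used
    through [n] and not by rewriting. *)
Let S_comp_sub s t f g : 0 <= s -> 0 <= t ->
  n (S (s + t) f - S s g) <= n (S s (S t f - g)).
Proof.
move=> s0 t0; apply: le_trans (nB3 _ (S s (S t f)) _) _.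
by rewrite S_comp// add0r (n_eq (S_sub s0 _ _)).
Qed.

Let S_rcont t f e : 0 <= t -> 0 < e -> \forall h \near 0^'+, n (S (t + h) f - S t f) < e.
Proof.
move=> t0 e0; have [M M0 HM] := S_bnd0 t0.
have e1 : 0 < e / (M + 1) by rewrite divr_gt0// ltr_wpDl.
near=> h.
have h0 : 0 < h by near: h; exact: nbhs_right_gt.
apply: le_lt_trans (S_comp_sub _ _ t0 (ltW h0)) _.
apply: le_lt_trans (HM _) _.
have H : n (S h f - f) < e / (M + 1) by near: h; exact: S_cont.
apply: le_lt_trans (ler_wpM2l M0 (ltW H)) _.
by rewrite mulrA ltr_pdivrMr ?ltr_wpDl//; nra.
Unshelve. all: by end_near. Qed.

(** Baire category: every [S t] is bounded, so the sets [E N] of times with operator bound [N] cover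
    []0, a[], and the closure of one of them contains an open set [W]. A time [t] of [W] to the
    right of [x0] is a limit from the right of points of [E N], and right continuity of orbits
    passes the bound to [t]. *)
Let S_bnd_itv (a : R) : 0 < a -> exists t0 r : R, exists N, [/\ 0 < t0, 0 < r, t0 + r < a, 0 <= N &
  forall t f, t0 <= t -> t < t0 + r -> n (S t f) <= N * n f].
Proof.
move=> a0.
pose E (N : nat) := [set t : R^o | [/\ 0 < t, t < a & forall f, n (S t f) <= N%:R * n f]].
have S_near t f : 0 <= t -> forall e, 0 < e -> \forall s \near t^'+, n (S s f - S t f) < e.
  by move=> t0 e e0; apply/nbhs_right0P; exact: S_rcont.
have [H|] := pselect (forall N, dense (~` closure (E N))).
  exfalso.
  have BE : forall N, open (~` closure (E N)) /\ dense (~` closure (E N)).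
    by move=> N; split=> //; rewrite openC; exact: closed_closure.
  have ne : `]0, a[%classic !=set0.
    by exists (a / 2); rewrite /= in_itv/= divr_gt0//= ltr_pdivrMr//; lra.
  have [t [/=]] := @Baire _ (R^o : completeNormedModType R) _ BE _ ne (@itv_open _ R 0 a).
  rewrite in_itv/= => /andP[t0 ta] tE.
  have [M M0 HM] := S_bnd0 (ltW t0).
  have [N MN] : exists N, M <= N%:R.
    by exists (Num.truncn M).+1; rewrite ltW// truncnS_gt.
  apply: (tE N I); apply: subset_closure; split=> // f.
  by apply: le_trans (HM f) _; rewrite ler_wpM2r.
move/existsNP => [N] /existsNP[W] /not_implyP[[x Wx]] /not_implyP[oW WE].
have WsE : W `<=` closure (E N).
  by move=> y Wy; apply: contrapT => yE; apply: WE; exists y.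
have [x0 [[x0p x0a _] Wx0]] : E N `&` W !=set0.
  by apply: (WsE _ Wx); exact: open_nbhs_nbhs.
have [r [r0 rW ra]] : exists r : R, [/\ 0 < r, `]x0 - r, x0 + r[ `<=` (W : set R) & x0 + r < a].
  have := @open_itvoo_subset _ (W : set R) x0 oW Wx0 => Hr.
  have /filter_ex [r [[r1 r2] r3]] :
      \forall r \near 0^'+, (0 < r /\ r < a - x0) /\ `]x0 - r, x0 + r[ `<=` (W : set R).
    near=> r; split; [split|]; near: r => //; [exact: nbhs_right_gt|].
    by apply: nbhs_right_lt; rewrite subr_gt0.
  by exists r; split=> //; lra.
exists x0, r, N%:R; split=> // t f x0t tr.
apply/ler_addgt0Pr => e e0.
have t0 : 0 <= t by rewrite (le_trans _ x0t)// ltW.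
have H1 : \forall s \near t^'+, n (S s f - S t f) < e by exact: S_near.
have H2 : \forall s \near t^'+, s < x0 + r by exact: nbhs_right_lt.
have [d /= d0 Hd] := filterI H1 H2.
have Hs s : t < s -> s < t + d -> n (S s f - S t f) < e /\ s < x0 + r.
  move=> ts sd; apply: Hd => //=; rewrite /ball/= ltr_distl; apply/andP; split; lra.
have dm : 0 < d / 2 by rewrite divr_gt0.
have Wm : W (t + Num.min (d / 2) ((x0 + r - t) / 2)).
  apply: rW; rewrite /= in_itv/=.
  have : 0 < Num.min (d / 2) ((x0 + r - t) / 2) by rewrite lt_min dm divr_gt0//; lra.
  have : Num.min (d / 2) ((x0 + r - t) / 2) <= ((x0 + r - t) / 2) by rewrite ge_min lexx orbT.
  by move=> H3 H4; apply/andP; split; lra.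
have : nbhs (t + Num.min (d / 2) ((x0 + r - t) / 2)) (`]t, t + d[%classic : set R^o).
  apply: open_nbhs_nbhs; split; first exact: (@itv_open _ R).
  rewrite /= in_itv/=.
  have : 0 < Num.min (d / 2) ((x0 + r - t) / 2) by rewrite lt_min dm divr_gt0//; lra.
  have : Num.min (d / 2) ((x0 + r - t) / 2) <= d / 2 by rewrite ge_min lexx.
  by move=> H3 H4; apply/andP; split; lra.
move=> /(WsE _ Wm)[s [[s0 sa HsE]]] /=; rewrite in_itv/= => /andP[ts std].
have [/ltW Hst _] := Hs s ts std.
apply: le_trans (nleB _ (S s f)) _.
by rewrite nBC lerD.
Unshelve. all: by end_near. Qed.

(** The bound on one short interval before [t] propagates: [S (t - h)] is the fixed operator
    [S (t - (a + r / 2))] applied after [S (a + r / 2 - h)], whose time stays in that interval. *)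
Let S_locbnd (t : R) : 0 < t -> exists d M, [/\ 0 < d, d <= t, 0 <= M &
  forall h f, 0 <= h -> h < d -> n (S (t - h) f) <= M * n f].
Proof.
move=> t0; have [a [r [N [a0 r0 ar N0 HN]]]] := S_bnd_itv t0.
have c0 : 0 <= t - (a + r / 2) by lra.
have [M M0 HM] := S_bnd0 c0.
exists (r / 2), (M * N); split; [lra|lra|exact: mulr_ge0|].
move=> h f h0 hr.
have -> : t - h = (t - (a + r / 2)) + (a + r / 2 - h) by lra.
have p0 : 0 <= a + r / 2 - h by lra.
rewrite (n_eq (S_comp c0 p0 f)) (le_trans (HM _))// -mulrA ler_wpM2l// HN//; lra.
Qed.

(** Up to a null difference, [S (t - h) f - S t f] is [S (t - h) (f - S h f)]: a locally bounded
    operator applied to a small vector. *)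
Let S_lcont t f e : 0 < t -> 0 < e -> \forall h \near 0^'+, n (S (t - h) f - S t f) < e.
Proof.
move=> t0 e0; have [d [M [d0 dt M0 HM]]] := S_locbnd t0.
have e1 : 0 < e / (M + 1) by rewrite divr_gt0// ltr_wpDl.
near=> h.
have h0 : 0 < h by near: h; exact: nbhs_right_gt.
have hd : h < d by near: h; exact: nbhs_right_lt.
have th : 0 <= t - h by lra.
have := S_comp_sub f f th (ltW h0); rewrite subrK nBC => H.
apply: le_lt_trans H _.
apply: le_lt_trans (HM _ _ (ltW h0) hd) _.
have H : n (S h f - f) < e / (M + 1) by near: h; exact: S_cont.
apply: le_lt_trans (ler_wpM2l M0 (ltW H)) _.
by rewrite mulrA ltr_pdivrMr ?ltr_wpDl//; nra.
Unshelve. all: by end_near. Qed.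

Definition is_gen f g := forall e, 0 < e ->
  \forall h \near 0^'+, n (h^-1 *: (S h f - f) - g) < e.

Let gen_S f g t : 0 <= t -> is_gen f g -> is_gen (S t f) (S t g).
Proof.
move=> t0 fg e e0; have [M M0 HM] := S_bnd0 t0.
have e1 : 0 < e / (M + 1) by rewrite divr_gt0// ltr_wpDl.
near=> h.
have h0 : 0 < h by near: h; exact: nbhs_right_gt.
have hh : h^-1 * h = 1 by rewrite mulVf// gt_eqF.
set g' := h^-1 *: (S h f - f).
have Sf : S h f = h *: g' + f by rewrite /g' scalerA mulrC hh scale1r subrK.
have H1 : n (S h (S t f) - (h *: S t g' + S t f)) = 0.
  apply/eqP; rewrite eq_le n_ge0 andbT.
  apply: le_trans (nB3 _ (S (h + t) f) _) _.
  rewrite nBC (S_comp (ltW h0) t0) add0r (addrC h t).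
  apply: le_trans (nB3 _ (S t (S h f)) _) _.
  by rewrite (S_comp t0 (ltW h0)) add0r Sf S_lin.
have H2 : n (h^-1 *: (S h (S t f) - S t f) - S t g') = 0.
  have -> : S t g' = h^-1 *: (h *: S t g') by rewrite scalerA hh scale1r.
  rewrite -scalerBr nZ; apply/eqP; rewrite mulf_eq0; apply/orP; right; apply/eqP.
  by rewrite -H1; congr n; rewrite [h *: S t g' + _]addrC opprD addrA.
apply: le_lt_trans (nB3 _ (S t g') _) _; rewrite H2 add0r -(n_eq (S_sub t0 _ _)).
apply: le_lt_trans (HM _) _.
have H : n (g' - g) < e / (M + 1) by rewrite /g'; near: h; exact: fg.
apply: le_lt_trans (ler_wpM2l M0 (ltW H)) _.
by rewrite mulrA ltr_pdivrMr ?ltr_wpDl//; nra.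
Unshelve. all: by end_near. Qed.

Context (Q : V -> V -> R) (K k : R).
Hypothesis Q_lin : forall a f g h, Q (a *: f + g) h = a * Q f h + Q g h.
Hypothesis Q_sym : forall f g, Q f g = Q g f.
Hypothesis Q_ge0 : forall f, 0 <= Q f f.
Hypothesis K_ge0 : 0 <= K.
Hypothesis Q_bnd : forall f g, `|Q f g| <= K * (n f * n g).
Hypothesis k_ge0 : 0 <= k.
Hypothesis Q_diss : forall f g, is_gen f g -> Q f g <= - k * Q f f.

Let QD f g h : Q (f + g) h = Q f h + Q g h.
Proof. by rewrite -{1}[f]scale1r Q_lin mul1r. Qed.

Let Qsq f d : Q (f + d) (f + d) = Q f f + 2 * Q f d + Q d d.
Proof. rewrite QD ![Q _ (f + d)]Q_sym !QD (Q_sym d f); ring. Qed.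

Let Q0 h : Q 0 h = 0.
Proof. by have := QD 0 0 h; rewrite addr0; lra. Qed.

Let QZ a f h : Q (a *: f) h = a * Q f h.
Proof. by have := Q_lin a f 0 h; rewrite addr0 Q0 addr0. Qed.

(** With [u = S t f] and [w = S t g], write [S (t + h) f = u + h w + z] where [z] is small compared
    with [h]. The first-order term of the form is [2 h Q u w], at most [- 2 k h Q u u] by
    dissipation, and Gronwall applies. *)
Let decay_dom f g T : is_gen f g -> 0 <= T ->
  Q (S T f) (S T f) <= expR (- (2 * k) * T) * Q f f.
Proof.
move=> fg T0.
have -> : Q f f = Q (S 0 f) (S 0 f).
  have /esym := Qsq f (S 0 f - f); rewrite subrKC => <-.
  have H u : Q u (S 0 f - f) = 0.
    by apply/eqP; rewrite -normr_le0 (le_trans (Q_bnd _ _))// S_id !mulr0.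
  by rewrite !H mulr0 !addr0.
apply: (@right_gronwall _ (fun t => Q (S t f) (S t f)) (2 * k) T) => //.
- move=> t e t0 e0.
  have Suw := gen_S t0 fg; have := Q_diss Suw.
  set u := S t f; set w := S t g => uw.
  (* [e'] limits the remainder [2 * Q u z] to half of [e * h]; the bound [c0] on [h] limits the
     quadratic term to the other half. *)
  pose e' := Num.min 1 (e / (4 * (K * n u + 1))).
  have Ku : 0 <= K * n u by rewrite mulr_ge0.
  have Kw : 0 <= K * (n w + 1) ^+ 2 by rewrite mulr_ge0// sqr_ge0.
  have e'0 : 0 < e' by rewrite lt_min ltr01 divr_gt0// mulr_gt0// ltr_wpDl.
  have c0 : 0 < e / (2 * (K * (n w + 1) ^+ 2 + 1)) by rewrite divr_gt0// mulr_gt0// ltr_wpDl.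
  near=> h.
  have h0 : 0 < h by near: h; exact: nbhs_right_gt.
  have hc : h < e / (2 * (K * (n w + 1) ^+ 2 + 1)) by near: h; exact: nbhs_right_lt.
  set U := S (t + h) f.
  have H : n (h^-1 *: (S h u - u) - w) < e' by near: h; exact: Suw.
  have e'1 : e' <= 1 by rewrite ge_min lexx.
  have e'2 : e' * (4 * (K * n u + 1)) <= e.
    by rewrite -ler_pdivlMr ?mulr_gt0 ?ltr_wpDl// ge_min lexx orbT.
  have hh : h^-1 * h = 1 by rewrite mulVf// gt_eqF.
  have HU : n (U - S h u) = 0 by rewrite /U (addrC t h) (S_comp (ltW h0) t0).
  pose z := U - u - h *: w.
  have nz : n z <= h * e'.
    have -> : z = (U - S h u) + h *: (h^-1 *: (S h u - u) - w).
      by rewrite scalerBr scalerA mulrC hh scale1r /z addrA subrKA.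
    by apply: le_trans (nD _ _) _; rewrite HU add0r nZ gtr0_norm// ler_wpM2l// ltW.
  have dE : U - u = h *: w + z by rewrite /z subrKC.
  have nd : n (U - u) <= h * (n w + 1).
    rewrite dE; apply: le_trans (nD _ _) _; rewrite nZ gtr0_norm// mulrDr lerD2l.
    by apply: (le_trans nz); rewrite ler_wpM2l// ltW.
  have Qz : `|Q u z| <= K * n u * (h * e').
    by apply: le_trans (Q_bnd _ _) _; rewrite mulrA ler_wpM2l.
  have Qd : `|Q (U - u) (U - u)| <= K * (h * (n w + 1)) ^+ 2.
    by apply: le_trans (Q_bnd _ _) _; rewrite ler_wpM2l// expr2 ler_pM.
  have QU := Qsq u (U - u); rewrite subrKC in QU.
  rewrite QU.
  have -> : Q u (U - u) = h * Q u w + Q u z by rewrite Q_sym dE QD QZ !(Q_sym u).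
  have h1 : K * n u * (h * e') * 4 <= e * h.
    have := ler_wpM2r (ltW h0) e'2.
    have : 0 <= h * e' by rewrite mulr_ge0 ?ltW.
    nra.
  have h2 : K * (h * (n w + 1)) ^+ 2 * 2 <= e * h.
    move: hc; rewrite ltr_pdivlMr ?mulr_gt0 ?ltr_wpDl// => /ltW/(ler_wpM2r (ltW h0)).
    rewrite exprMn; set W := (n w + 1) ^+ 2 in Kw *.
    have : 0 <= h ^+ 2 by rewrite sqr_ge0.
    nra.
  have := ler_wpM2l (ltW h0) uw.
  have := ler_norm (Q u z); have := ler_norm (Q (U - u) (U - u)).
  nra.
- move=> t e t0 e0; set u := S t f.
  have Ku : 0 <= K * n u by rewrite mulr_ge0.
  have c0 : 0 < e / (2 * (K * n u + 1)) by rewrite divr_gt0// mulr_gt0// ltr_wpDl.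
  near=> h.
  have H : n (S (t - h) f - u) < e / (2 * (K * n u + 1)) by near: h; exact: S_lcont.
  have := Qsq u (S (t - h) f - u); rewrite subrKC => ->.
  have := Q_ge0 (S (t - h) f - u).
  have := Q_bnd u (S (t - h) f - u); rewrite mulrA ler_norml => /andP[H1 _].
  have H2 : K * n u * n (S (t - h) f - u) * 2 <= e.
    move: H; rewrite ltr_pdivlMr ?mulr_gt0 ?ltr_wpDl// => H.
    have := n_ge0 (S (t - h) f - u); lra.
  lra.
- by rewrite mulr_ge0.
Unshelve. all: by end_near. Qed.

Hypothesis gen_dense : forall f e, 0 < e -> exists f' g', is_gen f' g' /\ n (f' - f) < e.

(** At fixed [t] both sides are continuous in [f], since [S t] and [Q] are bounded, so the estimate
    passes from the dense domain. [C] collects the coefficients of [d = n (f' - f)], after [d ^+ 2]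
    is bounded by [d]. *)
Lemma semigroup_decay f t : 0 <= t ->
  Q (S t f) (S t f) <= expR (- (2 * k) * t) * Q f f.
Proof.
move=> t0; apply/ler_addgt0Pr => e e0.
have [M M0 HM] := S_bnd0 t0.
have Qle a b : Q a a <= Q b b + 2 * K * n b * n (a - b) + K * n (a - b) ^+ 2.
  have := Qsq b (a - b); rewrite subrKC => ->.
  have := Q_bnd b (a - b); rewrite ler_norml => /andP[_ H1].
  have := Q_bnd (a - b) (a - b); rewrite ler_norml => /andP[_ H2].
  by rewrite expr2; lra.
set E := expR _.
have E0 : 0 <= E by exact: expR_ge0.
pose C := E * (2 * K * n f + K) + 2 * K * (M * (n f + 1)) * M + K * M ^+ 2.
have C0 : 0 <= C by rewrite !addr_ge0// !mulr_ge0// ?addr_ge0// mulr_ge0// mulr_ge0.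
have [|f' [g' [fg ff']]] := gen_dense f (e := Num.min 1 (e / (C + 1))).
  by rewrite lt_min ltr01 divr_gt0// ltr_wpDl.
set d := n (f' - f) in ff'.
have d0 : 0 <= d by exact: n_ge0.
have [d1 dC] : d < 1 /\ d * (C + 1) < e.
  by move: ff'; rewrite lt_min => /andP[-> ]; rewrite ltr_pdivlMr ?ltr_wpDl.
apply: le_trans (Qle _ (S t f')) _.
have H1 := decay_dom fg t0; rewrite -/E in H1.
have H2 := Qle f' f; rewrite -/d in H2.
have H3 : n (S t f - S t f') <= M * d.
  by rewrite -(n_eq (S_sub t0 _ _)) (le_trans (HM _))// nBC.
have H4 : n (S t f') <= M * (n f + 1).
  apply: le_trans (HM _) _; rewrite ler_wpM2l//.
  by apply: le_trans (nleB _ f) _; rewrite lerD2l ltW.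
have H5 : 2 * K * n (S t f') * n (S t f - S t f') <= 2 * K * (M * (n f + 1)) * (M * d).
  rewrite -!mulrA ler_wpM2l// ler_wpM2l// !mulrA.
  by rewrite -mulrA ler_pM.
have H6 : K * n (S t f - S t f') ^+ 2 <= K * (M * d) ^+ 2.
  by rewrite ler_wpM2l// lerXn2r// ?nnegrE// mulr_ge0.
have d2 : d ^+ 2 <= d by rewrite expr2 ler_piMr// ltW.
have H7 : K * (M * d) ^+ 2 <= K * M ^+ 2 * d.
  by rewrite exprMn mulrA ler_wpM2l// mulr_ge0// sqr_ge0.
have H8 : Q f' f' <= Q f f + (2 * K * n f + K) * d.
  by apply: (le_trans H2); have := ler_wpM2l K_ge0 d2; lra.
have := ler_wpM2l E0 H8; move: dC; rewrite /C; lra.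
Qed.
End AbstractDecay.

(** * Square-integrable functions *)

Section L2Facts.
Context d {T : measurableType d} {R : realType} (mu : {measure set T -> \bar R}).

(** Since [fine] sends an infinite norm to 0, this is the L2 norm only for [f] in [Lfun mu 2%:E]. *)
Definition nrm2 (f : T -> R) : R := fine ('N[mu]_2%:E[EFin \o f])%E.

Lemma Lfun2_Lnorm (f : T -> R) : f \in Lfun mu 2%:E ->
  'N[mu]_2%:E[EFin \o f]%E = (nrm2 f)%:E.
Proof.
rewrite inE => /andP[_]; rewrite inE/= => h.
by rewrite /nrm2 fineK// ge0_fin_numE ?Lnorm_ge0.
Qed.

Lemma nrm2_ge0 f : 0 <= nrm2 f.
Proof. by rewrite fine_ge0// Lnorm_ge0. Qed.

Lemma Lfun2_measurable (f : T -> R) : f \in Lfun mu 2%:E -> measurable_fun setT f.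
Proof. by rewrite inE => /andP[]; rewrite inE. Qed.

Lemma Lfun2_integrableM (f g : T -> R) : f \in Lfun mu 2%:E -> g \in Lfun mu 2%:E ->
  mu.-integrable setT (EFin \o (fun x => f x * g x)).
Proof. by move=> f2 g2; apply/Lfun1_integrable; exact: Lfun2_mul_Lfun1. Qed.

Lemma sqr_nrm2 (f : T -> R) : f \in Lfun mu 2%:E -> nrm2 f ^+ 2 = \int[mu]_x (f x * f x).
Proof.
move=> f2; have := @powR_Lnorm _ _ _ mu (EFin \o f) 2 _.
rewrite Lfun2_Lnorm// poweR_EFin powR_mulrn ?nrm2_ge0// => H.
have := H (lt0r_neq0 (ltr0Sn _ _)).
rewrite /Rintegral => {}H; rewrite -[LHS]/(fine (_ %:E)) H; congr fine.
apply: eq_integral => x _ /=.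
by rewrite powR_mulrn// real_normK ?num_real// expr2.
Qed.

Lemma cauchy_schwarz2 (f g : T -> R) : f \in Lfun mu 2%:E -> g \in Lfun mu 2%:E ->
  `|\int[mu]_x (f x * g x)| <= nrm2 f * nrm2 g.
Proof.
move=> f2 g2.
have := @hoelder _ _ _ mu f g 2 2 (Lfun2_measurable f2) (Lfun2_measurable g2).
rewrite !Lfun2_Lnorm// Lnorm1 => H.
apply: le_trans (le_normr_Rintegral _ (Lfun2_integrableM f2 g2)) _ => //.
have {}H := H (ltr0Sn _ _) (ltr0Sn _ _) _.
rewrite -lee_fin EFinM; apply: le_trans (H _); last by lra.
rewrite /Rintegral fineK//.
by apply: integrable_fin_num => //; apply/integrable_norm => //; exact: Lfun2_integrableM.
Qed.

Lemma Lfun2P (f : T -> R) : measurable_fun setT f ->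
  mu.-integrable setT (EFin \o (fun x => f x * f x)) -> f \in Lfun mu 2%:E.
Proof.
move=> mf /integrableP[_ If]; rewrite inE; apply/andP; split; rewrite inE//=.
rewrite /finite_norm unlock /=.
rewrite poweR_lty//; apply: le_lt_trans If.
rewrite le_eqVlt; apply/orP; left; apply/eqP; apply: eq_integral => x _ /=.
by rewrite powR_mulrn// real_normK ?num_real// normrM expr2 -normrM ger0_norm// -expr2 sqr_ge0.
Qed.
End L2Facts.

(** * Integration against a measure given by a density *)

Section Density.
Context d {T : measurableType d} {R : realType}.
Context (mu nu : {measure set T -> \bar R}) (p : T -> R).
Hypothesis mp : measurable_fun setT p.
Hypothesis p0 : forall x, 0 <= p x.
Hypothesis nuE : forall A, measurable A -> nu A = (\int[mu]_(x in A) (p x)%:E)%E.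

Import HBNNSimple.
Local Open Scope ereal_scope.

Let density_nnsfun (f : {nnsfun T >-> R}) :
  \int[nu]_x (f x)%:E = \int[mu]_x ((f x)%:E * (p x)%:E).
Proof.
under [LHS]eq_integral do rewrite fimfunE -fsumEFin//.
rewrite [LHS]ge0_integral_fsum//; last 2 first.
  - by move=> r; exact/measurable_EFinP/measurableT_comp.
  - by move=> n x _; rewrite EFinM nnfun_muleindic_ge0.
under [RHS]eq_integral.
  move=> x xD; rewrite fimfunE -fsumEFin// ge0_mule_fsuml; last first.
    by move=> r; rewrite EFinM nnfun_muleindic_ge0.
  over.
rewrite [RHS]ge0_integral_fsum//; last 2 first.
  - move=> r; apply: emeasurable_funM; apply/measurable_EFinP => //.
    exact: measurableT_comp.
  - by move=> n x _; apply: mule_ge0; [rewrite EFinM nnfun_muleindic_ge0|rewrite lee_fin].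
apply: eq_fsbigr => r rf.
have [x fx] : exists x, f x = r by have := set_mem rf; case => x _ fx; exists x.
have r0 : (0 <= r)%R by rewrite -fx.
under eq_integral do rewrite EFinM.
rewrite ge0_integralZl//; last by exact/measurable_EFinP.
under [RHS]eq_integral do rewrite EFinM -muleA.
rewrite [RHS]ge0_integralZl//; last 2 first.
  - by apply: emeasurable_funM; apply/measurable_EFinP.
  - by move=> y _; rewrite mule_ge0// lee_fin.
congr (_ * _); rewrite integral_indic// setIT nuE// integral_mkcond.
apply: eq_integral => y _; rewrite patchE indicE; case: ifPn => _.
  by rewrite mul1e.
by rewrite mul0e.
Qed.

Lemma ge0_integral_density (f : T -> \bar R) : measurable_fun setT f ->
  (forall x, 0 <= f x) -> \int[nu]_x f x = \int[mu]_x (f x * (p x)%:E).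
Proof.
move=> mf f0.
pose f_ := nnsfun_approx measurableT mf.
transitivity (lim (\int[nu]_x (f_ n x)%:E @[n --> \oo])).
  rewrite -monotone_convergence//=.
  - apply: eq_integral => ? /[!inE] xD; apply/esym/cvg_lim => //=.
    exact: cvg_nnsfun_approx.
  - by move=> n; exact/measurable_EFinP/measurable_funTS.
  - by move=> n ? _; rewrite lee_fin.
  - by move=> ? _ ? ? mn; rewrite lee_fin; exact/lefP/nd_nnsfun_approx.
under [X in lim (fmap X _)]funext => n do rewrite density_nnsfun.
rewrite -monotone_convergence//=.
- apply: eq_integral => x _; apply/cvg_lim => //=.
  by apply: cvgeZr => //; exact: cvg_nnsfun_approx.
- by move=> n; apply: emeasurable_funM; apply/measurable_EFinP => //; exact/measurable_funTS.
- by move=> n x _; rewrite mule_ge0// lee_fin.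
- move=> x _ a b ab; apply: lee_wpmul2r; first by rewrite lee_fin.
  by rewrite lee_fin; exact/lefP/nd_nnsfun_approx.
Qed.

Lemma integrable_density (f : T -> R) : measurable_fun setT f ->
  nu.-integrable setT (EFin \o f) <-> mu.-integrable setT (EFin \o (fun x => f x * p x)%R).
Proof.
move=> mf.
have H : \int[nu]_x `|(EFin \o f) x| = \int[mu]_x `|(EFin \o (fun x => f x * p x)%R) x|.
  rewrite ge0_integral_density//=; last by apply/measurable_EFinP; exact: measurableT_comp.
  by apply: eq_integral => x _; rewrite normrM EFinM (ger0_norm (p0 x)).
split => /integrableP[_ Hi]; apply/integrableP; split.
- by apply/measurable_EFinP; exact: measurable_funM.
- by rewrite -H.
- exact/measurable_EFinP.
- by rewrite H.
Qed.

Lemma Rintegral_density (f : T -> R) : measurable_fun setT f ->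
  nu.-integrable setT (EFin \o f) -> (\int[nu]_x f x = \int[mu]_x (f x * p x))%R.
Proof.
move=> mf fi; rewrite /Rintegral; congr fine.
rewrite [LHS]integralE [RHS]integralE.
have mEf : measurable_fun setT (EFin \o f) by exact/measurable_EFinP.
rewrite ge0_integral_density//; last exact: measurable_funepos.
rewrite ge0_integral_density//; last exact: measurable_funeneg.
by congr (_ - _); apply: eq_integral => x _;
  rewrite ?funeposE ?funenegE /= -?EFinN -!EFin_max -EFinM maxr_pMl// mul0r ?mulNr.
Qed.
End Density.

(** * One-dimensional Lebesgue and Gaussian integrals *)

Section LebesgueLine.
Context {R : realType}.
Local Notation leb := (@lebesgue_measure R).

Lemma dominated_Rintegral d {T : measurableType d} (mu : {measure set T -> \bar R})
    (f_ : (T -> R)^nat) (f g : T -> R) :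
  (forall n, measurable_fun setT (f_ n)) -> measurable_fun setT f ->
  (forall x, f_ n x @[n --> \oo] --> f x) ->
  mu.-integrable setT (EFin \o g) -> (forall n x, `|f_ n x| <= g x) ->
  (\int[mu]_x f_ n x) @[n --> \oo] --> \int[mu]_x f x.
Proof.
move=> mf_ mf cf ig fg.
have [|||||fi0 _ fi] := @dominated_convergence _ _ _ mu setT measurableT
  (fun n => EFin \o f_ n) (EFin \o f) (EFin \o g).
- by move=> n; exact/measurable_EFinP.
- exact/measurable_EFinP.
- apply: aeW => x _; apply: cvg_EFin; last exact: cf.
  exact: nearW.
- by [].
- by apply: aeW => x n _; rewrite lee_fin; exact: fg.
have fin := integrable_fin_num measurableT fi0; move: fi; rewrite -(fineK fin).
by move/fine_cvg.
Qed.

Lemma cvg_Rintegral_itvNn (f : R -> R) : leb.-integrable setT (EFin \o f) ->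
  \int[leb]_(x in `[- n%:R, n%:R]) f x @[n --> \oo] --> \int[leb]_x f x.
Proof.
move=> fi; have mf : measurable_fun setT f by apply/measurable_EFinP; case/integrableP : fi.
under eq_fun do rewrite Rintegral_mkcond.
apply: (@dominated_Rintegral _ _ leb (fun n : nat => f \_ `[- n%:R, n%:R]) f (fun x => `|f x|)) => //.
- move=> n; apply/(measurable_restrictT _ _).1 => //; exact: measurable_funS mf.
- move=> x; apply: cvg_near_cst.
  have : \forall n \near \oo, `|x| <= n%:R :> R by exact: nbhs_infty_ger.
  apply: filterS => n xn; rewrite patchE mem_set//= in_itv/=.
  by rewrite -ler_norml.
- exact: integrable_norm.
- by move=> n x; rewrite patchE; case: ifPn => // _; rewrite normr0.
Qed.

Lemma Rintegral_deriv (G g : R -> R) (a b : R) : a < b ->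
  (forall x : R, a < x < b -> is_derive x 1 G (g x)) -> {within `[a, b], continuous G} ->
  {within `[a, b], continuous g} -> \int[leb]_(x in `[a, b]) g x = G b - G a.
Proof.
move=> ab dG cG cg; rewrite /Rintegral (@continuous_FTC2 _ g G a b)//.
- have [_ Ga Gb] := (continuous_within_itvP G ab).1 cG.
  split=> // x; rewrite in_itv/= => axb.
  by have [] := dG x axb.
- by move=> x; rewrite in_itv/= => axb; rewrite derive1E; apply: derive_val; exact: dG.
Qed.

Lemma Rintegral_derivT (G g : R -> R) (a b : R) : a <= b ->
  (forall x : R, is_derive x 1 G (g x)) -> continuous g ->
  \int[leb]_(x in `[a, b]) g x = G b - G a.
Proof.
rewrite le_eqVlt => /predU1P[->|ab] dG cg.
  by rewrite set_itv1 Rintegral_set1 subrr.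
apply: Rintegral_deriv => //; apply: continuous_subspaceT => // x.
apply: differentiable_continuous; apply/derivable1_diffP.
by have [] := dG x.
Qed.

Lemma Rintegral_derivT_eq0 (G g : R -> R) :
  (forall x : R, is_derive x 1 G (g x)) -> continuous g ->
  leb.-integrable setT (EFin \o g) ->
  G n%:R - G (- n%:R) @[n --> \oo] --> 0 ->
  \int[leb]_x g x = 0.
Proof.
move=> dG cg ig G0; have := cvg_Rintegral_itvNn ig.
under eq_fun do rewrite (Rintegral_derivT _ dG cg) ?ge0_cp//.
by move=> H; apply: (cvg_unique _ H G0).
Qed.
End LebesgueLine.

Section DerivRules.
Context {R : realType}.
Implicit Types (f g : R -> R) (x : R).

Lemma isd_mul f g x a b : is_derive x 1 f a -> is_derive x 1 g b ->
  is_derive x 1 (fun y => f y * g y) (a * g x + f x * b).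
Proof.
by move=> df dg; apply: (is_derive_eq (is_deriveM df dg)); rewrite /GRing.scale/= addrC mulrC.
Qed.

Lemma isd_add f g x a b : is_derive x 1 f a -> is_derive x 1 g b ->
  is_derive x 1 (fun y => f y + g y) (a + b).
Proof. by move=> df dg; exact: (is_derive_eq (is_deriveD df dg)). Qed.

Lemma isd_sub f g x a b : is_derive x 1 f a -> is_derive x 1 g b ->
  is_derive x 1 (fun y => f y - g y) (a - b).
Proof. by move=> df dg; exact: (is_derive_eq (is_deriveB df dg)). Qed.

Lemma isd_cst (c : R) x : is_derive x 1 (fun=> c : R) (0 : R).
Proof. exact: is_derive_cst. Qed.

Lemma isd_id x : is_derive x 1 (fun y : R => y : R) (1 : R).
Proof. exact: is_derive_id. Qed.

Lemma isd_cmul c f x a : is_derive x 1 f a -> is_derive x 1 (fun y => c * f y) (c * a).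
Proof. by move=> df; apply: (is_derive_eq (isd_mul (isd_cst c x) df)); rewrite mul0r add0r. Qed.

Lemma isd_comp f g x a b : is_derive (g x) 1 f a -> is_derive x 1 g b ->
  is_derive x 1 (fun y => f (g y)) (a * b).
Proof. by move=> df dg; exact: is_derive1_comp. Qed.

Lemma isd_continuous f x a : is_derive x 1 f a -> {for x, continuous f}.
Proof.
by move=> df; apply: differentiable_continuous; apply/derivable1_diffP; case: df.
Qed.

Lemma cont_mul f g : continuous f -> continuous g -> continuous (fun x => f x * g x).
Proof. by move=> cf cg x; apply: (@continuousM _ _ f g); [exact: cf|exact: cg]. Qed.

Lemma cont_add f g : continuous f -> continuous g -> continuous (fun x => f x + g x).
Proof. by move=> cf cg x; apply: (@continuousD _ _ _ f g); [exact: cf|exact: cg]. Qed.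

Lemma cont_sub f g : continuous f -> continuous g -> continuous (fun x => f x - g x).
Proof. by move=> cf cg x; apply: (@continuousB _ _ _ f g); [exact: cf|exact: cg]. Qed.

Lemma cont_id : continuous (fun x : R => x).
Proof. by move=> x; exact: cvg_id. Qed.

Lemma cont_cst (c : R) : continuous (fun _ : R => c).
Proof. exact: cst_continuous. Qed.
End DerivRules.

(** * The standard Gaussian measure: density, moments, Stein identity *)

Section Gauss.
Context {R : realType}.
Local Notation leb := (@lebesgue_measure R).
Local Notation w := (@normal_pdf R 0 1).
Local Notation gauss := (@gauss_prob R).

Lemma gauss_pdfE (v : R) : w v = normal_peak 1 * expR (- (v ^+ 2) / 2).
Proof. by rewrite normal_pdfE ?oner_neq0// /normal_fun subr0 expr1n. Qed.

Lemma gauss_pdf_gt0 (v : R) : 0 < w v.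
Proof. by rewrite gauss_pdfE mulr_gt0 ?expR_gt0// normal_peak_gt0// oner_neq0. Qed.

Lemma is_derive_gauss_pdf (v : R) : is_derive v 1 w (- v * w v).
Proof.
have -> : w = fun v => normal_peak 1 * expR (- (v ^+ 2) / 2) by apply/funext => u; rewrite gauss_pdfE.
have H : is_derive v (1:R) (fun v : R => - (v ^+ 2) / 2) (- v).
  have -> : (fun v : R => - (v ^+ 2) / 2) = (fun v : R => - 2^-1 * (v * v)).
    by apply/funext => u; rewrite expr2; field.
  by apply: (is_derive_eq (isd_cmul (- 2^-1) (isd_mul (isd_id v) (isd_id v)))); field.
apply: (is_derive_eq (isd_cmul (normal_peak 1) (isd_comp (is_derive_expR _) H))).
by rewrite mulrA mulrC.
Qed.

Lemma gaussE A : measurable A -> gauss A = (\int[leb]_(x in A) (w x)%:E)%E.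
Proof. by []. Qed.

Let mw : measurable_fun setT w := measurable_normal_pdf 0 1.
Let w0 (x : R) : 0 <= w x := normal_pdf_ge0 0 1 x.

Lemma integrable_gauss (f : R -> R) : measurable_fun setT f ->
  gauss.-integrable setT (EFin \o f) <-> leb.-integrable setT (EFin \o (fun x => f x * w x)).
Proof. move=> mf; have := @integrable_density _ _ _ leb gauss w mw w0 gaussE f mf. exact. Qed.

Lemma Rintegral_gauss (f : R -> R) : measurable_fun setT f ->
  gauss.-integrable setT (EFin \o f) -> \int[gauss]_x f x = \int[leb]_x (f x * w x).
Proof. exact: (@Rintegral_density _ _ _ leb gauss w mw w0 gaussE). Qed.

(** From [expR y >= 1 + y ^+ 2 / 2] at [y = v ^+ 2 / 4] comes [v ^+ 4 * expR (- v ^+ 2 / 2) <= 32 *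
    expR (- v ^+ 2 / 4)], a multiple of the Gaussian density of variance 2. *)
Lemma integrable_gauss_pow4 : gauss.-integrable setT (EFin \o (fun v : R => v ^+ 4)).
Proof.
apply/integrable_gauss; first exact: measurable_funX.
have s0 : Num.sqrt 2 != 0 :> R by rewrite gt_eqF// sqrtr_gt0.
pose c : R := 32 * normal_peak 1 / normal_peak (Num.sqrt 2).
have H := @integrable_normal_pdf R 0 (Num.sqrt 2).
apply: (le_integrable measurableT _ _ (integrableZl measurableT c H)).
  by apply/measurable_EFinP; apply: measurable_funM => //; exact: measurable_funX.
move=> v _ /=; rewrite lee_fin.
have p1 := normal_peak_gt0 (oner_neq0 R); have p2 := normal_peak_gt0 s0.
have c0 : 0 <= c by rewrite /c divr_ge0 ?mulr_ge0// ltW.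
have v4 : 0 <= v ^+ 4 by rewrite exprn_even_ge0.
rewrite !ger0_norm; [|by apply: mulr_ge0 => //; exact: normal_pdf_ge0|by apply: mulr_ge0 => //; exact: w0].
rewrite gauss_pdfE normal_pdfE// /normal_fun subr0 sqr_sqrtr// /c.
set p := normal_peak (Num.sqrt 2) in p2 *.
rewrite (_ : _ / p * (p * _) = normal_peak 1 * (32 * expR (- v ^+ 2 / (2 *+ 2)))); last first.
  by field; rewrite gt_eqF.
rewrite mulrCA; apply: ler_wpM2l; first exact: ltW.
have -> : - v ^+ 2 / 2 = - (v ^+ 2 / 4) + - (v ^+ 2 / 4) by field.
have -> : - v ^+ 2 / (2 *+ 2) = - (v ^+ 2 / 4) by rewrite -mulr_natr; field.
rewrite expRD mulrA ler_wpM2r ?expR_ge0// expRN -ler_pdivlMr ?invr_gt0 ?expR_gt0// invrK.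
have : 0 <= v ^+ 2 / 4 by rewrite divr_ge0// sqr_ge0.
move/(expR_ge1Dxn 1); rewrite (_ : 2`!%:R = 2)// expr_div_n -exprM => H1.
suff : v ^+ 4 = 32 * (v ^+ (2 * 2) / 4 ^+ 2 / 2) by lra.
by field.
Qed.
End Gauss.

Section GaussMoments.
Context {R : realType}.
Local Notation leb := (@lebesgue_measure R).
Local Notation w := (@normal_pdf R 0 1).
Local Notation gauss := (@gauss_prob R).

Lemma integrable_gauss_growth (f : R -> R) (M : R) : measurable_fun setT f ->
  (forall v, `|f v| <= M * (1 + v ^+ 4)) -> gauss.-integrable setT (EFin \o f).
Proof.
move=> mf fM.
have i1 : gauss.-integrable setT (EFin \o (fun v : R => 1)).
  exact: finite_measure_integrable_cst.
have H := integrableZl measurableT M (integrableD measurableT i1 integrable_gauss_pow4).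
apply: (le_integrable measurableT _ _ H); first exact/measurable_EFinP.
move=> v _ /=; rewrite lee_fin; apply: le_trans (fM v) _; exact: ler_norm.
Qed.

(** Gaussian integration by parts: [w' = - v * w], so [(f v - v * F v) * w v] is the derivative of
    [F * w], whose boundary values cancel in the limit. *)
Lemma stein_gauss (F f : R -> R) : (forall v : R, is_derive v 1 F (f v)) ->
  continuous f -> gauss.-integrable setT (EFin \o (fun v => f v - v * F v)) ->
  F n%:R * w n%:R - F (- n%:R) * w (- n%:R) @[n --> \oo] --> 0 ->
  \int[gauss]_v (f v - v * F v) = 0.
Proof.
move=> dF cf ig lim0.
have cF : continuous F by move=> x; exact: isd_continuous (dF x).
have cw : continuous w by apply: continuous_normal_pdf; exact: oner_neq0.
have mf : measurable_fun setT (fun v => f v - v * F v).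
  by apply/measurable_EFinP; case/integrableP : ig.
rewrite Rintegral_gauss//.
apply: (@Rintegral_derivT_eq0 _ (fun v => F v * w v)) => //.
- by move=> v; apply: (is_derive_eq (isd_mul (dF v) (is_derive_gauss_pdf v))); ring.
- move=> v; apply: (@continuousM _ _ (fun v => f v - v * F v) w); last exact: cw.
  apply: (@continuousB _ _ _ f (fun v => v * F v)); first exact: cf.
  by apply: (@continuousM _ _ id F); [exact: cvg_id|exact: cF].
- exact/integrable_gauss.
Qed.

Lemma stein_gauss_csupp (F f : R -> R) (K : R) : (forall v : R, is_derive v 1 F (f v)) ->
  continuous f -> (forall v, K < `|v| -> F v = 0) ->
  gauss.-integrable setT (EFin \o (fun v => f v - v * F v)) ->
  \int[gauss]_v (f v - v * F v) = 0.
Proof.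
move=> dF cf FK ig; apply: stein_gauss => //.
apply: cvg_near_cst.
have : \forall n \near \oo, K + 1 <= n%:R :> R by exact: nbhs_infty_ger.
apply: filterS => n Kn.
by rewrite !FK ?mul0r ?subrr// ?normrN ger0_norm//; lra.
Qed.

Lemma gauss_mean0 : \int[gauss]_v v = 0.
Proof.
have H (v : R) : v = -1 * (0 - v * 1) by ring.
transitivity (\int[gauss]_v (-1 * (0 - v * 1))).
  by apply: eq_Rintegral => v _; exact: H.
have ig : gauss.-integrable setT (EFin \o (fun v : R => 0 - v * 1)).
  apply: (@integrable_gauss_growth _ 1); first by apply: measurable_funB => //; exact: measurable_funM.
  move=> v; rewrite mulr1 sub0r normrN mul1r.
  have : 0 <= (`|v| ^+ 2 - 1) ^+ 2 by rewrite sqr_ge0.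
  have -> : v ^+ 4 = `|v| ^+ 4 by rewrite -[RHS]ger0_norm ?exprn_ge0// -normrX normr_id ger0_norm// exprn_even_ge0.
  have : 0 <= (`|v| - 1) ^+ 2 by rewrite sqr_ge0.
  rewrite !expr2 !exprS expr0; nra.
have st : \int[gauss]_v (0 - v * 1) = 0.
  apply: (@stein_gauss (fun=> 1) (fun=> 0)) => //.
  - by move=> v; exact: cst_continuous.
  - apply: cvg_near_cst; apply: nearW => n.
    by rewrite !mul1r !gauss_pdfE sqrrN subrr.
by rewrite RintegralZl// st mulr0.
Qed.

(** Stein identity for [F v = v]. The boundary term [2 n w(n)] is at most a multiple of
    [1 / (n + 1)], by [expR y >= 1 + y] at [y = n ^+ 2 / 2]. *)
Lemma gauss_var1 : \int[gauss]_v (v ^+ 2) = 1.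
Proof.
have i2 : gauss.-integrable setT (EFin \o (fun v : R => v ^+ 2)).
  apply: (@integrable_gauss_growth _ 1); first exact: measurable_funX.
  move=> v; rewrite mul1r ger0_norm ?sqr_ge0//.
  have : 0 <= (v ^+ 2 - 1) ^+ 2 by rewrite sqr_ge0.
  have := sqr_ge0 v.
  rewrite (_ : v ^+ 4 = v ^+ 2 * v ^+ 2) -?exprD//; nra.
have i1 : gauss.-integrable setT (EFin \o (fun v : R => 1)).
  exact: finite_measure_integrable_cst.
have : \int[gauss]_v (1 - v * v) = 0.
  apply: (@stein_gauss id (fun=> 1)).
  - by move=> v; exact: cst_continuous.
  - exact: (integrableB measurableT i1 i2).
  - have wN n : w (- n) = w n by rewrite !gauss_pdfE sqrrN.
    under eq_fun do rewrite /= wN mulNr opprK.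
    apply: (@squeeze_cvgr _ _ _ _ (fun=> 0) (fun n : nat => 8 * normal_peak 1 * n.+1%:R^-1)).
    + exists 1%N => // n /= n1.
      have w0 := gauss_pdf_gt0 (n%:R : R).
      apply/andP; split; first by rewrite addr_ge0// mulr_ge0// ltW.
      have p0 := normal_peak_gt0 (oner_neq0 R).
      have n1' : 1 <= n%:R :> R by rewrite ler1n.
      rewrite ler_pdivlMr// gauss_pdfE mulNr expRN.
      have E : 1 + n%:R ^+ 2 / 2 <= expR (n%:R ^+ 2 / 2 : R) by exact: expR_ge1Dx.
      set e := expR _ in E *.
      have e0 : 0 < e by apply: lt_le_trans E; have := sqr_ge0 (n%:R : R); lra.
      rewrite -natr1; set N : R := n%:R in n1' E *; set p := normal_peak 1 in p0 *.
      have -> : (N * (p * e^-1) + N * (p * e^-1)) * (N + 1) = p * (2 * N * (N + 1) / e) by ring.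
      rewrite [8 * p]mulrC ler_pM2l// ler_pdivrMr//.
      have : 0 <= (N - 1) ^+ 2 by rewrite sqr_ge0.
      by rewrite expr2 in E *; nra.
    + exact: cvg_cst.
    + rewrite -[X in _ --> X](mulr0 (8 * normal_peak 1)).
      by apply: cvgM; [exact: cvg_cst|exact: cvg_harmonic].
under eq_Rintegral do rewrite -expr2.
rewrite RintegralB//.
have -> : \int[gauss]_v (1 : R) = 1.
  rewrite Rintegral_cst// mul1r -[RHS]/(fine 1%E); congr fine.
  exact: (@probability_setT _ _ _ (gauss : probability _ R)).
by move=> /eqP; rewrite subr_eq0 => /eqP <-.
Qed.

(* A weight [a] with [v a - a' - a^2 >= 1/10] on [v >= 0]: integrating
   [(g' - a g)^2 >= 0] by parts then bounds [g^2] by [g'^2] as soon as [g 0 = 0]. *)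
Let wt (v : R) := 4^-1 * expR (- v) + 8^-1.

Let wt_ge0 v : 0 <= wt v.
Proof. by rewrite addr_ge0// mulr_ge0// expR_ge0. Qed.

Let wt_ineq (v : R) : 0 <= v -> 10^-1 <= v * wt v + 4^-1 * expR (- v) - wt v ^+ 2.
Proof.
move=> v0; rewrite /wt; set t := expR (- v).
have t0 : 0 <= t by exact: expR_ge0.
have t1 : t <= 1 by rewrite -expR0 ler_expR; lra.
have tv : 1 - v <= t by have := expR_ge1Dx (- v).
have vt : 0 <= v * t by rewrite mulr_ge0.
have tt : t ^+ 2 <= t by rewrite expr2; nra.
(* By [t ^+ 2 <= t] and [v + t >= 1] the right-hand side is at least 1/8 - 1/64 = 7/64, which
   exceeds 1/10. *)
lra.
Qed.

Let is_derive_wt s (v : R) : is_derive v 1 (fun v => wt (s * v)) (- s * (4^-1 * expR (- (s * v)))).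
Proof.
have H : is_derive v 1 (fun v => - (s * v)) (- s).
  have -> : (fun v => - (s * v)) = (fun v => - s * v) by apply/funext => u; rewrite mulNr.
  by apply: (is_derive_eq (isd_cmul (- s) (isd_id v))); rewrite mulr1.
apply: (is_derive_eq (isd_add (isd_cmul 4^-1 (isd_comp (is_derive_expR _) H)) (isd_cst 8^-1 v))).
by rewrite addr0; ring.
Qed.

(** * A Poincare inequality for the Gaussian measure *)

Section Poincare.
Context (g g' : R -> R).
Hypothesis dg : forall v : R, is_derive v 1 g (g' v).
Hypothesis cg' : continuous g'.
Hypothesis g0 : g 0 = 0.

Let D (v : R) : R := g' v ^+ 2 * w v - 10^-1 * (g v ^+ 2 * w v).
Let G (s v : R) : R := s * wt (s * v) * (g v ^+ 2 * w v).
Let G' (s v : R) : R := s * (- s * (4^-1 * expR (- (s * v)))) * (g v ^+ 2 * w v) +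
  s * wt (s * v) * ((g' v * g v + g v * g' v) * w v + g v ^+ 2 * (- v * w v)).

Let dG (s v : R) : is_derive v 1 (G s) (G' s v).
Proof.
exact: (isd_mul (isd_cmul s (is_derive_wt s v)) (isd_mul (isd_mul (dg v) (dg v)) (is_derive_gauss_pdf v))).
Qed.

(** Expanding the square [(g' - s a g)^2] bounds the cross term [2 s a g g'] of [G'] by
    [g'^2 + a^2 g^2]; the choice of the weight then leaves at most [- g^2 / 10]. *)
Let G'D (s v : R) : s ^+ 2 = 1 -> 0 <= s * v -> G' s v <= D v.
Proof.
move=> s1 sv; have := wt_ineq sv; rewrite /G' /D.
set a := wt (s * v); set t := 4^-1 * expR _ => H.
have w0 := gauss_pdf_gt0 v.
have : 0 <= (g' v - s * a * g v) ^+ 2 * w v by rewrite mulr_ge0 ?sqr_ge0// ltW.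
have : 0 <= g v ^+ 2 * w v by rewrite mulr_ge0 ?sqr_ge0// ltW.
move=> gw0; have := ler_wpM2r gw0 H.
rewrite sqrrB !exprMn s1 mul1r => H1 H2.
have -> : s * (- s * t) = - t by rewrite mulrA mulrN -expr2 s1 mulN1r.
lra.
Qed.

Let cg : continuous g. Proof. by move=> x; exact: isd_continuous (dg x). Qed.
Let cw : continuous w. Proof. by apply: continuous_normal_pdf; exact: oner_neq0. Qed.

Let csq (h : R -> R) : continuous h -> continuous (fun v => h v ^+ 2 * w v).
Proof.
move=> ch v; apply: (@continuousM _ _ (fun v => h v ^+ 2) w); last exact: cw.
by apply: (@continuousM _ _ h h); exact: ch.
Qed.

Let cD : continuous D.
Proof.
move=> v; apply: (@continuousB _ _ _ (fun v => g' v ^+ 2 * w v) (fun v => 10^-1 * (g v ^+ 2 * w v))).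
  exact: csq.
by apply: (@continuousM _ _ (fun=> 10^-1) (fun v => g v ^+ 2 * w v)); [exact: cvg_cst|exact: csq].
Qed.

Let cG' s : continuous (G' s).
Proof.
have cwt : continuous (fun v => wt (s * v)) by move=> v; exact: isd_continuous (is_derive_wt s v).
have ce : continuous (fun v : R => - s * (4^-1 * expR (- (s * v)))).
  have -> : (fun v : R => - s * (4^-1 * expR (- (s * v)))) = (fun v => - s * wt (s * v) + s / 8).
    by apply/funext => v; rewrite /wt; field.
  by apply: cont_add; [apply: cont_mul => //|]; exact: cont_cst.
have ci : continuous (fun v : R => - v * w v).
  have -> : (fun v : R => - v * w v) = (fun v => -1 * v * w v) by apply/funext => v; rewrite mulN1r.
  by do 2 apply: cont_mul => //; [exact: cont_cst|exact: cont_id].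
apply: cont_add; apply: cont_mul.
- by apply: cont_mul => //; exact: cont_cst.
- exact: csq.
- by apply: cont_mul => //; exact: cont_cst.
- apply: cont_add; apply: cont_mul => //; first by apply: cont_add; apply: cont_mul.
  exact: cont_mul.
Qed.

Let int a b (h : R -> R) : continuous h -> leb.-integrable `[a, b] (EFin \o h).
Proof.
by move=> ch; apply: continuous_compact_integrable;
  [exact: segment_compact|exact: continuous_subspaceT].
Qed.

Let G0 s : G s 0 = 0.
Proof. by rewrite /G g0 expr0n /= mul0r mulr0. Qed.

Let half_pos b : 0 <= b -> 0 <= \int[leb]_(v in `[0, b]) D v.
Proof.
move=> b0; apply: le_trans (_ : \int[leb]_(v in `[0, b]) G' 1 v <= _); last first.
  apply: le_Rintegral => //; [exact: int|exact: int|].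
  by move=> v; rewrite /= in_itv/= => /andP[v0 _]; rewrite G'D ?expr1n ?mul1r.
rewrite (Rintegral_derivT b0 (dG 1) (@cG' 1)) G0 subr0.
rewrite /G !mul1r; apply: mulr_ge0; first exact: wt_ge0.
apply: mulr_ge0; first exact: sqr_ge0.
exact: ltW (gauss_pdf_gt0 _).
Qed.

Let half_neg b : 0 <= b -> 0 <= \int[leb]_(v in `[- b, 0]) D v.
Proof.
move=> b0; apply: le_trans (_ : \int[leb]_(v in `[- b, 0]) G' (-1) v <= _); last first.
  apply: le_Rintegral => //; [exact: int|exact: int|].
  by move=> v; rewrite /= in_itv/= => /andP[_ v0]; rewrite G'D ?sqrrN ?expr1n ?mulN1r ?oppr_ge0.
have nb : - b <= 0 by rewrite oppr_le0.
rewrite (Rintegral_derivT nb (dG (-1)) (@cG' (-1))) G0 sub0r.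
rewrite /G !mulN1r opprK mulNr opprK.
apply: mulr_ge0; first exact: wt_ge0.
apply: mulr_ge0; first exact: sqr_ge0.
exact: ltW (gauss_pdf_gt0 _).
Qed.

(** Integrate [G'D] over [[- n, 0]] and [[0, n]] and let [n] grow. The normalization is by the value
    at 0 instead of the mean: applied to [g - g 0] it still controls the variance, which is the
    smallest second moment about a constant. *)
Lemma poincare_gauss0 :
  gauss.-integrable setT (EFin \o (fun v => g v ^+ 2)) ->
  gauss.-integrable setT (EFin \o (fun v => g' v ^+ 2)) ->
  \int[gauss]_v (g v ^+ 2) <= 10 * \int[gauss]_v (g' v ^+ 2).
Proof.
move=> ig ig'.
have mg : measurable_fun setT (fun v => g v ^+ 2) by apply/measurable_EFinP; case/integrableP : ig.
have mg' : measurable_fun setT (fun v => g' v ^+ 2) by apply/measurable_EFinP; case/integrableP : ig'.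
rewrite !Rintegral_gauss//.
have jg := (integrable_gauss mg).1 ig; have jg' := (integrable_gauss mg').1 ig'.
have jg10 : leb.-integrable setT (EFin \o (fun v => 10^-1 * (g v ^+ 2 * w v))).
  exact: (integrableZl measurableT 10^-1 jg).
suff : 0 <= \int[leb]_v D v.
  rewrite RintegralB// RintegralZl// subr_ge0 mulrC ler_pdivrMr// [_ * 10]mulrC; exact.
have jD : leb.-integrable setT (EFin \o D) by exact: (integrableB measurableT jg' jg10).
have lD := cvg_Rintegral_itvNn jD.
rewrite -(cvg_lim _ lD)//; apply: limr_ge; first exact: cvgP lD.
apply: nearW => n.
have n0 : 0 <= n%:R :> R by [].
have nn : - n%:R <= 0 :> R by rewrite oppr_le0.
have := @Rintegral_itvB _ D (BLeft (- n%:R)) (BRight n%:R) 0 (int _ _ cD).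
rewrite !bnd_simp => /(_ nn n0)/eqP; rewrite subr_eq => /eqP ->.
rewrite addr_ge0//; last exact: half_neg.
rewrite Rintegral_itv_obnd_cbnd; first exact: half_pos.
by apply: integrableS (int 0 n%:R cD) => //; apply: subset_itvr; rewrite bnd_simp.
Qed.
End Poincare.
End GaussMoments.

(** * The primitive kernel of the torus *)

Section Torus.
Context {R : realType} {ell : R} (ell_gt0 : 0 < ell).
Local Notation leb := (@lebesgue_measure R).
Local Notation torus := (torus_prob ell_gt0).

Let p := uniform_pdf (0 : R) ell.

Let torusE A : measurable A -> torus A = (\int[leb]_(x in A) (p x)%:E)%E.
Proof. by []. Qed.

Let p_ge0 x : 0 <= p x. Proof. exact: uniform_pdf_ge0. Qed.

Let torus_pdfE (f : R -> R) : (fun x => f x * p x) = (fun x => ell^-1 * f x) \_ `[0, ell].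
Proof.
apply/funext => x; rewrite patchE /p /uniform_pdf subr0.
have [xi|xi] := boolP (0 <= x <= ell).
  by rewrite mem_set/= ?in_itv// mulrC.
by rewrite memNset/= ?mulr0// in_itv/=; exact/negP.
Qed.

Lemma Rintegral_torus (f : R -> R) : measurable_fun setT f ->
  torus.-integrable setT (EFin \o f) ->
  \int[torus]_x f x = ell^-1 * \int[leb]_(x in `[0, ell]) f x.
Proof.
move=> mf fi.
have mp : measurable_fun setT p by exact: measurable_uniform_pdf.
rewrite (@Rintegral_density _ _ _ leb torus p mp p_ge0 torusE)//.
have := (@integrable_density _ _ _ leb torus p mp p_ge0 torusE f mf).1 fi.
rewrite torus_pdfE -restrict_EFin => H0.
have H1 : leb.-integrable `[0, ell] (EFin \o (fun x => ell^-1 * f x)).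
  by apply/(integrable_mkcond _ _).2.
have H : leb.-integrable `[0, ell] (EFin \o f).
  have mI : @measurable _ (measurableTypeR R) `[0, ell]%classic by exact: measurable_itv.
  have := integrableZl mI ell H1; apply: eq_integrable => // x _ /=.
  by rewrite -EFinM mulVKf// gt_eqF.
by rewrite -Rintegral_mkcond RintegralZl.
Qed.

Lemma torus_ae : {ae torus, forall x, 0 < x < ell}.
Proof.
exists (~` `]0, ell[%classic); split.
- by apply: measurableC; exact: measurable_itv.
- rewrite torusE /p; last by apply: measurableC; exact: measurable_itv.
  rewrite integral_uniform_pdf null_set_integral//.
  + by apply: measurableI; [apply: measurableC|]; exact: measurable_itv.
  + by apply: measurable_funTS; apply: measurableT_comp => //; exact: measurable_uniform_pdf.
  + have s : ~` `]0, ell[ `&` `[0, ell] `<=` [set 0] `|` [set ell].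
      move=> x [/=]; rewrite !in_itv/= => nx /andP[x0 xl].
      have [->|x0'] := eqVneq x 0; first by left.
      have [->|xl'] := eqVneq x ell; first by right.
      by exfalso; apply: nx; rewrite !lt_neqAle x0 xl (eq_sym 0) x0' xl'.
    apply/eqP; rewrite eq_le measure_ge0 andbT.
    apply: le_trans (le_measure leb _ _ s) _; rewrite ?inE.
    * by apply: measurableI; [apply: measurableC|]; exact: measurable_itv.
    * by apply: measurableU; exact: measurable_set1.
    * have H := @measureU2 _ _ _ leb [set 0] [set ell] (measurable_set1 _) (measurable_set1 _).
      apply: le_trans H _.
      have l1 (r : R) : (leb [set r] <= 0)%E by have -> := lebesgue_measure_set1 r.
      by rewrite -[leRHS]adde0; apply: leeD; exact: l1.
- by move=> x /= H; rewrite in_itv.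
Qed.

(* [torus_ker x] is the mean-zero primitive kernel of the torus: integrating it against
   [phi'] recovers [phi - mean phi], up to the factor [ell]. *)
Definition torus_ker (x y : R) : R :=
  if (0 < x < ell) && (0 < y < ell) then Num.sg (x - y) / 2 + (y - x) / ell else 0.

Lemma torus_ker_anti x y : torus_ker x y = - torus_ker y x.
Proof.
rewrite /torus_ker andbC; case: ifP => _; last by rewrite oppr0.
by rewrite -[x - y]opprB sgrN; field; rewrite gt_eqF.
Qed.

Lemma torus_ker_bound x y : `|torus_ker x y| <= 1.
Proof.
rewrite /torus_ker; case: ifP => [|_]; last by rewrite normr0.
move=> /andP[/andP[x0 xl] /andP[y0 yl]].
have [xy|xy|->] := ltgtP x y.
- rewrite ltr0_sg ?subr_lt0// ler_norml; apply/andP.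
  have : 0 <= (y - x) / ell by rewrite divr_ge0 ?ltW// subr_gt0.
  have : (y - x) / ell <= 1 by rewrite ler_pdivrMr// mul1r; lra.
  by split; lra.
- rewrite gtr0_sg ?subr_gt0// ler_norml; apply/andP.
  have : (y - x) / ell <= 0 by rewrite ler_pdivrMr// mul0r; lra.
  have : -1 <= (y - x) / ell by rewrite ler_pdivlMr// mulN1r; lra.
  by split; lra.
- by rewrite !subrr sgr0 !mul0r addr0 normr0.
Qed.

Lemma measurable_torus_ker : measurable_fun setT (fun z : R * R => torus_ker z.1 z.2).
Proof.
have msub : measurable_fun setT (fun z : R * R => z.1 - z.2) by exact: measurable_funB.
apply: measurable_fun_ifT => //.
  by repeat (apply: measurable_and => //); exact: measurable_fun_ltr.
apply: measurable_funD; last by apply: measurable_funM => //; exact: measurable_funB.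
apply: measurable_funM => //.
have -> : (fun z : R * R => Num.sg (z.1 - z.2)) =
  (fun z => if z.1 < z.2 then -1 else if z.1 == z.2 then 0 else 1).
  apply/funext => z; have [h|h|h] := ltgtP z.1 z.2.
  - by rewrite ltr0_sg// subr_lt0.
  - by rewrite gtr0_sg// subr_gt0.
  - by rewrite h subrr sgr0.
by apply: measurable_fun_ifT => //; [exact: measurable_fun_ltr|apply: measurable_fun_ifT => //; exact: measurable_fun_eqr].
Qed.

Lemma integrable_torus_cont (h : R -> R) : continuous h -> torus.-integrable setT (EFin \o h).
Proof.
move=> ch; have mh : measurable_fun setT h by exact: continuous_measurable_fun.
have mp : measurable_fun setT p by exact: measurable_uniform_pdf.
apply/(@integrable_density _ _ _ leb torus p mp p_ge0 torusE h mh).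
rewrite torus_pdfE -restrict_EFin; apply/(integrable_mkcond _ _).1; first exact: measurable_itv.
apply: continuous_compact_integrable; first exact: segment_compact.
by apply: continuous_subspaceT; apply: cont_mul => //; exact: cont_cst.
Qed.

Let eq_Rintegral_oo (f g : R -> R) a b : a < b -> measurable_fun setT f -> measurable_fun setT g ->
  (forall x, a < x < b -> f x = g x) ->
  \int[leb]_(x in `[a, b]) f x = \int[leb]_(x in `[a, b]) g x.
Proof.
move=> ab mf mg fg; rewrite /Rintegral; congr fine.
have ms (h : R -> R) D : measurable_fun setT h -> measurable_fun D (EFin \o h).
  by move=> mh; apply/measurable_EFinP; exact: measurable_funTS.
rewrite -[LHS]integral_itv_bndo_bndc; last exact: (ms f).
rewrite -[RHS]integral_itv_bndo_bndc; last exact: (ms g).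
rewrite -[LHS]integral_itv_obnd_cbnd; last exact: (ms f).
rewrite -[RHS]integral_itv_obnd_cbnd; last exact: (ms g).
by apply: eq_integral => x; rewrite inE/= in_itv/= => /fg ->.
Qed.

(** Cut at the jump [y = x]: on each side the kernel is affine in [y], with slope [ell^-1] and value
    [2^-1] or [- 2^-1] at the jump. Integration by parts produces the mean from the slope and
    [phi x] from the unit jump. The boundary term is kept so that the formula covers [phi = id],
    from which [torus_ker_cst] follows. *)
Lemma torus_ker_deriv (phi phi' : R -> R) (x : R) :
  (forall y : R, is_derive y 1 phi (phi' y)) -> continuous phi' -> 0 < x < ell ->
  ell * \int[torus]_y (torus_ker x y * phi' y) =
  phi x + (2^-1 - x / ell) * (phi ell - phi 0) - \int[torus]_y phi y.
Proof.
move=> dphi cphi' /andP[x0 xl].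
have cphi : continuous phi by move=> y; exact: isd_continuous (dphi y).
have int a b (h : R -> R) : continuous h -> leb.-integrable `[a, b] (EFin \o h).
  by move=> ch; apply: continuous_compact_integrable;
    [exact: segment_compact|exact: continuous_subspaceT].
have mker : measurable_fun setT (torus_ker x).
  exact: (measurableT_comp measurable_torus_ker (pair1_measurable x)).
have mkp : measurable_fun setT (fun y => torus_ker x y * phi' y).
  by apply: measurable_funM => //; exact: continuous_measurable_fun.
have iker : torus.-integrable setT (EFin \o (fun y => torus_ker x y * phi' y)).
  have := integrable_torus_cont cphi'; apply: le_integrable => //.
    exact/measurable_EFinP.
  move=> y _ /=; rewrite lee_fin normrM ler_piMl//; exact: torus_ker_bound.
have iker' : leb.-integrable `[0, ell] (EFin \o (fun y => torus_ker x y * phi' y)).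
  apply: le_integrable (int 0 ell _ cphi') => //; first exact/measurable_funTS/measurable_EFinP.
  move=> y _ /=; rewrite lee_fin normrM ler_piMl//; exact: torus_ker_bound.
rewrite Rintegral_torus// mulVKf ?gt_eqF//.
rewrite Rintegral_torus//; [|exact: continuous_measurable_fun|exact: integrable_torus_cont].
have split (h : R -> R) : leb.-integrable `[0, ell] (EFin \o h) ->
    \int[leb]_(y in `[0, ell]) h y = \int[leb]_(y in `[0, x]) h y + \int[leb]_(y in `[x, ell]) h y.
  move=> ih; have := @Rintegral_itvB _ h (BLeft 0) (BRight ell) x ih.
  rewrite !bnd_simp => /(_ (ltW x0) (ltW xl))/eqP; rewrite subr_eq => /eqP ->.
  rewrite addrC Rintegral_itv_obnd_cbnd//.
  by apply: integrableS ih => //; apply: subset_itvr; rewrite bnd_simp ltW.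
rewrite (split _ iker') (split _ (int 0 ell _ cphi)).
have part c a b : a <= b -> \int[leb]_(y in `[a, b]) ((c + (y - x) / ell) * phi' y) =
    (c + (b - x) / ell) * phi b - (c + (a - x) / ell) * phi a - ell^-1 * \int[leb]_(y in `[a, b]) phi y.
  move=> ab.
  have cc : continuous (fun y => (c + (y - x) / ell) * phi' y).
    apply: cont_mul => //; apply: cont_add; first exact: cont_cst.
    by apply: cont_mul; [apply: cont_sub; [exact: cont_id|exact: cont_cst]|exact: cont_cst].
  have dd (y : R) : is_derive y 1 (fun y => (c + (y - x) / ell) * phi y) (ell^-1 * phi y + (c + (y - x) / ell) * phi' y).
    have H := isd_add (isd_cst c y) (isd_mul (isd_sub (isd_id y) (isd_cst x y)) (isd_cst ell^-1 y)).
    by apply: (is_derive_eq (isd_mul H (dphi y))); ring.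
  have := Rintegral_derivT ab dd.
  rewrite RintegralD//; [|apply: int; apply: cont_mul => //; exact: cont_cst|exact: int].
  rewrite RintegralZl//; last exact: int.
  by move=> <-; [ring|apply: cont_add => //; apply: cont_mul => //; exact: cont_cst].
have -> : \int[leb]_(y in `[0, x]) (torus_ker x y * phi' y) =
    \int[leb]_(y in `[0, x]) ((2^-1 + (y - x) / ell) * phi' y).
  apply: eq_Rintegral_oo => //.
    apply: continuous_measurable_fun; apply: cont_mul => //; apply: cont_add; first exact: cont_cst.
    by apply: cont_mul; [apply: cont_sub; [exact: cont_id|exact: cont_cst]|exact: cont_cst].
  move=> y /andP[y0 yx]; rewrite /torus_ker x0 xl y0 (lt_trans yx xl)/=.
  by rewrite gtr0_sg ?subr_gt0// div1r.
have -> : \int[leb]_(y in `[x, ell]) (torus_ker x y * phi' y) =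
    \int[leb]_(y in `[x, ell]) ((- 2^-1 + (y - x) / ell) * phi' y).
  apply: eq_Rintegral_oo => //.
    apply: continuous_measurable_fun; apply: cont_mul => //; apply: cont_add; first exact: cont_cst.
    by apply: cont_mul; [apply: cont_sub; [exact: cont_id|exact: cont_cst]|exact: cont_cst].
  move=> y /andP[xy yl]; rewrite /torus_ker x0 xl yl (lt_trans x0 xy)/=.
  by rewrite ltr0_sg ?subr_lt0// mulN1r.
rewrite !part ?ltW//; field; rewrite gt_eqF//.
Qed.

Lemma torus_ker_cst x : 0 < x < ell -> \int[torus]_y torus_ker x y = 0.
Proof.
move=> xi; have := torus_ker_deriv isd_id (@cont_cst R 1) xi.
rewrite (@Rintegral_torus id)//; last exact: integrable_torus_cont cont_id.
have dq (y : R) : is_derive y 1 (fun y : R => 2^-1 * (y * y)) y.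
  by apply: (is_derive_eq (isd_cmul 2^-1 (isd_mul (isd_id y) (isd_id y)))); field.
rewrite (Rintegral_derivT (ltW ell_gt0) dq cont_id).
have -> : x + (2^-1 - x / ell) * (ell - 0) - ell^-1 * (2^-1 * (ell * ell) - 2^-1 * (0 * 0)) = 0.
  by field; rewrite gt_eqF.
move/eqP; rewrite mulf_eq0 gt_eqF//= => /eqP.
by under eq_Rintegral do rewrite mulr1.
Qed.

Lemma torus_deriv_eq0 (phi phi' : R -> R) :
  (forall y : R, is_derive y 1 phi (phi' y)) -> continuous phi' -> phi ell = phi 0 ->
  \int[torus]_y phi' y = 0.
Proof.
move=> dphi cphi' per.
rewrite Rintegral_torus; [|exact: continuous_measurable_fun|exact: integrable_torus_cont].
by rewrite (Rintegral_derivT (ltW ell_gt0) dphi cphi') per subrr mulr0.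
Qed.
End Torus.
Arguments torus_ker {R} ell x y.

(** * Integrals over phase space *)

Section PhaseIntegrals.
Context {R : realType} {ell : R} (ell_gt0 : 0 < ell).
Local Notation torus := (torus_prob ell_gt0).
Local Notation gauss := (@gauss_prob R).
Local Notation P := (phase_prob ell_gt0).
Implicit Types h a : R * R -> R.

(** Growth classes in [v], uniform in [x]: [growth4] functions are integrable on phase space, and
    [moderate] ones are square integrable because a product of two of them is [growth4]. *)
Definition growth4 h := measurable_fun setT h /\ exists M, forall z, `|h z| <= M * (1 + z.2 ^+ 4).

Definition moderate h := measurable_fun setT h /\ exists M, forall z, `|h z| <= M * (1 + z.2 ^+ 2).

Definition bounded_meas a := measurable_fun setT a /\ exists M, forall z, `|a z| <= M.

(** Kept as a function on phase space, constant in [v], so that it can be subtracted from [h] or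
    multiplied with it directly. *)
Definition vavg h : R * R -> R := fun z => \int[gauss]_v h (z.1, v).

Lemma bounded_moderate a : bounded_meas a -> moderate a.
Proof.
move=> [ma [M aM]]; split=> //; exists M => z; apply: le_trans (aM z) _.
have M0 := le_trans (normr_ge0 _) (aM z).
by rewrite ler_peMr// lerDl sqr_ge0.
Qed.

Lemma moderate_cst c : moderate (fun=> c).
Proof. by apply: bounded_moderate; split; [exact: measurable_cst|exists `|c|]. Qed.

Lemma moderate_v : moderate (fun z => z.2).
Proof.
split; first exact: measurable_snd.
exists 1 => z; rewrite mul1r -(real_normK (num_real z.2)).
have : 0 <= (`|z.2| - 1) ^+ 2 by rewrite sqr_ge0.
have : 0 <= `|z.2| by [].
rewrite !expr2; nra.
Qed.

Lemma moderate_v2 : moderate (fun z => z.2 ^+ 2).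
Proof.
split; first by apply: measurable_funX; exact: measurable_snd.
by exists 1 => z; rewrite mul1r ger0_norm ?sqr_ge0// lerDr.
Qed.

Lemma moderateMb a h : bounded_meas a -> moderate h -> moderate (fun z => a z * h z).
Proof.
move=> [ma [M aM]] [mh [N hN]]; split; first exact: measurable_funM.
exists (M * N) => z; rewrite normrM -mulrA.
by apply: ler_pM.
Qed.

Lemma bounded_cst c : bounded_meas (fun=> c).
Proof. by split; [exact: measurable_cst|exists `|c|]. Qed.

Lemma boundedD a b : bounded_meas a -> bounded_meas b -> bounded_meas (fun z => a z + b z).
Proof.
move=> [ma [M aM]] [mb [N bN]]; split; first exact: measurable_funD.
by exists (M + N) => z; apply: le_trans (ler_normD _ _) (lerD _ _).
Qed.

Lemma boundedM a b : bounded_meas a -> bounded_meas b -> bounded_meas (fun z => a z * b z).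
Proof.
move=> [ma [M aM]] [mb [N bN]]; split; first exact: measurable_funM.
by exists (M * N) => z; rewrite normrM ler_pM.
Qed.

Lemma boundedN a : bounded_meas a -> bounded_meas (fun z => - a z).
Proof. by move=> /(boundedM (bounded_cst (-1))); under eq_fun do rewrite mulN1r. Qed.

Lemma boundedB a b : bounded_meas a -> bounded_meas b -> bounded_meas (fun z => a z - b z).
Proof. by move=> ba bb; apply: (boundedD ba); exact: boundedN. Qed.

Lemma moderateM_growth4 h k : moderate h -> moderate k -> growth4 (fun z => h z * k z).
Proof.
move=> [mh [M hM]] [mk [N kN]]; split; first exact: measurable_funM.
exists (M * N * 2) => z; rewrite normrM.
apply: le_trans (ler_pM _ _ (hM z) (kN z)) _ => //.
have M0 : 0 <= M by have := le_trans (normr_ge0 _) (hM (0, 0)); rewrite expr0n/= addr0 mulr1.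
have N0 : 0 <= N by have := le_trans (normr_ge0 _) (kN (0, 0)); rewrite expr0n/= addr0 mulr1.
have -> : M * (1 + z.2 ^+ 2) * (N * (1 + z.2 ^+ 2)) = M * N * (1 + z.2 ^+ 2) ^+ 2 by ring.
rewrite -[leRHS]mulrA ler_wpM2l ?mulr_ge0//.
have -> : z.2 ^+ 4 = z.2 ^+ 2 * z.2 ^+ 2 by rewrite -exprD.
have : 0 <= (z.2 ^+ 2 - 1) ^+ 2 by rewrite sqr_ge0.
by rewrite !expr2; lra.
Qed.

Lemma moderate_growth4 h : moderate h -> growth4 h.
Proof.
move=> mh; have := moderateM_growth4 mh (moderate_cst 1).
by under eq_fun do rewrite mulr1.
Qed.

Lemma growth4_integrable_v h x : growth4 h -> gauss.-integrable setT (EFin \o (fun v => h (x, v))).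
Proof.
move=> [mh [M hM]]; apply: (@integrable_gauss_growth _ _ M) => [|v]; last exact: hM (x, v).
exact: (measurableT_comp mh (pair1_measurable x)).
Qed.

Lemma growth4_integrable h : growth4 h -> P.-integrable setT (EFin \o h).
Proof.
move=> gh; have [mh [M hM]] := gh.
apply/integrable12ltyP; first exact/measurable_EFinP.
have i4 : gauss.-integrable setT (EFin \o (fun v : R => M * (1 + v ^+ 4))).
  apply: (@growth4_integrable_v (fun z => M * (1 + z.2 ^+ 4)) 0); split.
    by apply: measurable_funM => //; apply: measurable_funD => //; apply: measurable_funX.
  exists M => z; rewrite ger0_norm//; exact: le_trans (normr_ge0 _) (hM z).
pose c : R := \int[gauss]_v (M * (1 + v ^+ 4)).
apply: (@le_lt_trans _ _ (\int[torus]_x c%:E)%E); last first.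
  rewrite integral_cst//; apply: lte_mul_pinfty; rewrite ?lee_fin ?ltry//.
    apply: Rintegral_ge0 => v _; exact: le_trans (normr_ge0 _) (hM (0, v)).
  have := @probability_setT _ _ _ (torus : probability _ R).
  by move=> H; apply: (@le_lt_trans _ _ 1%E); [rewrite -H|rewrite ltry].
have mabs : measurable_fun setT (abse \o (EFin \o h)).
  by apply: measurableT_comp => //; exact/measurable_EFinP.
apply: ge0_le_integral => //.
- by move=> x _; apply: integral_ge0 => v _.
- exact: (@measurable_fun_fubini_tonelli_F _ _ _ _ R gauss (abse \o (EFin \o h)) mabs (fun=> abse_ge0 _)).
- move=> x _; rewrite /c /Rintegral fineK; last exact: integrable_fin_num.
  apply: ge0_le_integral => //.
  + exact: (measurableT_comp mabs (pair1_measurable x)).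
  + by case/integrableP : i4.
  + by move=> v _; rewrite lee_fin; exact: (hM (x, v)).
Qed.

Lemma moderate_Lfun2 h : moderate h -> h \in Lfun P 2%:E.
Proof.
move=> mh; apply: Lfun2P; first by case: mh.
exact: growth4_integrable (moderateM_growth4 mh mh).
Qed.

Lemma vavg_measurable h : growth4 h -> measurable_fun setT (vavg h).
Proof.
move=> gh; have := measurable_fubini_F (growth4_integrable gh).
move=> mF; rewrite /vavg.
have : measurable_fun setT (fun x => \int[gauss]_v h (x, v)).
  by exact: (measurableT_comp (fine_measurable measurableT) mF).
by move=> H; exact: (measurableT_comp H measurable_fst).
Qed.

Lemma vavg_bounded h : growth4 h -> bounded_meas (vavg h).
Proof.
move=> gh; split; first exact: vavg_measurable.
have [mh [M hM]] := gh.
pose k (z : R * R) := M * (1 + z.2 ^+ 4).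
have gk : growth4 k.
  split; first by apply: measurable_funM => //; apply: measurable_funD => //; apply: measurable_funX.
  exists M => z; rewrite ger0_norm//; exact: le_trans (normr_ge0 _) (hM z).
exists (vavg k (0, 0)) => z.
apply: le_trans (le_normr_Rintegral _ (growth4_integrable_v z.1 gh)) _ => //.
apply: le_Rintegral => //.
- by apply: integrable_norm => //; exact: (growth4_integrable_v z.1 gh).
- exact: (growth4_integrable_v 0 gk).
Qed.

Lemma fubini_xv h : growth4 h -> \int[P]_z h z = \int[torus]_x \int[gauss]_v h (x, v).
Proof.
move=> gh; rewrite {1}/Rintegral -(integral12_prod_meas1 (growth4_integrable gh)).
congr fine; apply: eq_integral => x _ /=.
by rewrite /fubini_F /Rintegral fineK//; exact: integrable_fin_num (growth4_integrable_v x gh).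
Qed.
End PhaseIntegrals.

(** * Integrals against a bounded kernel on a product of probability spaces *)

Section ProductKernel.
Context d1 d2 {T1 : measurableType d1} {T2 : measurableType d2} {R : realType}.
Context (m1 : probability T1 R) (m2 : probability T2 R).
Context (a : T1 -> R) (K : T1 * T2 -> R) (g : T2 -> R).
Hypothesis ia : m1.-integrable setT (EFin \o a).
Hypothesis ig : m2.-integrable setT (EFin \o g).
Hypothesis mK : measurable_fun setT K.
Hypothesis K1 : forall u, `|K u| <= 1.

Let F (u : T1 * T2) := a u.1 * K u * g u.2.

Let ma : measurable_fun setT a. Proof. by apply/measurable_EFinP; case/integrableP : ia. Qed.
Let mg : measurable_fun setT g. Proof. by apply/measurable_EFinP; case/integrableP : ig. Qed.

Let mF : measurable_fun setT F.
Proof.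
apply: measurable_funM; last exact: (measurableT_comp mg measurable_snd).
by apply: measurable_funM => //; exact: (measurableT_comp ma measurable_fst).
Qed.

Let iKg x : m2.-integrable setT (EFin \o (fun y => K (x, y) * g y)).
Proof.
apply: le_integrable ig => //.
  apply/measurable_EFinP; apply: measurable_funM => //.
  exact: (measurableT_comp mK (pair1_measurable x)).
by move=> y _ /=; rewrite lee_fin normrM ler_piMl.
Qed.

Let iaK y : m1.-integrable setT (EFin \o (fun x => a x * K (x, y))).
Proof.
apply: le_integrable ia => //.
  apply/measurable_EFinP; apply: measurable_funM => //.
  exact: (measurableT_comp mK (pair2_measurable y)).
by move=> x _ /=; rewrite lee_fin normrM ler_piMr.
Qed.

Let absF_le : (\int[m1]_x \int[m2]_y `|(EFin \o F) (x, y)| <=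
  (\int[m1]_x `|a x| * \int[m2]_y `|g y|)%:E)%E.
Proof.
have nia := integrable_norm ia. have nig := integrable_norm ig.
have mAF : measurable_fun setT (abse \o (EFin \o F)).
  by apply: measurableT_comp => //; exact/measurable_EFinP.
pose G := \int[m2]_y `|g y|.
have GE : G%:E = (\int[m2]_y `|g y|%:E)%E.
  by rewrite /G /Rintegral fineK//; exact: (integrable_fin_num measurableT nig).
have GG : 0 <= G by exact: Rintegral_ge0.
apply: (@le_trans _ _ (\int[m1]_x (`|a x| * G)%:E)%E); last first.
  rewrite -/G -RintegralZr//.
  rewrite /Rintegral fineK//; apply: integrable_fin_num => //.
  by have := integrableZr measurableT G nia.
apply: ge0_le_integral => //.
- by move=> x _; apply: integral_ge0 => v _.
- exact: (@measurable_fun_fubini_tonelli_F _ _ _ _ R m2 (abse \o (EFin \o F)) mAF (fun=> abse_ge0 _)).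
- by apply/measurable_EFinP; apply: measurable_funM => //; exact: measurableT_comp.
- move=> x _; rewrite EFinM GE -ge0_integralZl//; last first.
    by apply/measurable_EFinP; exact: measurableT_comp.
  apply: ge0_le_integral => //.
  + exact: (measurableT_comp mAF (pair1_measurable x)).
  + by apply/measurable_EFinP; apply: measurable_funM => //; exact: measurableT_comp.
  + move=> y _ /=; rewrite lee_fin !normrM ler_wpM2r// ler_piMr//.
Qed.

Lemma kernel_integrable : (m1 \x m2)%E.-integrable setT (EFin \o F).
Proof.
apply/integrable12ltyP; first exact/measurable_EFinP.
by apply: le_lt_trans absF_le _; rewrite ltry.
Qed.

Lemma kernel_bound : `|\int[(m1 \x m2)%E]_u F u| <= \int[m1]_x `|a x| * \int[m2]_y `|g y|.
Proof.
apply: le_trans (le_normr_Rintegral measurableT kernel_integrable) _.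
rewrite -lee_fin; apply: le_trans absF_le.
have iF := integrable_norm kernel_integrable.
rewrite /Rintegral fineK; last exact: (integrable_fin_num measurableT iF).
by rewrite -(integral12_prod_meas1 iF).
Qed.

Lemma kernel_fubini12 : \int[(m1 \x m2)%E]_u F u = \int[m1]_x (a x * \int[m2]_y (K (x, y) * g y)).
Proof.
rewrite {1}/Rintegral -(integral12_prod_meas1 kernel_integrable).
congr fine; apply: eq_integral => x _; rewrite /fubini_F -RintegralZl// /Rintegral fineK.
  by apply: eq_integral => y _; rewrite /F/= mulrA.
by apply: integrable_fin_num => //; exact: (integrableZl measurableT (a x) (iKg x)).
Qed.

Lemma kernel_fubini21 : \int[(m1 \x m2)%E]_u F u = \int[m2]_y ((\int[m1]_x (a x * K (x, y))) * g y).
Proof.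
rewrite {1}/Rintegral -(integral21_prod_meas1 kernel_integrable).
congr fine; apply: eq_integral => y _; rewrite /fubini_G -RintegralZr// /Rintegral fineK//.
by apply: integrable_fin_num => //; exact: (integrableZr measurableT (g y) (iaK y)).
Qed.
End ProductKernel.

Section PhaseForms.
Context {R : realType} {ell : R} (ell_gt0 : 0 < ell).
Local Notation torus := (torus_prob ell_gt0).
Local Notation gauss := (@gauss_prob R).
Local Notation P := (phase_prob ell_gt0).
Local Notation nrm := (nrm2 P).
Local Notation L2fun := (Lfun P 2%:E).
Implicit Types f g h a : R * R -> R.

Lemma growth4_integrable_x h v : growth4 h -> torus.-integrable setT (EFin \o (fun x => h (x, v))).
Proof.
move=> [mh [M hM]].
have H : torus.-integrable setT (EFin \o (fun _ : R => M * (1 + v ^+ 4))).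
  exact: finite_measure_integrable_cst.
apply: le_integrable H => //.
  by apply/measurable_EFinP; exact: (measurableT_comp mh (pair2_measurable v)).
by move=> x _ /=; rewrite lee_fin (le_trans (hM (x, v)))// ler_norm.
Qed.

Lemma fubini_vx h : growth4 h -> \int[P]_z h z = \int[gauss]_v \int[torus]_x h (x, v).
Proof.
move=> gh; rewrite {1}/Rintegral -(integral21_prod_meas1 (growth4_integrable ell_gt0 gh)).
congr fine; apply: eq_integral => v _ /=.
by rewrite /fubini_G /Rintegral fineK//; exact: integrable_fin_num (growth4_integrable_x v gh).
Qed.

Lemma Rintegral_probability_cst d {T : measurableType d} (m : probability T R) (c : R) :
  \int[m]_x c = c.
Proof.
rewrite Rintegral_cst// -[RHS]mulr1; congr (_ * _).
by rewrite -[RHS]/(fine 1%E); congr fine; exact: (@probability_setT _ _ _ m).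
Qed.

Lemma bounded_growth4 a : bounded_meas a -> growth4 a.
Proof. by move=> /bounded_moderate/moderate_growth4. Qed.

Lemma mean_vavg h : growth4 h -> \int[P]_z vavg h z = \int[P]_z h z.
Proof.
move=> gh; rewrite fubini_vx; last by apply: bounded_growth4; exact: vavg_bounded.
by rewrite /vavg/= Rintegral_probability_cst fubini_xv.
Qed.

Definition xdep a := forall x v w, a (x, v) = a (x, w).

Lemma xdep_vavg h : xdep (vavg h). Proof. by []. Qed.

Lemma vavg_mull a h z : growth4 h -> xdep a -> vavg (fun z => a z * h z) z = a z * vavg h z.
Proof.
move=> gh xa; rewrite /vavg -RintegralZl//; last exact: growth4_integrable_v.
by case: z => x v; apply: eq_Rintegral => w _ /=; rewrite (xa x w v).
Qed.

Lemma vavg_xdep a : xdep a -> vavg a = a.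
Proof.
move=> xa; apply/funext => -[x v]; rewrite /vavg/=.
transitivity (\int[gauss]_w a (x, v)); first by apply: eq_Rintegral => w _; exact: xa.
exact: Rintegral_probability_cst.
Qed.

(** [vavg] is the conditional expectation given [x], so a factor depending on [x] alone passes
    through it. *)
Lemma mean_xdep_mul a h : growth4 h -> bounded_meas a -> xdep a ->
  growth4 (fun z => a z * h z) ->
  \int[P]_z (a z * h z) = \int[P]_z (a z * vavg h z).
Proof.
move=> gh ba xa gah; rewrite -mean_vavg//.
by apply: eq_Rintegral => z _; rewrite vavg_mull.
Qed.

(** The kernel identities are available for [0 < x < ell] only, as [torus_ker] is set to 0
    elsewhere; the remaining [x] form a null set of the torus. *)
Lemma eq_mean_interior f g : growth4 f -> growth4 g ->
  (forall x v, 0 < x < ell -> f (x, v) = g (x, v)) -> \int[P]_z f z = \int[P]_z g z.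
Proof.
move=> gf gg fg; rewrite (fubini_xv ell_gt0 gf) (fubini_xv ell_gt0 gg); congr fine.
have mv h : growth4 h -> measurable_fun setT (fun x => (\int[gauss]_v h (x, v))%:E).
  move=> gh; apply/measurable_EFinP.
  exact: (measurableT_comp (vavg_measurable ell_gt0 gh) (pair2_measurable (0 : R))).
apply: ae_eq_integral => //; [exact: mv|exact: mv|].
have [N [mN N0 sN]] := torus_ae ell_gt0; exists N; split; [exact: mN|exact: N0|].
move=> x nx; apply: sN => x01; apply: nx => _; congr EFin.
by apply: eq_Rintegral => v _; exact: fg.
Qed.

Lemma moderate_L2 h : moderate h -> h \in L2fun.
Proof. exact: moderate_Lfun2. Qed.

Lemma mean_v2 : \int[P]_z (z.2 * z.2) = 1.
Proof.
rewrite fubini_xv; last exact: (moderateM_growth4 moderate_v moderate_v).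
transitivity (\int[torus]_x (1 : R)); last exact: Rintegral_probability_cst.
by apply: eq_Rintegral => x _; apply: etrans gauss_var1; apply: eq_Rintegral => v _; rewrite expr2.
Qed.

Lemma nrm_v : nrm (fun z => z.2) = 1.
Proof.
apply/eqP; rewrite -(eqrXn2 (_ : 0 < 2)%N) ?nrm2_ge0//.
by rewrite sqr_nrm2 ?mean_v2 ?expr1n//; apply: moderate_L2; exact: moderate_v.
Qed.

Lemma nrm_1 : nrm (fun=> 1) = 1.
Proof.
apply/eqP; rewrite -(eqrXn2 (_ : 0 < 2)%N) ?nrm2_ge0//.
rewrite sqr_nrm2 ?expr1n//; last by apply: moderate_L2; exact: moderate_cst.
by under eq_Rintegral do rewrite mulr1; rewrite (@Rintegral_probability_cst _ _ P).
Qed.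

Lemma L2_norm f : f \in L2fun -> (fun z => `|f z|) \in L2fun.
Proof.
move=> f2; apply: Lfun2P.
  by apply: measurableT_comp => //; exact: Lfun2_measurable f2.
have := Lfun2_integrableM f2 f2; apply: eq_integrable => // z _ /=.
by rewrite -normrM ger0_norm// -expr2 sqr_ge0.
Qed.

Lemma nrm_norm f : nrm (fun z => `|f z|) = nrm f.
Proof. by rewrite /nrm2; congr fine; rewrite -[RHS]Lnorm_abse. Qed.

Lemma L1_mul_le h f : h \in L2fun -> f \in L2fun -> \int[P]_z `|h z * f z| <= nrm h * nrm f.
Proof.
move=> h2 f2; rewrite -(nrm_norm h) -(nrm_norm f).
have H := cauchy_schwarz2 (L2_norm h2) (L2_norm f2).
apply: (le_trans _ H); apply: le_trans (ler_norm _); rewrite le_eqVlt; apply/orP; left; apply/eqP.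
by apply: eq_Rintegral => z _; rewrite normrM.
Qed.
End PhaseForms.

(** * The bilinear form coupling flux and density *)

Section BilinearForm.
Context {R : realType} {ell : R} (ell_gt0 : 0 < ell).
Local Notation torus := (torus_prob ell_gt0).
Local Notation gauss := (@gauss_prob R).
Local Notation P := (phase_prob ell_gt0).
Local Notation nrm := (nrm2 P).
Local Notation L2fun := (Lfun P 2%:E).
Implicit Types f g h a : R * R -> R.

Let K (u : (R * R) * (R * R)) : R := torus_ker ell u.1.1 u.2.1.

Lemma measurable_phase_ker :
  measurable_fun setT (fun u : (R * R) * (R * R) => torus_ker ell u.1.1 u.2.1).
Proof.
have mpr : measurable_fun setT (fun u : (R * R) * (R * R) => (u.1.1, u.2.1)).
  apply: measurable_fun_pair.
    exact: (measurableT_comp measurable_fst measurable_fst).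
  exact: (measurableT_comp measurable_fst measurable_snd).
exact: (measurableT_comp (@measurable_torus_ker R ell) mpr).
Qed.

Let mK : measurable_fun setT K := measurable_phase_ker.

Let K1 u : `|K u| <= 1. Proof. exact: torus_ker_bound. Qed.

(** A single integral over two copies of phase space: this makes sense for all square-integrable
    arguments, and Fubini gives both iterated forms, one with the primitive of the density of [g],
    the other with that of the flux of [f]. *)
Definition bform f g : R :=
  \int[(P \x P)%E : probability _ R]_u (u.1.2 * f u.1 * torus_ker ell u.1.1 u.2.1 * g u.2).

Let v2 : (fun z : R * R => z.2) \in L2fun.
Proof. by apply: moderate_L2; exact: moderate_v. Qed.

Let L2_int f : f \in L2fun -> P.-integrable setT (EFin \o f).
Proof.
move=> f2; have := Lfun2_integrableM f2 (moderate_L2 ell_gt0 (moderate_cst (1 : R))).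
by apply: eq_integrable => // z _ /=; rewrite mulr1.
Qed.

Let vf_int f : f \in L2fun -> P.-integrable setT (EFin \o (fun z => z.2 * f z)).
Proof. by move=> f2; exact: Lfun2_integrableM. Qed.

(** A kernel bounded by 1 separates the two variables; Cauchy-Schwarz against [v] and against 1,
    both of norm 1, then bounds each factor. *)
Lemma bform_bound f g : f \in L2fun -> g \in L2fun -> `|bform f g| <= nrm f * nrm g.
Proof.
move=> f2 g2.
have H : `|bform f g| <= \int[P]_z `|z.2 * f z| * \int[P]_z `|g z|.
  exact: (@kernel_bound _ _ _ _ R P P _ K g (vf_int f2) (L2_int g2) mK K1).
apply: le_trans H _.
apply: ler_pM; [exact: Rintegral_ge0|exact: Rintegral_ge0|..].
  by apply: le_trans (L1_mul_le v2 f2) _; rewrite (nrm_v ell_gt0) mul1r.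
have := L1_mul_le (moderate_L2 ell_gt0 (moderate_cst (1 : R))) g2.
by rewrite (nrm_1 ell_gt0) mul1r; under eq_Rintegral do rewrite mul1r.
Qed.

Lemma bform_fubini12 f g : f \in L2fun -> g \in L2fun ->
  bform f g = \int[P]_z (z.2 * f z * \int[P]_y (torus_ker ell z.1 y.1 * g y)).
Proof. by move=> f2 g2; exact: (@kernel_fubini12 _ _ _ _ R P P _ K g (vf_int f2) (L2_int g2) mK K1). Qed.

Lemma bform_fubini21 f g : f \in L2fun -> g \in L2fun ->
  bform f g = \int[P]_y ((\int[P]_z (z.2 * f z * torus_ker ell z.1 y.1)) * g y).
Proof. by move=> f2 g2; exact: (@kernel_fubini21 _ _ _ _ R P P _ K g (vf_int f2) (L2_int g2) mK K1). Qed.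

Lemma bform_linl c f f' g : f \in L2fun -> f' \in L2fun -> g \in L2fun ->
  bform (fun z => c * f z + f' z) g = c * bform f g + bform f' g.
Proof.
move=> f2 f'2 g2; have i1 := kernel_integrable (vf_int f2) (L2_int g2) mK K1.
have i2 := kernel_integrable (vf_int f'2) (L2_int g2) mK K1.
rewrite /bform -RintegralZl// -RintegralD//; last exact: (integrableZl measurableT c i1).
by apply: eq_Rintegral => u _; ring.
Qed.

Lemma bform_linr c f g g' : f \in L2fun -> g \in L2fun -> g' \in L2fun ->
  bform f (fun z => c * g z + g' z) = c * bform f g + bform f g'.
Proof.
move=> f2 g2 g'2; have i1 := kernel_integrable (vf_int f2) (L2_int g2) mK K1.
have i2 := kernel_integrable (vf_int f2) (L2_int g'2) mK K1.
rewrite /bform -RintegralZl// -RintegralD//; last exact: (integrableZl measurableT c i1).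
by apply: eq_Rintegral => u _; ring.
Qed.
End BilinearForm.

(** * Test functions and the kinetic operator *)

Section PlaneContinuity.
Context {R : realType}.
Implicit Types (f : R * R -> R).

(** An open set is a union of squares with rational center and half-side, hence a countable union of
    measurable rectangles. *)
Lemma open_plane_measurable (W : set (R * R)) : open W -> measurable W.
Proof.
move=> oW.
pose box (i : rat * rat * rat) : set (R * R) :=
  `](ratr i.1.1 - ratr i.2), (ratr i.1.1 + ratr i.2)[%classic `*`
  `](ratr i.1.2 - ratr i.2), (ratr i.1.2 + ratr i.2)[%classic.
have -> : W = \bigcup_(i : rat * rat * rat) (if `[< box i `<=` W >] then box i else set0).
  apply/seteqP; split => [z Wz|z [i _]]; last by case: asboolP => // + bz; exact.
  have := oW; rewrite openE => /(_ _ Wz)/nbhs_ballP[e /= e0 eW].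
  have e2 : 0 < e / 2 by rewrite divr_gt0.
  have [r] := rat_in_itvoo e2; rewrite in_itv/= => /andP[r0 re].
  have lt1 (x : R) : x - ratr r < x + ratr r by lra.
  have [p] := rat_in_itvoo (lt1 z.1); have [q] := rat_in_itvoo (lt1 z.2).
  rewrite !in_itv/= => /andP[q1 q2] /andP[p1 p2].
  exists (p, q, r) => //.
  have bW : box (p, q, r) `<=` W.
    move=> y [/=]; rewrite !in_itv/= => /andP[y1 y2] /andP[y3 y4].
    apply: eW; split; rewrite /ball/= ltr_distl; apply/andP; split; lra.
  rewrite asboolT//; split; rewrite /= in_itv/=; apply/andP; split; lra.
apply: countable_bigcupT_measurable => [|i]; first exact: countableP.
case: asboolP => // _.
by apply: measurableX; exact: measurable_itv.
Qed.

Lemma continuous_plane_measurable f : continuous f -> measurable_fun setT f.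
Proof.
move=> cf; apply: (measurability _ (RGenOInfty.measurableE R)) => _ [_ [a ->] <-].
rewrite setTI; apply: open_plane_measurable.
by move/continuousP: cf; apply; apply: itv_open_ends_open.
Qed.

Lemma continuous_section1 f v : continuous f -> continuous (fun x => f (x, v)).
Proof.
move=> cf x; apply: (@continuous_comp _ _ _ (fun x => (x, v)) f); last exact: cf.
exact: (cvg_pair cvg_id (cvg_cst v)).
Qed.

Lemma continuous_section2 f x : continuous f -> continuous (fun v => f (x, v)).
Proof.
move=> cf v; apply: (@continuous_comp _ _ _ (fun v => (x, v)) f); last exact: cf.
exact: (cvg_pair (cvg_cst x) cvg_id).
Qed.
End PlaneContinuity.

Section TestFunctions.
Context {R : realType} {ell : R} (ell_gt0 : 0 < ell).
Implicit Types f : R * R -> R.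
Local Notation test := (test_function ell).

Lemma is_derive_derive1 (g : R -> R) (x : R) : derivable g x 1 -> is_derive x 1 g (g^`()%classic x).
Proof. by move=> dg; rewrite derive1E; exact: derivableP. Qed.

Lemma test_isd_dx f (x v : R) : test f -> is_derive x 1 (fun x : R => f (x, v)) (dx f (x, v)).
Proof. by case=> /(_ 1%N)[d _ _ _] _ _; apply: is_derive_derive1; exact: (d (x, v)). Qed.

Lemma test_isd_dv f (x v : R) : test f -> is_derive v 1 (fun v : R => f (x, v)) (dv f (x, v)).
Proof. by case=> /(_ 1%N)[_ d _ _] _ _; apply: is_derive_derive1; exact: (d (x, v)). Qed.

Lemma test_continuous f : test f -> continuous f.
Proof. by case=> /(_ 0%N). Qed.

Lemma test_dx f : test f -> test (dx f).
Proof.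
move=> tf; have [cf pf [K fK]] := tf; split.
- by move=> n; have [] := cf n.+1.
- move=> x v; rewrite /dx/= /derive1.
  have H y : f (y + (x + ell), v) = f (y + x, v) by rewrite addrA pf.
  by under eq_fun do rewrite H pf.
- exists K => x v Kv; rewrite /dx/=.
  by under eq_fun do rewrite fK//; rewrite derive1_cst.
Qed.

Lemma test_dv f : test f -> test (dv f).
Proof.
move=> tf; have [cf pf [K fK]] := tf; split.
- by move=> n; have [] := cf n.+1.
- move=> x v; rewrite /dv/=.
  by under eq_fun do rewrite pf.
- exists K => x v Kv; rewrite /dv/= derive1E.
  rewrite (@near_eq_derive _ _ _ _ (fun=> 0)) ?derive_cst//.
  have : \forall w \near v, K < `|w|.
    have : {for v, continuous (fun w : R => `|w|)} by exact: norm_continuous.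
    by move/(_ _ (lt_nbhsr Kv)).
  by apply: filterS => w; exact: fK.
Qed.

Lemma periodic_int (g : R -> R) (k : int) x : (forall x, g (x + ell) = g x) -> g (x + ell * k%:~R) = g x.
Proof.
move=> pg.
have pn n y : g (y + ell * n%:R) = g y.
  by elim: n => [|n IH]; rewrite ?mulr0 ?addr0// -natr1 mulrDr mulr1 addrA pg.
case: k => n; first exact: pn.
by rewrite -(pn n.+1) NegzE mulrNz mulrN subrK.
Qed.

(** Translation by a multiple of [ell] brings [x] into [[0, ell]], and the velocity support
    restricts [v] to [[- K, K]]; continuity on this compact set concludes. *)
Lemma test_bounded f : test f -> exists M, forall z, `|f z| <= M.
Proof.
move=> tf; have [_ pf [K fK]] := tf.
have cf := test_continuous tf.
have : compact (f @` (`[0, ell]%classic `*` `[- K, K]%classic)).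
  apply: continuous_compact; first exact: continuous_subspaceT.
  by apply: compact_setX; exact: segment_compact.
move/(@compact_bounded _ R^o) => [M [_ HM]].
exists (`|M| + 1) => -[x v].
have [Kv|vK] := ltP K `|v|; first by rewrite fK// normr0 addr_ge0.
have -> : f (x, v) = f (x + ell * (- Num.floor (x / ell))%:~R, v).
  by rewrite (@periodic_int (fun x => f (x, v))).
apply: HM; first by rewrite (le_lt_trans (ler_norm _))// ltrDl.
exists (x + ell * (- Num.floor (x / ell))%:~R, v) => //; split => /=; rewrite in_itv/=.
  have /andP[h1 h2] := floor_itv (x / ell).
  rewrite intrD in h2; rewrite mulrNz; set k := _%:~R in h1 h2 *.
  rewrite ler_pdivlMr// in h1; rewrite ltr_pdivrMr// in h2.
  apply/andP; split; lra.
by rewrite -ler_norml.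
Qed.

Lemma test_bounded_meas f : test f -> bounded_meas f.
Proof.
move=> tf; split; last exact: test_bounded.
by apply: continuous_plane_measurable; exact: test_continuous.
Qed.

Lemma test_supp f : test f -> exists K, forall x v, K < `|v| -> f (x, v) = 0.
Proof. by case. Qed.

Lemma test_per f x v : test f -> f (x + ell, v) = f (x, v).
Proof. by case. Qed.

Lemma test_vf f : test f -> bounded_meas (fun z => z.2 * f z).
Proof.
move=> tf; have [K fK] := test_supp tf; have [M fM] := test_bounded tf.
have M0 : 0 <= M := le_trans (normr_ge0 _) (fM (0, 0)).
split; first by apply: measurable_funM; [exact: measurable_snd|case: (test_bounded_meas tf)].
exists (`|K| * M) => -[x v] /=.
have [Kv|vK] := ltP K `|v|; first by rewrite fK// mulr0 normr0 mulr_ge0.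
by rewrite normrM ler_pM// (le_trans vK)// ler_norm.
Qed.
End TestFunctions.

Section MeanCalculus.
Context {R : realType} {ell : R} (ell_gt0 : 0 < ell).
Local Notation P := (phase_prob ell_gt0).
Local Notation gauss := (@gauss_prob R).
Implicit Types f g h a : R * R -> R.

Lemma growth4D h k : growth4 h -> growth4 k -> growth4 (fun z => h z + k z).
Proof.
move=> [mh [M hM]] [mk [N kN]]; split; first exact: measurable_funD.
exists (M + N) => z; apply: le_trans (ler_normD _ _) _.
by rewrite mulrDl lerD.
Qed.

Lemma growth4Z c h : growth4 h -> growth4 (fun z => c * h z).
Proof.
move=> [mh [M hM]]; split; first exact: measurable_funM.
by exists (`|c| * M) => z; rewrite normrM -mulrA ler_wpM2l.
Qed.

Lemma growth4Mb a h : bounded_meas a -> growth4 h -> growth4 (fun z => a z * h z).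
Proof.
move=> [ma [M aM]] [mh [N hN]]; split; first exact: measurable_funM.
by exists (M * N) => z; rewrite normrM -mulrA ler_pM.
Qed.

Lemma meanD h k : growth4 h -> growth4 k ->
  \int[P]_z (h z + k z) = \int[P]_z h z + \int[P]_z k z.
Proof. by move=> gh gk; rewrite RintegralD//; exact: growth4_integrable. Qed.

Lemma meanZ c h : growth4 h -> \int[P]_z (c * h z) = c * \int[P]_z h z.
Proof. by move=> gh; rewrite RintegralZl//; exact: growth4_integrable. Qed.

Lemma mean_cst (c : R) : \int[P]_z c = c.
Proof. exact: (Rintegral_probability_cst P). Qed.

Lemma mean_le h k : growth4 h -> growth4 k -> (forall z, h z <= k z) ->
  \int[P]_z h z <= \int[P]_z k z.
Proof.
move=> gh gk hk; apply: le_Rintegral => //; exact: growth4_integrable.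
Qed.

Lemma eq_mean h k : h =1 k -> \int[P]_z h z = \int[P]_z k z.
Proof. by move=> hk; apply: eq_Rintegral => z _; exact: hk. Qed.

Lemma vavgD h k z : growth4 h -> growth4 k -> vavg (fun z => h z + k z) z = vavg h z + vavg k z.
Proof. by move=> gh gk; rewrite /vavg RintegralD//; exact: growth4_integrable_v. Qed.

Lemma vavgZ c h z : growth4 h -> vavg (fun z => c * h z) z = c * vavg h z.
Proof. by move=> gh; rewrite /vavg RintegralZl//; exact: growth4_integrable_v. Qed.

Lemma eq_vavg h k z : h =1 k -> vavg h z = vavg k z.
Proof. by move=> hk; apply: eq_Rintegral => v _; exact: hk. Qed.

Lemma vavg_v z : vavg (fun z : R * R => z.2) z = 0.
Proof. exact: gauss_mean0. Qed.

Lemma vavg_v2 z : vavg (fun z : R * R => z.2 ^+ 2) z = 1.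
Proof. exact: gauss_var1. Qed.

(** Up to the factor [ell], the primitive in [x] of the density of [g]; it inverts [dx] on densities
    modulo the mean, as [kavg_dx] states. *)
Definition kavg g : R * R -> R := fun z => \int[P]_y (torus_ker ell z.1 y.1 * g y).

Lemma torus_ker_bounded x : bounded_meas (fun z : R * R => torus_ker ell x z.1).
Proof.
split; last by exists 1 => z; exact: torus_ker_bound.
have mx := measurableT_comp (@measurable_torus_ker R ell) (pair1_measurable x).
exact: (measurableT_comp mx measurable_fst).
Qed.

Lemma kavg_bounded g : growth4 g -> bounded_meas (kavg g).
Proof.
move=> bg; have ig := growth4_integrable ell_gt0 bg; split; last first.
  exists (\int[P]_z `|g z|) => z.
  have gk : growth4 (fun y => torus_ker ell z.1 y.1 * g y).
    by apply: growth4Mb => //; exact: torus_ker_bounded.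
  apply: le_trans (le_normr_Rintegral _ (growth4_integrable ell_gt0 gk)) _ => //.
  apply: le_Rintegral => //.
  - by apply: integrable_norm => //; exact: growth4_integrable.
  - exact: integrable_norm.
  - by move=> y _; rewrite normrM ler_piMl//; exact: torus_ker_bound.
have i1 : P.-integrable setT (EFin \o (fun _ : R * R => 1 : R)).
  exact: growth4_integrable (bounded_growth4 (bounded_cst 1)).
have H := @kernel_integrable _ _ _ _ R P P _ _ g i1 ig (@measurable_phase_ker R ell)
  (fun u => torus_ker_bound ell_gt0 u.1.1 u.2.1).
have mF := measurable_fubini_F H.
have mf := measurableT_comp (fine_measurable measurableT) mF.
rewrite (_ : kavg g = fine \o (fubini_F P (EFin \o
  (fun u : (R * R) * (R * R) => 1 * torus_ker ell u.1.1 u.2.1 * g u.2)))) //.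
apply/funext => z; rewrite /kavg /= /fubini_F /Rintegral; congr fine.
by apply: eq_integral => y _ /=; rewrite mul1r.
Qed.

Lemma kavg_vavg0 g z : growth4 g -> (forall y, vavg g y = 0) -> kavg g z = 0.
Proof.
move=> gg g0; rewrite /kavg -mean_vavg; last by apply: growth4Mb => //; exact: torus_ker_bounded.
rewrite -[RHS](mean_cst 0); apply: eq_mean => y.
by rewrite (@vavg_mull _ (fun y => torus_ker ell z.1 y.1) g) ?g0 ?mulr0.
Qed.

Lemma kavg_cst c z : kavg (fun=> c) z = 0.
Proof.
rewrite /kavg fubini_xv; last first.
  by apply: growth4Mb; [exact: torus_ker_bounded|exact: bounded_growth4 (bounded_cst c)].
have [z01|z01] := boolP (0 < z.1 < ell); last first.
  under eq_Rintegral do under eq_Rintegral do rewrite /torus_ker/= (negbTE z01)/= mul0r.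
  by under eq_Rintegral do rewrite Rintegral_probability_cst; rewrite Rintegral_probability_cst.
transitivity (\int[torus_prob ell_gt0]_x (c * torus_ker ell z.1 x)).
  by apply: eq_Rintegral => x _ /=; rewrite Rintegral_probability_cst mulrC.
rewrite RintegralZl ?torus_ker_cst ?mulr0//.
exact: (growth4_integrable_x ell_gt0 0 (bounded_growth4 (torus_ker_bounded z.1))).
Qed.

Lemma kavgD g h z : growth4 g -> growth4 h -> kavg (fun z => g z + h z) z = kavg g z + kavg h z.
Proof.
move=> gg gh; rewrite /kavg -meanD; [|by apply: growth4Mb => //; exact: torus_ker_bounded..].
by apply: eq_mean => y; rewrite mulrDr.
Qed.

Lemma kavg_transpose g y : growth4 g -> \int[P]_z (g z * torus_ker ell z.1 y.1) = - kavg g y.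
Proof.
move=> gg; rewrite /kavg -mulN1r -meanZ; last by apply: growth4Mb => //; exact: torus_ker_bounded.
by apply: eq_mean => z; rewrite (torus_ker_anti ell_gt0) mulrN mulN1r mulrC.
Qed.

Lemma bform_kavgr f g : f \in Lfun P 2%:E -> g \in Lfun P 2%:E ->
  bform ell_gt0 f g = \int[P]_z (z.2 * f z * kavg g z).
Proof. exact: bform_fubini12. Qed.

Lemma bform_kavgl f g : f \in Lfun P 2%:E -> g \in Lfun P 2%:E ->
  growth4 (fun z => z.2 * f z) ->
  bform ell_gt0 f g = \int[P]_y (- kavg (fun z => z.2 * f z) y * g y).
Proof.
move=> f2 g2 gf; rewrite bform_fubini21//.
by apply: eq_mean => y; rewrite kavg_transpose.
Qed.
End MeanCalculus.

(** * Closure properties of smooth functions *)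

Section SmoothFunctions.
Context {R : realType} {ell : R}.
Implicit Types f g : R * R -> R.

Definition smooth f := forall n, Cn n f.

(** [Cn n.+1] speaks of the first partial derivatives and does not contain [Cn n] of the function
    itself, so the inductions for products and compositions carry all orders up to [n] together. *)
Let cn n f := forall m, (m <= n)%N -> Cn m f.

Let cn_dx n f : cn n.+1 f -> cn n (dx f).
Proof. by move=> cf m mn; have [] := cf m.+1 mn. Qed.

Let cn_dv n f : cn n.+1 f -> cn n (dv f).
Proof. by move=> cf m mn; have [] := cf m.+1 mn. Qed.

Let cnS n f : cn n.+1 f -> cn n f.
Proof. by move=> cf m mn; apply: cf; exact: leqW. Qed.

Let cn_isd1 n f (z : R * R) : cn n.+1 f -> is_derive z.1 1 (fun x : R => f (x, z.2)) (dx f z).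
Proof. by move=> /(_ 1%N isT)[d _ _ _]; exact: is_derive_derive1. Qed.

Let cn_isd2 n f (z : R * R) : cn n.+1 f -> is_derive z.2 1 (fun v : R => f (z.1, v)) (dv f z).
Proof. by move=> /(_ 1%N isT)[_ d _ _]; exact: is_derive_derive1. Qed.

Lemma dxE f (z : R * R) a : is_derive z.1 1 (fun x : R => f (x, z.2)) a -> dx f z = a.
Proof. by move=> d; rewrite /dx derive1E; exact: derive_val. Qed.

Lemma dvE f (z : R * R) a : is_derive z.2 1 (fun v : R => f (z.1, v)) a -> dv f z = a.
Proof. by move=> d; rewrite /dv derive1E; exact: derive_val. Qed.

Let cnSI n f f1 f2 : cn n f ->
  (forall z : R * R, is_derive z.1 1 (fun x : R => f (x, z.2)) (f1 z)) ->
  (forall z : R * R, is_derive z.2 1 (fun v : R => f (z.1, v)) (f2 z)) ->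
  cn n f1 -> cn n f2 -> cn n.+1 f.
Proof.
move=> cf d1 d2 c1 c2 m; rewrite leq_eqVlt => /predU1P[->|]; last exact: cf.
split.
- by move=> z; case: (d1 z).
- by move=> z; case: (d2 z).
- by rewrite (_ : dx f = f1); [exact: c1|apply/funext => z; exact: dxE (d1 z)].
- by rewrite (_ : dv f = f2); [exact: c2|apply/funext => z; exact: dvE (d2 z)].
Qed.

Let cnD n f g : cn n f -> cn n g -> cn n (fun z => f z + g z).
Proof.
elim: n f g => [|n IH] f g cf cg.
  case=> // _ z; apply: (@continuousD _ _ _ f g); [exact: (cf 0%N)|exact: (cg 0%N)].
apply: (@cnSI _ _ (fun z => dx f z + dx g z) (fun z => dv f z + dv g z)).
- by apply: IH; exact: cnS.
- by move=> z; apply: isd_add; [exact: cn_isd1 cf|exact: cn_isd1 cg].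
- by move=> z; apply: isd_add; [exact: cn_isd2 cf|exact: cn_isd2 cg].
- by apply: IH; exact: cn_dx.
- by apply: IH; exact: cn_dv.
Qed.

Let cnM n f g : cn n f -> cn n g -> cn n (fun z => f z * g z).
Proof.
elim: n f g => [|n IH] f g cf cg.
  case=> // _ z; apply: (@continuousM _ _ f g); [exact: (cf 0%N)|exact: (cg 0%N)].
apply: (@cnSI _ _ (fun z => dx f z * g z + f z * dx g z) (fun z => dv f z * g z + f z * dv g z)).
- by apply: IH; exact: cnS.
- by move=> [x v]; exact: isd_mul (cn_isd1 _ cf) (cn_isd1 _ cg).
- by move=> [x v]; exact: isd_mul (cn_isd2 _ cf) (cn_isd2 _ cg).
- by apply: cnD; apply: IH; (exact: cn_dx || exact: cnS).
- by apply: cnD; apply: IH; (exact: cn_dv || exact: cnS).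
Qed.

(** The induction also differentiates the outer function, so it runs over a class [F] closed under
    differentiation: combinations of the [flat m], or of sine and cosine. *)
Let cn_comp (F : (R -> R) -> Prop) n h g :
  (forall h, F h -> exists2 h', F h' & forall x : R, is_derive x 1 h (h' x)) ->
  F h -> cn n g -> cn n (fun z => h (g z)).
Proof.
move=> dF; elim: n h g => [|n IH] h g Fh cg; have [h' Fh' dh] := dF h Fh.
  case=> // _ z; apply: (@continuous_comp _ _ _ g h); first exact: (cg 0%N).
  exact: isd_continuous (dh _).
apply: (@cnSI _ _ (fun z => h' (g z) * dx g z) (fun z => h' (g z) * dv g z)).
- by apply: IH => //; exact: cnS.
- by move=> [x v]; exact: isd_comp (dh _) (cn_isd1 _ cg).
- by move=> [x v]; exact: isd_comp (dh _) (cn_isd2 _ cg).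
- by apply: cnM; [apply: IH => //; exact: cnS|exact: cn_dx].
- by apply: cnM; [apply: IH => //; exact: cnS|exact: cn_dv].
Qed.

Let smoothP f : smooth f -> forall n, cn n f.
Proof. by move=> sf n m _. Qed.

Lemma smoothD f g : smooth f -> smooth g -> smooth (fun z => f z + g z).
Proof. by move=> sf sg n; apply: (@cnD n) => //; exact: smoothP. Qed.

Lemma smoothM f g : smooth f -> smooth g -> smooth (fun z => f z * g z).
Proof. by move=> sf sg n; apply: (@cnM n) => //; exact: smoothP. Qed.

Lemma smooth_comp (F : (R -> R) -> Prop) h g :
  (forall h, F h -> exists2 h', F h' & forall x : R, is_derive x 1 h (h' x)) ->
  F h -> smooth g -> smooth (fun z => h (g z)).
Proof. by move=> dF Fh sg n; apply: (@cn_comp F n) => //; exact: smoothP. Qed.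

Lemma smooth_cst (c : R) : smooth (fun=> c).
Proof.
move=> n; elim: n c => [|n IH] c; first exact: cst_continuous.
split=> [z|z||] //=.
- by rewrite (_ : dx _ = fun=> 0)//; apply/funext => z; apply: dxE; exact: isd_cst.
- by rewrite (_ : dv _ = fun=> 0)//; apply/funext => z; apply: dvE; exact: isd_cst.
Qed.

Lemma smooth_fst : smooth (fun z => z.1).
Proof.
case=> [|n]; first by move=> z; exact: cvg_fst.
split=> [z|z||] /=; [exact: derivable_id|exact: derivable_cst| |].
- rewrite (_ : dx _ = fun=> 1); first exact: smooth_cst.
  by apply/funext => z; apply: dxE; exact: isd_id.
- rewrite (_ : dv _ = fun=> 0); first exact: smooth_cst.
  by apply/funext => z; apply: dvE; exact: isd_cst.
Qed.

Lemma smooth_snd : smooth (fun z => z.2).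
Proof.
case=> [|n]; first by move=> z; exact: cvg_snd.
split=> [z|z||] /=; [exact: derivable_cst|exact: derivable_id| |].
- rewrite (_ : dx _ = fun=> 0); first exact: smooth_cst.
  by apply/funext => z; apply: dxE; exact: isd_cst.
- rewrite (_ : dv _ = fun=> 1); first exact: smooth_cst.
  by apply/funext => z; apply: dvE; exact: isd_id.
Qed.

Lemma test_smoothM f g : smooth f -> (forall x v, f (x + ell, v) = f (x, v)) ->
  test_function ell g -> test_function ell (fun z => f z * g z).
Proof.
move=> sf pf [sg pg [K gK]]; split.
- exact: smoothM.
- by move=> x v; rewrite pf pg.
- by exists K => x v Kv; rewrite gK// mulr0.
Qed.

Lemma testM f g : test_function ell f -> test_function ell g -> test_function ell (fun z => f z * g z).
Proof. by case=> sf pf _; exact: test_smoothM. Qed.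

Lemma test_vM g : test_function ell g -> test_function ell (fun z => z.2 * g z).
Proof. by apply: test_smoothM => //; exact: smooth_snd. Qed.
End SmoothFunctions.

(** * Collision identities on test functions *)

Section TestIdentities.
Context {R : realType} {ell : R} (ell_gt0 : 0 < ell).
Local Notation P := (phase_prob ell_gt0).
Local Notation gauss := (@gauss_prob R).
Local Notation torus := (torus_prob ell_gt0).
Context (f : R * R -> R).
Hypothesis tf : test_function ell f.

Let bf := test_bounded_meas ell_gt0 tf.
Let tdx := test_dx tf.
Let tdv := test_dv tf.
Let tdvv := test_dv tdv.

Let tb (g : R * R -> R) (tg : test_function ell g) := test_bounded_meas ell_gt0 tg.
Let tv (g : R * R -> R) (tg : test_function ell g) := test_vf ell_gt0 tg.

Lemma collision_bounded c : bounded_meas (collision_op c f).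
Proof.
case: c => /=.
  apply: boundedN; apply: boundedD; last exact: (test_vf ell_gt0 tdv).
  by apply: boundedN; exact: (test_bounded_meas ell_gt0 tdvv).
by apply: boundedB => //; apply: (vavg_bounded ell_gt0); exact: bounded_growth4.
Qed.

Lemma kinetic_bounded c : bounded_meas (kinetic_op c f).
Proof. by apply: boundedB; [exact: (test_vf ell_gt0 tdx)|exact: collision_bounded]. Qed.

Let stein (F F' : R -> R) K : (forall v : R, is_derive v 1 F (F' v)) -> continuous F' ->
  (forall v, K < `|v| -> F v = 0) -> (exists M, forall v, `|F' v - v * F v| <= M) ->
  \int[gauss]_v (F' v - v * F v) = 0.
Proof.
move=> dF cF' FK [M HM]; apply: stein_gauss_csupp FK _ => //.
have mF : measurable_fun setT (fun v => F' v - v * F v).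
  apply: measurable_funB; first exact: continuous_measurable_fun.
  apply: measurable_funM => //; apply: continuous_measurable_fun => v.
  exact: isd_continuous (dF v).
apply: (@integrable_gauss_growth _ _ M) => // v.
by rewrite (le_trans (HM v))// ler_peMr ?lerDl ?exprn_even_ge0// (le_trans (normr_ge0 _) (HM v)).
Qed.

Let stein_test (g : R * R -> R) x : test_function ell g ->
  \int[gauss]_v (dv g (x, v) - v * g (x, v)) = 0.
Proof.
move=> tg; have [K gK] := test_supp tg.
apply: (stein (K := K)).
- by move=> v; exact: test_isd_dv tg.
- by apply: continuous_section2; exact: test_continuous (test_dv tg).
- by move=> v; exact: gK.
- have [_ [M HM]] := boundedB (test_bounded_meas ell_gt0 (test_dv tg)) (test_vf ell_gt0 tg).
  by exists M => v; exact: (HM (x, v)).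
Qed.

(** Collisions conserve local mass: the FP operator is the Stein expression [dv g - v * g] of
    [g = dv f], and the BL one is [r - f]. *)
Lemma vavg_collision c z : vavg (collision_op c f) z = 0.
Proof.
case: c; last first.
  rewrite (@eq_vavg _ _ (fun z => vavg f z + -1 * f z)); last by move=> y /=; rewrite mulN1r.
  rewrite vavgD; [|by apply: bounded_growth4; exact: (vavg_bounded ell_gt0 (bounded_growth4 bf))|by apply: growth4Z; exact: bounded_growth4].
  by rewrite vavgZ ?(vavg_xdep (xdep_vavg f)) ?mulN1r ?subrr//; exact: bounded_growth4.
rewrite -[RHS](stein_test z.1 tdv); apply: eq_Rintegral => v _ /=.
by rewrite opprD opprK.
Qed.

Let isd_v (g : R * R -> R) (x v : R) : test_function ell g ->
  dv (fun z => z.2 * g z) (x, v) = g (x, v) + v * dv g (x, v).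
Proof.
by move=> tg; apply: dvE; apply: (is_derive_eq (isd_mul (isd_id v) (test_isd_dv x v tg))); rewrite mul1r.
Qed.

(** Both operators damp the flux at unit rate. For FP, [v * L f = h - (dv f - v * f) - v * f], where
    [h] and the bracket are Stein expressions with zero average. *)
Lemma vavg_v_collision c z :
  vavg (fun y => y.2 * collision_op c f y) z = - vavg (fun y => y.2 * f y) z.
Proof.
have gvf := bounded_growth4 (test_vf ell_gt0 tf).
case: c; last first.
  rewrite (@eq_vavg _ _ (fun y => vavg f y * y.2 + -1 * (y.2 * f y))); last first.
    by move=> y /=; rewrite mulN1r mulrBr mulrC.
  have bvf := vavg_bounded ell_gt0 (bounded_growth4 bf).
  rewrite vavgD; [|by apply: growth4Mb => //; exact: moderate_growth4 moderate_v|exact: growth4Z].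
  by rewrite vavgZ// vavg_mull ?vavg_v ?mulr0 ?add0r ?mulN1r//; exact: moderate_growth4 moderate_v.
have st1 := stein_test z.1 tf; have st2 := stein_test z.1 (test_vM tdv).
have gdv := bounded_growth4 (test_bounded_meas ell_gt0 tdv).
have gv2 : growth4 (fun y : R * R => dv f y - y.2 * f y).
  by apply: bounded_growth4; apply: boundedB; [exact: tb|exact: tv].
pose h (y : R * R) := dv (fun z => z.2 * dv f z) y - y.2 * (y.2 * dv f y).
have gh : growth4 h.
  apply: bounded_growth4; apply: boundedB.
    exact: tb (test_dv (test_vM tdv)).
  exact: tv (test_vM tdv).
rewrite (@eq_vavg _ _ (fun y => h y + -1 * (dv f y - y.2 * f y) + -1 * (y.2 * f y))); last first.
  by move=> [x v]; rewrite /h isd_v//=; ring.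
rewrite vavgD; [|by apply: growth4D => //; exact: growth4Z|exact: growth4Z].
rewrite vavgD//; last exact: growth4Z.
by rewrite !vavgZ// /vavg st1 /h st2 mulr0 !add0r mulN1r.
Qed.

(** For BL the right-hand side is exactly the squared norm of [f - r]. For FP, integration by parts
    turns it into that of [dv f], and the Poincare inequality is applied on each fiber to
    [f (x, v) - f (x, 0)]. *)
Lemma mean_mul_collision c :
  10^-1 * \int[P]_z (f z - vavg f z) ^+ 2 <= - (\int[P]_z (f z * collision_op c f z)).
Proof.
have bvf := vavg_bounded ell_gt0 (bounded_growth4 bf).
have bq := boundedB bf bvf.
have gq2 : growth4 (fun z => (f z - vavg f z) ^+ 2) by apply: bounded_growth4; exact: boundedM.
case: c; last first.
  have -> : \int[P]_z (f z * collision_op BL f z) = - \int[P]_z (f z - vavg f z) ^+ 2.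
    have H : \int[P]_z (vavg f z * (f z - vavg f z)) = 0.
      rewrite (mean_xdep_mul ell_gt0)//; [|exact: bounded_growth4|by apply: bounded_growth4; exact: boundedM].
      rewrite -[RHS](mean_cst ell_gt0 0); apply: eq_mean => z.
      rewrite (@eq_vavg _ (fun z => f z - vavg f z) (fun z => f z + -1 * vavg f z)); last by move=> y; rewrite mulN1r.
      rewrite vavgD; [|exact: bounded_growth4|by apply: growth4Z; exact: bounded_growth4].
      by rewrite vavgZ ?(vavg_xdep (xdep_vavg f)) ?mulN1r ?subrr ?mulr0//; exact: bounded_growth4.
    rewrite (@eq_mean _ _ _ _ (fun z => -1 * (f z - vavg f z) ^+ 2 + -1 * (vavg f z * (f z - vavg f z)))); last first.
      by move=> z /=; rewrite -/(vavg f z); ring.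
    have gp : growth4 (fun z => vavg f z * (f z - vavg f z)) by apply: bounded_growth4; exact: boundedM.
    by rewrite meanD ?meanZ ?H ?mulr0 ?addr0 ?mulN1r//; exact: growth4Z.
  rewrite opprK ler_piMl//; last by lra.
  by apply: Rintegral_ge0 => z _; exact: sqr_ge0.
have gdv2 : growth4 (fun z => dv f z ^+ 2).
  by apply: bounded_growth4; apply: boundedM; exact: tb.
have fc : growth4 (fun z => f z * collision_op FP f z).
  by apply: bounded_growth4; apply: boundedM => //; exact: collision_bounded.
have -> : - (\int[P]_z (f z * collision_op FP f z)) = \int[P]_z (dv f z ^+ 2).
  rewrite -mulN1r -meanZ// -[LHS]mean_vavg; last exact: growth4Z.
  rewrite -(mean_vavg ell_gt0 gdv2); apply: eq_mean => -[x v].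
  have tg := testM tf tdv.
  pose h (y : R * R) := dv (fun z => f z * dv f z) y - y.2 * (f y * dv f y).
  have gh : growth4 h.
    by apply: bounded_growth4; apply: boundedB; [exact: tb (test_dv tg)|exact: tv tg].
  rewrite (@eq_vavg _ _ (fun y => -1 * h y + dv f y ^+ 2)); last first.
    move=> [y w]; rewrite /h (_ : dv _ (y, w) = dv f (y, w) ^+ 2 + f (y, w) * dv (dv f) (y, w)) /=; first by ring.
    apply: dvE; apply: (is_derive_eq (isd_mul (test_isd_dv y w tf) (test_isd_dv y w tdv))).
    by rewrite expr2.
  rewrite vavgD//; last exact: growth4Z.
  by rewrite vavgZ// /vavg (stein_test x tg) mulr0 add0r.
rewrite mulrC ler_pdivrMr// mulrC -meanZ//.
rewrite -[leLHS]mean_vavg// -[leRHS]mean_vavg; last exact: growth4Z.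
apply: mean_le; [exact: bounded_growth4 (vavg_bounded ell_gt0 gq2)|by apply: bounded_growth4; apply: (vavg_bounded ell_gt0); exact: growth4Z|].
move=> -[x v]; rewrite vavgZ//.
have gfx : growth4 (fun y : R * R => (f y - f (x, 0)) ^+ 2).
  by apply: bounded_growth4; apply: boundedM; apply: boundedB => //; exact: bounded_cst.
have H := @poincare_gauss0 _ (fun v => f (x, v) - f (x, 0)) (fun v => dv f (x, v)).
apply: le_trans (_ : vavg (fun y => (f y - f (x, 0)) ^+ 2) (x, v) <= _); last first.
  apply: H.
  - move=> w; apply: (is_derive_eq (isd_sub (test_isd_dv x w tf) (isd_cst (f (x, 0)) w))).
    by rewrite subr0.
  - by apply: continuous_section2; exact: test_continuous tdv.
  - by rewrite subrr.
  - exact: (growth4_integrable_v x gfx).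
  - exact: (growth4_integrable_v x gdv2).
(* The second moment about [f (x, 0)] exceeds the variance on the fiber by [c ^+ 2]. *)
pose c := vavg f (x, v) - f (x, 0).
have gq : growth4 (fun z => f z - vavg f z) by exact: bounded_growth4.
have -> : vavg (fun y => (f y - f (x, 0)) ^+ 2) (x, v) =
    vavg (fun y => (f y - vavg f y) ^+ 2 + (2 * c * (f y - vavg f y) + c ^+ 2)) (x, v).
  by apply: eq_Rintegral => w _; rewrite /c (xdep_vavg f x v w); ring.
have gc : growth4 (fun _ : R * R => c ^+ 2) by exact: bounded_growth4 (bounded_cst _).
rewrite vavgD//; last by apply: growth4D => //; exact: growth4Z.
rewrite lerDl vavgD//; last exact: growth4Z.
rewrite (@vavgZ _ (2 * c) (fun y => f y - vavg f y))//.
rewrite (@eq_vavg _ (fun z => f z - vavg f z) (fun z => f z + -1 * vavg f z)); last by move=> y; rewrite mulN1r.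
have gf := bounded_growth4 bf; have gvf := bounded_growth4 bvf.
rewrite vavgD//; last exact: growth4Z.
rewrite vavgZ// (vavg_xdep (xdep_vavg f)) mulN1r subrr mulr0 add0r.
have -> : vavg (fun=> c ^+ 2) (x, v) = c ^+ 2 by exact: (Rintegral_probability_cst gauss).
exact: sqr_ge0.
Qed.
End TestIdentities.

(** * Transport identities on test functions *)

Section TestTransport.
Context {R : realType} {ell : R} (ell_gt0 : 0 < ell).
Local Notation P := (phase_prob ell_gt0).
Local Notation gauss := (@gauss_prob R).
Local Notation torus := (torus_prob ell_gt0).
Local Notation test := (test_function ell).
Implicit Types f g : R * R -> R.

Let tb g (tg : test g) := test_bounded_meas ell_gt0 tg.
Let tg4 g (tg : test g) := bounded_growth4 (tb tg).

Lemma dx_vM g : test g -> dx (fun z => z.2 * g z) = (fun z => z.2 * dx g z).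
Proof.
by move=> tg; apply/funext => -[x v]; apply: dxE; exact: isd_cmul (test_isd_dx x v tg).
Qed.

Lemma mean_dx g : test g -> \int[P]_z dx g z = 0.
Proof.
move=> tg; rewrite fubini_vx; last exact: tg4 (test_dx tg).
rewrite -[RHS](Rintegral_probability_cst gauss); apply: eq_Rintegral => v _.
apply: (torus_deriv_eq0 ell_gt0 (phi := fun x => g (x, v))).
- by move=> x; exact: (test_isd_dx x v tg).
- by apply: continuous_section1; exact: test_continuous (test_dx tg).
- by rewrite -[ell]add0r (test_per _ _ tg).
Qed.

(** Fubini in the order [x] first: [torus_ker_deriv] applies at each fixed [v], where periodicity
    cancels the boundary term, and the result is averaged in [v]. *)
Lemma kavg_dx g z : test g -> 0 < z.1 < ell ->
  ell * kavg ell_gt0 (dx g) z = vavg g z - \int[P]_y g y.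
Proof.
move=> tg z01; have tdg := test_dx tg.
have gk : growth4 (fun y => torus_ker ell z.1 y.1 * dx g y).
  by apply: growth4Mb; [exact: torus_ker_bounded|exact: tg4].
rewrite /kavg fubini_vx// fubini_vx; last exact: tg4.
have H v : \int[torus]_x (torus_ker ell z.1 x * dx g (x, v)) =
    ell^-1 * (g (z.1, v) - \int[torus]_x g (x, v)).
  have cd : continuous (fun x => dx g (x, v)).
    by apply: continuous_section1; exact: test_continuous tdg.
  have := torus_ker_deriv ell_gt0 (fun x => test_isd_dx x v tg) cd z01.
  rewrite -[in g (ell, v)](add0r ell) (test_per _ _ tg) subrr mulr0 addr0 => <-.
  by rewrite mulKf// gt_eqF.
under eq_Rintegral do rewrite H.
have [_ [M gM]] := tb tg.
have gA : growth4 (fun z => \int[torus]_x g (x, z.2)).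
  apply: bounded_growth4; split; last first.
    exists M => y; apply: le_trans (le_normr_Rintegral _ (growth4_integrable_x ell_gt0 y.2 (tg4 tg))) _ => //.
    rewrite -[leRHS](Rintegral_probability_cst torus); apply: le_Rintegral => //.
    - by apply: integrable_norm => //; exact: growth4_integrable_x (tg4 tg).
    - exact: finite_measure_integrable_cst.
  have mG := measurable_fubini_G (growth4_integrable ell_gt0 (tg4 tg)).
  have mf := measurableT_comp (fine_measurable measurableT) mG.
  exact: (measurableT_comp mf measurable_snd).
have iv := growth4_integrable_v z.1 (tg4 tg); have iA := growth4_integrable_v z.1 gA.
rewrite RintegralZl//; last exact: (integrableB measurableT iv iA).
by rewrite mulVKf ?gt_eqF// RintegralB.
Qed.

Context (c : collision) (f : R * R -> R).
Hypothesis tf : test f.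
Let L := collision_op c f.
Let Pf := kinetic_op c f.
Let tvf := test_vM tf.
Let tvvf := test_vM tvf.
Let gL : growth4 L. Proof. exact: bounded_growth4 (collision_bounded ell_gt0 tf c). Qed.

Let PfE z : Pf z = dx (fun z => z.2 * f z) z + -1 * L z.
Proof. by rewrite dx_vM// mulN1r. Qed.

Lemma mean_kinetic : \int[P]_z Pf z = 0.
Proof.
rewrite (eq_mean ell_gt0 PfE) meanD; [|exact: tg4 (test_dx tvf)|exact: growth4Z].
rewrite meanZ// mean_dx// -mean_vavg//.
under eq_Rintegral do rewrite (vavg_collision ell_gt0 tf).
by rewrite mean_cst mulr0 addr0.
Qed.

(** Transport is antisymmetric: [f * (v * dx f)] is half the [x]-derivative of [v * f ^+ 2], of zero
    mean by periodicity. *)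
Lemma mean_mul_kinetic : \int[P]_z (f z * Pf z) = - (\int[P]_z (f z * L z)).
Proof.
have t2 := testM tf tvf.
rewrite (@eq_mean _ _ ell_gt0 _ (fun z => 2^-1 * dx (fun z => f z * (z.2 * f z)) z + -1 * (f z * L z))).
  have gfL : growth4 (fun z => f z * L z) by apply: growth4Mb => //; exact: tb.
  rewrite meanD; [|by apply: growth4Z; exact: tg4 (test_dx t2)|exact: growth4Z].
  by rewrite !meanZ ?mean_dx ?mulr0 ?add0r ?mulN1r//; exact: tg4 (test_dx t2).
move=> z; rewrite PfE dx_vM// (_ : dx (fun z => f z * (z.2 * f z)) z = 2 * (z.2 * f z * dx f z)); first by field.
case: z => x v; apply: dxE; apply: (is_derive_eq (isd_mul (test_isd_dx x v tf) (test_isd_dx x v tvf))).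
by rewrite dx_vM//=; ring.
Qed.

(** The continuity equation integrated once in [x]: the density of [P f] is the derivative of the
    flux of [f], collisions having no density. *)
Lemma kavg_kinetic z : 0 < z.1 < ell ->
  ell * kavg ell_gt0 Pf z = vavg (fun y => y.2 * f y) z - \int[P]_y (y.2 * f y).
Proof.
move=> z01; rewrite -kavg_dx//; congr (_ * _).
rewrite {1}/kavg (@eq_mean _ _ ell_gt0 _ (fun y => torus_ker ell z.1 y.1 * (dx (fun z => z.2 * f z) y + -1 * L y))).
  have gN : growth4 (fun z => -1 * L z) by exact: growth4Z.
  rewrite -[LHS]/(kavg ell_gt0 (fun y => dx (fun z => z.2 * f z) y + -1 * L y) z).
  rewrite kavgD//; last exact: tg4 (test_dx tvf).
  by rewrite (@kavg_vavg0 _ _ _ (fun z => -1 * L z))// => [|y]; rewrite ?addr0// vavgZ// (vavg_collision ell_gt0 tf) ?mulr0.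
by move=> y; rewrite PfE.
Qed.

(** The momentum balance integrated once in [x]: the flux of [P f] is the derivative of the second
    velocity moment plus the flux of [f], the latter because [v * L f + v * f] has zero velocity
    average. *)
Lemma kavg_v_kinetic z : 0 < z.1 < ell ->
  ell * kavg ell_gt0 (fun y => y.2 * Pf y) z =
  vavg (fun y => y.2 * (y.2 * f y)) z - \int[P]_y (y.2 * (y.2 * f y)) +
  ell * kavg ell_gt0 (fun y => y.2 * f y) z.
Proof.
move=> z01; rewrite -kavg_dx// -mulrDr; congr (_ * _).
have gvL : growth4 (fun y => y.2 * L y).
  have := growth4Mb (collision_bounded ell_gt0 tf c) (moderate_growth4 moderate_v).
  by under eq_fun do rewrite mulrC.
have gA : growth4 (fun y => -1 * (y.2 * L y + y.2 * f y)).
  by apply: growth4Z; apply: growth4D => //; exact: tg4.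
have gB : growth4 (fun y => y.2 * f y) by exact: tg4.
have gC := tg4 (test_dx tvvf).
rewrite -kavgD//.
transitivity (kavg ell_gt0 (fun y => (dx (fun z => z.2 * (z.2 * f z)) y + y.2 * f y) +
    -1 * (y.2 * L y + y.2 * f y)) z).
  by apply: eq_mean => y; rewrite PfE !dx_vM//=; ring.
rewrite kavgD//; last exact: growth4D.
rewrite (@kavg_vavg0 _ _ _ (fun y => -1 * (y.2 * L y + y.2 * f y))) ?addr0// => y.
rewrite vavgZ; last exact: growth4D.
by rewrite vavgD// (vavg_v_collision ell_gt0 tf) addNr mulr0.
Qed.
End TestTransport.

(** * The modified entropy *)

Section TestCoercivity.
Context {R : realType} {ell : R} (ell_gt0 : 0 < ell).
Local Notation P := (phase_prob ell_gt0).
Local Notation gauss := (@gauss_prob R).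
Local Notation test := (test_function ell).
Local Notation nrm := (nrm2 P).
Context (c : collision) (f : R * R -> R).
Hypothesis tf : test f.
Let Pf := kinetic_op c f.
Let r := vavg f.
Let mf : R := \int[P]_z f z.
Let q z := f z - r z.
Let p z := r z - mf.
Let d := nrm q.
Let s := nrm p.

Let bf : bounded_meas f. Proof. exact: test_bounded_meas tf. Qed.
Let br : bounded_meas r. Proof. exact: (vavg_bounded ell_gt0 (bounded_growth4 bf)). Qed.
Let bq : bounded_meas q. Proof. exact: boundedB. Qed.
Let bp : bounded_meas p. Proof. by apply: boundedB => //; exact: bounded_cst. Qed.
Let bvf : bounded_meas (fun z => z.2 * f z). Proof. exact: (test_vf ell_gt0 tf). Qed.
Let bvvf : bounded_meas (fun z => z.2 * (z.2 * f z)). Proof. exact: (test_vf ell_gt0 (test_vM tf)). Qed.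
Let bPf : bounded_meas Pf. Proof. exact: (kinetic_bounded ell_gt0 tf c). Qed.
Let bvPf : growth4 (fun z => z.2 * Pf z).
Proof.
have := growth4Mb bPf (moderate_growth4 moderate_v).
by under eq_fun do rewrite mulrC.
Qed.
Let g4 (h : R * R -> R) := @bounded_growth4 R h.
Let b2 (h : R * R -> R) (bh : bounded_meas h) := moderate_Lfun2 ell_gt0 (bounded_moderate bh).

Let bMv (h : R * R -> R) : bounded_meas h -> moderate (fun z => h z * z.2).
Proof. by move=> bh; apply: moderateMb => //; exact: moderate_v. Qed.
Let bMv2 (h : R * R -> R) : bounded_meas h -> moderate (fun z => h z * z.2 ^+ 2).
Proof. by move=> bh; apply: moderateMb => //; exact: moderate_v2. Qed.

Let mean_p : \int[P]_z p z = 0.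
Proof.
rewrite (@eq_mean _ _ ell_gt0 _ (fun z => r z + - mf)); last by [].
rewrite meanD; [|exact: g4|exact: g4 (bounded_cst _)].
by rewrite mean_cst /r mean_vavg ?subrr//; exact: g4.
Qed.

Let vavg_q z : vavg q z = 0.
Proof.
rewrite (@eq_vavg _ _ (fun z => r z + -1 * r z + (f z - r z))) //; last by move=> y; rewrite mulN1r subrr add0r.
rewrite (@eq_vavg _ _ (fun z => f z + -1 * r z)); last by move=> y; ring.
rewrite vavgD; [|exact: g4|by apply: growth4Z; exact: g4].
by rewrite vavgZ ?(vavg_xdep (xdep_vavg f)) ?mulN1r ?subrr//; exact: g4.
Qed.

Let mean_q_xdep a : bounded_meas a -> xdep a -> \int[P]_z (a z * q z) = 0.
Proof.
move=> ba xa; rewrite (mean_xdep_mul ell_gt0)//; [|exact: g4|by apply: g4; exact: boundedM].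
by under eq_Rintegral do rewrite vavg_q mulr0; exact: mean_cst.
Qed.

(** Pythagoras: [q] has zero velocity average, while [p] depends on [x] only and has zero mean. *)
Lemma mean_sqr_decomp : \int[P]_z (f z * f z) = d ^+ 2 + s ^+ 2 + mf ^+ 2.
Proof.
rewrite !sqr_nrm2 ?b2//.
rewrite (@eq_mean _ _ ell_gt0 _ (fun z => q z * q z + p z * p z + (2 * (r z * q z) + 2 * mf * p z) + mf ^+ 2)); last first.
  by move=> z; rewrite /q /p; ring.
have bqq := boundedM bq bq; have bpp := boundedM bp bp; have brq := boundedM br bq.
have gA := growth4D (g4 bqq) (g4 bpp).
have gB := growth4D (growth4Z 2 (g4 brq)) (growth4Z (2 * mf) (g4 bp)).
rewrite (meanD ell_gt0 (growth4D gA gB) (g4 (bounded_cst _))).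
rewrite (meanD ell_gt0 gA gB) (meanD ell_gt0 (g4 bqq) (g4 bpp)).
rewrite (meanD ell_gt0 (growth4Z 2 (g4 brq)) (growth4Z (2 * mf) (g4 bp))).
rewrite mean_cst (meanZ ell_gt0 2 (g4 brq)) (meanZ ell_gt0 (2 * mf) (g4 bp)).
by rewrite mean_p (mean_q_xdep br (xdep_vavg f)) !mulr0 !addr0.
Qed.

(** In fact [b f f = b q p]: on the left [r] carries no flux; on the right [q] has no density and
    the constant [mf] has zero primitive. *)
Lemma bform_test_bound : `|bform ell_gt0 f f| <= d * s.
Proof.
have H0 := bform_bound (b2 bq) (b2 bp).
suff -> : bform ell_gt0 f f = bform ell_gt0 q p by exact: H0.
have gvr : growth4 (fun z => z.2 * r z).
  by have := moderate_growth4 (bMv br); under eq_fun do rewrite mulrC.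
have H1 : bform ell_gt0 f f = bform ell_gt0 (fun z => 1 * q z + r z) f.
  by congr bform; apply/funext => z; rewrite /q mul1r subrK.
have H2 : bform ell_gt0 r f = 0.
  rewrite bform_kavgl ?b2// -[RHS](mean_cst ell_gt0 0); apply: eq_mean => y.
  rewrite kavg_vavg0 ?oppr0 ?mul0r// => z.
  rewrite (@eq_vavg _ _ (fun z => r z * z.2)); last by move=> u; rewrite mulrC.
  by rewrite vavg_mull ?vavg_v ?mulr0//; exact: moderate_growth4 moderate_v.
rewrite H1 bform_linl ?b2// H2 mul1r addr0.
have -> : bform ell_gt0 q f = bform ell_gt0 q (fun z => 1 * q z + (1 * p z + mf)).
  by congr bform; apply/funext => z; rewrite /q /p; ring.
have bc := bounded_cst mf.
have bpm : bounded_meas (fun z => 1 * p z + mf).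
  by apply: boundedD => //; apply: boundedM => //; exact: bounded_cst.
rewrite bform_linr ?b2// bform_linr ?b2//.
rewrite !(bform_kavgr (b2 bq)) ?b2//.
have -> : \int[P]_z (z.2 * q z * kavg ell_gt0 q z) = 0.
  rewrite -[RHS](mean_cst ell_gt0 0); apply: eq_mean => z.
  by rewrite kavg_vavg0 ?mulr0//; exact: g4.
have -> : \int[P]_z (z.2 * q z * kavg ell_gt0 (fun=> mf) z) = 0.
  rewrite -[RHS](mean_cst ell_gt0 0); apply: eq_mean => z.
  by rewrite kavg_cst mulr0.
by rewrite mulr0 add0r mul1r addr0.
Qed.

Let J := vavg (fun z => z.2 * f z).
Let bJ : bounded_meas J. Proof. exact: (vavg_bounded ell_gt0 (g4 bvf)). Qed.

(** The left-hand side is the variance of the flux [J]. Since [v] has zero average, [J] is also the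
    flux of [q]; Cauchy-Schwarz against [J * v], which has the norm of [J], bounds that norm by
    [d]. *)
Lemma bform_kinetic_r : ell * bform ell_gt0 f Pf <= d ^+ 2.
Proof.
pose jm : R := \int[P]_y (y.2 * f y).
have e1 : ell * bform ell_gt0 f Pf = \int[P]_z (z.2 * f z * (J z - jm)).
  rewrite bform_kavgr ?b2// -meanZ; last first.
    by apply: g4; apply: boundedM => //; exact: kavg_bounded (g4 _).
  apply: eq_mean_interior.
  - by apply: growth4Z; apply: g4; apply: boundedM => //; exact: kavg_bounded (g4 _).
  - by apply: g4; apply: boundedM => //; apply: boundedB => //; exact: bounded_cst.
  - by move=> x v x01 /=; rewrite mulrCA (kavg_kinetic ell_gt0 c tf).
have bJJ := boundedM bJ bJ.
have gvfJ : growth4 (fun z => J z * (z.2 * f z)) by apply: g4; exact: boundedM.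
have e2 : \int[P]_z (J z * (z.2 * f z)) = \int[P]_z (J z * J z).
  by rewrite (mean_xdep_mul ell_gt0)//; exact: g4.
have e3 : \int[P]_z (z.2 * f z * (J z - jm)) = \int[P]_z (J z * J z) - jm ^+ 2.
  rewrite -e2 (@eq_mean _ _ ell_gt0 _ (fun z => J z * (z.2 * f z) + - jm * (z.2 * f z))); last by move=> z; ring.
  rewrite meanD//; last by apply: growth4Z; exact: g4.
  by rewrite meanZ; [rewrite expr2 -/jm mulNr|exact: g4].
rewrite e1 e3; apply: (@le_trans _ _ (\int[P]_z (J z * J z))).
  by rewrite gerBl sqr_ge0.
have mJv := bMv bJ; have lJv := moderate_Lfun2 ell_gt0 mJv.
have JvE : nrm (fun z => J z * z.2) ^+ 2 = \int[P]_z (J z * J z).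
  rewrite sqr_nrm2//.
  rewrite (@eq_mean _ _ ell_gt0 _ (fun z => (J z * J z) * (z.2 ^+ 2))); last by move=> z; ring.
  have gv2 : growth4 (fun z : R * R => z.2 ^+ 2) := moderate_growth4 moderate_v2.
  have gJ : growth4 (fun z => J z * J z * z.2 ^+ 2).
    by apply: moderate_growth4; exact: bMv2.
  have xJJ : xdep (fun z => J z * J z) by [].
  rewrite [LHS](mean_xdep_mul ell_gt0 gv2 bJJ xJJ gJ).
  by apply: eq_mean => z; rewrite vavg_v2 mulr1.
have e4 : \int[P]_z (J z * J z) = \int[P]_z (q z * (J z * z.2)).
  rewrite -e2 (@eq_mean _ _ ell_gt0 _ (fun z => q z * (J z * z.2) + (J z * r z) * z.2)); last first.
    by move=> z; rewrite /q; ring.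
  have bJr := boundedM bJ br.
  rewrite meanD; [|by apply: growth4Mb => //; exact: moderate_growth4|by apply: moderate_growth4; exact: bMv].
  rewrite [X in _ + X](mean_xdep_mul ell_gt0)//; last 2 first.
  - exact: moderate_growth4 moderate_v.
  - by apply: moderate_growth4; exact: bMv.
  by under [X in _ + X]eq_Rintegral do rewrite vavg_v mulr0; rewrite mean_cst addr0.
have := cauchy_schwarz2 (b2 bq) lJv; rewrite -e4 -JvE -/d.
set X := nrm (fun z => J z * z.2).
have X0 : 0 <= X by exact: nrm2_ge0.
rewrite ger0_norm ?sqr_ge0// => HX.
have Xd : X <= d.
  have [X00|] := eqVneq X 0; first by rewrite X00 nrm2_ge0.
  move=> Xn0; have Xp : 0 < X by rewrite lt_neqAle eq_sym Xn0.
  by rewrite -(ler_pM2r Xp) -expr2.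
by rewrite lerXn2r// nnegrE nrm2_ge0.
Qed.

Definition gauss_m4 : R := \int[gauss]_v (v ^+ 4).

(** The momentum balance brings in the second velocity moment [m2] of [f]. As [v ^+ 2] averages to
    1, the density contributes [r] itself to [m2], whence [- s ^+ 2]; the contribution of [q] is
    bounded by [d] times the norm of [p * v ^+ 2], and the damping of the flux adds
    [ell * b f f]. *)
Lemma bform_kinetic_l : ell * bform ell_gt0 Pf f <= - s ^+ 2 + (1 + gauss_m4 + ell) * (d * s).
Proof.
pose m2 := vavg (fun z => z.2 * (z.2 * f z)).
pose mm : R := \int[P]_z (z.2 * (z.2 * f z)).
have bm2 : bounded_meas m2 by exact: (vavg_bounded ell_gt0 (g4 bvvf)).
have bk := kavg_bounded ell_gt0 (g4 bvf).
have bkP := kavg_bounded ell_gt0 bvPf.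
have e1 : ell * bform ell_gt0 Pf f = \int[P]_z (- (m2 z - mm + ell * kavg ell_gt0 (fun y => y.2 * f y) z) * f z).
  rewrite bform_kavgl ?b2// -meanZ; last first.
    by apply: g4; apply: boundedM => //; exact: boundedN.
  apply: eq_mean_interior.
  - by apply: growth4Z; apply: g4; apply: boundedM => //; exact: boundedN.
  - apply: g4; apply: boundedM => //; apply: boundedN; apply: boundedD.
      by apply: boundedB => //; exact: bounded_cst.
    by apply: boundedM => //; exact: bounded_cst.
  - by move=> x v x01 /=; rewrite mulrA mulrN (kavg_v_kinetic ell_gt0 c tf).
have bm2f := boundedM bm2 bf. have bkf := boundedM bk bf.
have e2 : ell * bform ell_gt0 Pf f = - (\int[P]_z (m2 z * f z)) + mm * mf + ell * bform ell_gt0 f f.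
  rewrite e1 (@eq_mean _ _ ell_gt0 _ (fun z => -1 * (m2 z * f z) + mm * f z + - ell * (kavg ell_gt0 (fun y => y.2 * f y) z * f z))); last first.
    by move=> z; ring.
  rewrite meanD; [|by apply: growth4D; apply: growth4Z; exact: g4|by apply: growth4Z; exact: g4].
  rewrite meanD; [|by apply: growth4Z; exact: g4|by apply: growth4Z; exact: g4].
  rewrite !meanZ; [|exact: g4..].
  rewrite (bform_kavgl (b2 bf) (b2 bf)); last exact: g4.
  rewrite (@eq_mean _ _ ell_gt0 (fun z => - kavg ell_gt0 (fun y => y.2 * f y) z * f z) (fun z => -1 * (kavg ell_gt0 (fun y => y.2 * f y) z * f z))); last first.
    by move=> z; ring.
  rewrite meanZ; last exact: g4.
  by rewrite -/mf mulN1r [in RHS]mulN1r mulrN mulNr.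
have bvvp : bounded_meas (fun z => p z * (z.2 * (z.2 * f z))) by exact: boundedM.
have e3 : \int[P]_z (m2 z * f z) - mm * mf = \int[P]_z (p z * (z.2 * (z.2 * f z))).
  rewrite [RHS](@eq_mean _ _ ell_gt0 _ (fun z => r z * (z.2 * (z.2 * f z)) + - mf * (z.2 * (z.2 * f z)))); last first.
    by move=> z; rewrite /p; ring.
  have brv := boundedM br bvvf.
  rewrite meanD; [|exact: g4|by apply: growth4Z; exact: g4].
  rewrite meanZ; last exact: g4.
  rewrite (mean_xdep_mul ell_gt0 (g4 bvvf) br) //; last exact: g4.
  rewrite (mean_xdep_mul ell_gt0 (g4 bf) bm2) //; last exact: g4.
  rewrite (@eq_mean _ _ ell_gt0 (fun z => m2 z * vavg f z) (fun z => r z * vavg (fun z => z.2 * (z.2 * f z)) z)).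
    by rewrite -/mm -/mf mulNr [mm * _]mulrC.
  by move=> z; rewrite mulrC.
have mpv := bMv2 bp; have lpv := moderate_Lfun2 ell_gt0 mpv.
have bpp := boundedM bp bp; have bpr := boundedM bp br.
have e4 : \int[P]_z (p z * (z.2 * (z.2 * f z))) = s ^+ 2 + \int[P]_z (q z * (p z * z.2 ^+ 2)).
  rewrite (@eq_mean _ _ ell_gt0 _ (fun z => (p z * r z) * z.2 ^+ 2 + q z * (p z * z.2 ^+ 2))); last first.
    by move=> z; rewrite /q; ring.
  rewrite meanD; [|by apply: moderate_growth4; exact: bMv2|by apply: growth4Mb => //; exact: moderate_growth4].
  congr (_ + _); rewrite (mean_xdep_mul ell_gt0)//; last 2 first.
  - exact: moderate_growth4 moderate_v2.
  - by apply: moderate_growth4; exact: bMv2.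
  rewrite (@eq_mean _ _ ell_gt0 _ (fun z => p z * p z + mf * p z)); last first.
    by move=> z; rewrite vavg_v2 /p; ring.
  rewrite meanD; [|exact: g4|by apply: growth4Z; exact: g4].
  by rewrite meanZ ?mean_p ?mulr0 ?addr0 ?sqr_nrm2 ?b2//; exact: g4.
have m40 : 0 <= gauss_m4 by apply: Rintegral_ge0 => v _; rewrite exprn_even_ge0.
have e5 : nrm (fun z => p z * z.2 ^+ 2) ^+ 2 = s ^+ 2 * gauss_m4.
  rewrite (sqr_nrm2 lpv) (sqr_nrm2 (b2 bp)).
  rewrite (@eq_mean _ _ ell_gt0 _ (fun z => (p z * p z) * (z.2 ^+ 4))); last by move=> z; ring.
  have gv4 : growth4 (fun z : R * R => z.2 ^+ 4).
    split; first by apply: measurable_funX; exact: measurable_snd.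
    by exists 1 => z; rewrite mul1r ger0_norm ?exprn_even_ge0// lerDr.
  rewrite (mean_xdep_mul ell_gt0 gv4 bpp)//; last exact: growth4Mb.
  rewrite (@eq_mean _ _ ell_gt0 _ (fun z => gauss_m4 * (p z * p z))); last by move=> z; rewrite mulrC.
  by rewrite meanZ 1?mulrC//; exact: g4.
(* The exact factor is the square root of [gauss_m4]; [1 + gauss_m4] dominates it without a root. *)
have e6 : nrm (fun z => p z * z.2 ^+ 2) <= (1 + gauss_m4) * s.
  have s0 : 0 <= s by exact: nrm2_ge0.
  rewrite -ler_sqr ?nnegrE ?nrm2_ge0//; last by rewrite mulr_ge0// addr_ge0.
  rewrite e5.
  rewrite exprMn mulrC ler_wpM2r ?sqr_ge0// sqrrD expr1n.
  by have := sqr_ge0 gauss_m4; lra.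
have H1 := cauchy_schwarz2 (b2 bq) lpv; rewrite -/d in H1.
have H2 := bform_test_bound.
have d0 : 0 <= d by exact: nrm2_ge0.
have H3 := ler_wpM2l d0 e6.
move: H1 H2; rewrite !ler_norml => /andP[H1 _] /andP[_ H2].
have H4 := ler_wpM2l (ltW ell_gt0) H2.
rewrite e2; move: e3; rewrite e4 => e3; lra.
Qed.

(** For [B = 1 + gauss_m4 + ell], the inequality [2 * B <= 1 + B ^+ 2] yields [eps * ell <= 32^-1],
    and directly [eps * B ^+ 2 <= 16^-1]. The first gives the equivalence with the variance, the
    second the absorption of the cross term. *)
Definition entropy_eps : R := (16 * (1 + (1 + gauss_m4 + ell) ^+ 2))^-1.
End TestCoercivity.
Arguments gauss_m4 R : clear implicits.
Arguments entropy_eps {R} ell.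

Section Entropy.
Context {R : realType} {ell : R} (ell_gt0 : 0 < ell).
Local Notation P := (phase_prob ell_gt0).
Local Notation test := (test_function ell).
Local Notation nrm := (nrm2 P).
Local Notation L2fun := (Lfun P 2%:E).
Local Notation b := (bform ell_gt0).
Implicit Types f g : R * R -> R.

Let eps := entropy_eps ell.

(* [b] integrates the flux of [f] against the primitive of the density of [g]; along the
   flow it produces the dissipation of the density that the collisions do not give. *)
Definition entropy f g : R :=
  \int[P]_z (f z * g z) - (\int[P]_z f z) * (\int[P]_z g z) - eps * ell * (b f g + b g f).

Let B := 1 + gauss_m4 R + ell.

Let B_ge1 : 1 <= B.
Proof.
have : 0 <= gauss_m4 R by apply: Rintegral_ge0 => v _; rewrite exprn_even_ge0.
by move=> h; rewrite /B -addrA lerDl addr_ge0// ltW.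
Qed.

Let epsB : eps * (16 * (1 + B ^+ 2)) = 1.
Proof. by rewrite /eps /entropy_eps mulVf// gt_eqF// mulr_gt0// ltr_wpDr ?sqr_ge0. Qed.

Lemma entropy_eps_gt0 : 0 < eps.
Proof. by rewrite invr_gt0 mulr_gt0// ltr_wpDr ?sqr_ge0. Qed.

Let L1_int f : f \in L2fun -> P.-integrable setT (EFin \o f).
Proof.
move=> f2; have := Lfun2_integrableM f2 (moderate_L2 ell_gt0 (moderate_cst (1 : R))).
by apply: eq_integrable => // z _ /=; rewrite mulr1.
Qed.

Lemma entropy_sym f g : entropy f g = entropy g f.
Proof.
rewrite /entropy [b f g + _]addrC [(\int[P]_z f z) * _]mulrC; congr (_ - _ - _).
by apply: eq_mean => z; rewrite mulrC.
Qed.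

Lemma mean_lin c f f' : f \in L2fun -> f' \in L2fun ->
  \int[P]_z (c * f z + f' z) = c * \int[P]_z f z + \int[P]_z f' z.
Proof.
move=> f2 f'2; rewrite RintegralD ?RintegralZl//; [exact: L1_int|exact: (integrableZl measurableT c (L1_int f2))|exact: L1_int].
Qed.

Lemma entropy_lin c f f' g : f \in L2fun -> f' \in L2fun -> g \in L2fun ->
  entropy (fun z => c * f z + f' z) g = c * entropy f g + entropy f' g.
Proof.
move=> f2 f'2 g2; rewrite /entropy bform_linl// bform_linr// mean_lin//.
have i1 := Lfun2_integrableM f2 g2; have i2 := Lfun2_integrableM f'2 g2.
have -> : \int[P]_z ((c * f z + f' z) * g z) = c * \int[P]_z (f z * g z) + \int[P]_z (f' z * g z).
  rewrite -RintegralZl// -RintegralD//; last exact: (integrableZl measurableT c i1).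
  by apply: eq_mean => z; rewrite mulrDl mulrA.
by move: (\int[P]_z f z) (\int[P]_z f' z) (\int[P]_z g z) => u1 u2 u3;
   move: (\int[P]_z (f z * g z)) (\int[P]_z (f' z * g z)) => u4 u5; ring.
Qed.

Lemma mean_bound f : f \in L2fun -> `|\int[P]_z f z| <= nrm f.
Proof.
move=> f2; have := cauchy_schwarz2 f2 (moderate_L2 ell_gt0 (moderate_cst (1 : R))).
by rewrite nrm_1 mulr1; under eq_Rintegral do rewrite mulr1.
Qed.

Definition entropy_bd : R := 2 + 2 * (eps * ell).

Lemma entropy_bd_ge0 : 0 <= entropy_bd.
Proof. by rewrite addr_ge0// mulr_ge0// mulr_ge0// ltW// entropy_eps_gt0. Qed.

Lemma entropy_bound f g : f \in L2fun -> g \in L2fun -> `|entropy f g| <= entropy_bd * (nrm f * nrm g).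
Proof.
move=> f2 g2.
have H1 := cauchy_schwarz2 f2 g2; have H2 := bform_bound f2 g2; have H3 := bform_bound g2 f2.
have H4 : `|(\int[P]_z f z) * (\int[P]_z g z)| <= nrm f * nrm g.
  by rewrite normrM ler_pM ?mean_bound.
have H5 : `|b f g + b g f| <= 2 * (nrm f * nrm g).
  apply: le_trans (ler_normD _ _) _; rewrite mulr_natl mulr2n lerD//.
  by rewrite mulrC.
have e0 : 0 <= eps * ell by rewrite mulr_ge0// ltW// entropy_eps_gt0.
have H6 : `|eps * ell * (b f g + b g f)| <= eps * ell * (2 * (nrm f * nrm g)).
  by rewrite normrM ger0_norm// ler_wpM2l.
rewrite /entropy; apply: le_trans (ler_normB _ _) _.
rewrite /entropy_bd mulrDl [2 * (eps * ell)]mulrC -[eps * ell * 2 * _]mulrA; apply: lerD => //.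
by apply: le_trans (ler_normB _ _) _; rewrite mulr_natl mulr2n lerD.
Qed.

Context (c : collision) (f : R * R -> R).
Hypothesis tf : test f.
Let Pf := kinetic_op c f.
Let mf : R := \int[P]_z f z.
Let d := nrm (fun z => f z - vavg f z).
Let s := nrm (fun z => vavg f z - mf).

Let ds_sqr : 2 * (d * s) <= d ^+ 2 + s ^+ 2.
Proof. by have := sqr_ge0 (d - s); rewrite sqrrB; lra. Qed.

Let eps_ell : eps * ell <= 32^-1.
Proof.
have e0 := entropy_eps_gt0.
have H : eps * ell <= eps * B.
  rewrite ler_wpM2l ?(ltW e0)// /B lerDr addr_ge0//.
  by apply: Rintegral_ge0 => v _; rewrite exprn_even_ge0.
apply: le_trans H _.
have := ler_wpM2l (ltW e0) (sqr_ge0 (B - 1)); rewrite sqrrB expr1n.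
by move: epsB; lra.
Qed.

Let entropyE : entropy f f = d ^+ 2 + s ^+ 2 - 2 * (eps * ell * b f f).
Proof.
rewrite /entropy (mean_sqr_decomp ell_gt0 tf) -/mf -/d -/s.
by move: (b f f) => u; ring.
Qed.

Let bff : `|2 * (eps * ell * b f f)| <= (d ^+ 2 + s ^+ 2) / 32.
Proof.
rewrite normrM [`|2|]ger0_norm// normrM [`|eps * ell|]ger0_norm; last first.
  by rewrite mulr_ge0 ?(ltW entropy_eps_gt0)// ltW.
have H := bform_test_bound ell_gt0 tf; rewrite -/mf -/d -/s in H.
have := ler_pM (mulr_ge0 (ltW entropy_eps_gt0) (ltW ell_gt0)) (normr_ge0 _) eps_ell H.
by move: ds_sqr; lra.
Qed.

(** The variance is [d ^+ 2 + s ^+ 2], and the coupling changes it by at most a 32nd. *)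
Lemma entropy_test_lower : \int[P]_z (f z * f z) - mf ^+ 2 <= 2 * entropy f f.
Proof.
rewrite entropyE (mean_sqr_decomp ell_gt0 tf) -/mf -/d -/s.
move: bff; rewrite ler_norml => /andP[_ H].
by have := sqr_ge0 d; have := sqr_ge0 s; lra.
Qed.

(** Collisions give [d^2 / 10] and the coupling at least [- eps (d^2 - s^2 + B d s)]. The cross term
    costs half of [eps s^2] and [eps B^2 d^2 / 2], at most [d^2 / 32]; with [eps <= 1/32] at least
    [eps (d^2 + s^2) / 2] remains, and [entropy f f <= 2 (d^2 + s^2)]. *)
Lemma entropy_test_diss : eps / 4 * entropy f f <= entropy f Pf.
Proof.
have e0 := entropy_eps_gt0.
have H1 := mean_mul_collision ell_gt0 tf c; rewrite -(mean_mul_kinetic ell_gt0 c tf) -/Pf in H1.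
have H2 : \int[P]_z (f z - vavg f z) ^+ 2 = d ^+ 2.
  rewrite sqr_nrm2; last first.
    apply: moderate_L2; apply: bounded_moderate; apply: boundedB.
      exact: (test_bounded_meas ell_gt0 tf).
    by apply: (vavg_bounded ell_gt0); apply: bounded_growth4; exact: (test_bounded_meas ell_gt0 tf).
  by apply: eq_mean => z; rewrite expr2.
rewrite H2 in H1.
have H3 := bform_kinetic_r ell_gt0 c tf; have H4 := bform_kinetic_l ell_gt0 c tf.
rewrite -/mf -/d -/s -/Pf -/B in H3 H4.
have H5 : eps / 4 * entropy f f <= eps / 2 * (d ^+ 2 + s ^+ 2).
  have : entropy f f <= 2 * (d ^+ 2 + s ^+ 2).
    rewrite entropyE; move: bff; rewrite ler_norml => /andP[H _].
    by have := sqr_ge0 d; have := sqr_ge0 s; lra.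
  by move=> /(ler_wpM2l (ltW e0)); lra.
apply: le_trans H5 _.
rewrite /entropy (mean_kinetic ell_gt0 c tf) mulr0 subr0.
have H6 := ler_wpM2l (ltW e0) (lerD H3 H4).
have H7 : B * (d * s) <= s ^+ 2 / 2 + B ^+ 2 * d ^+ 2 / 2.
  by have := sqr_ge0 (B * d - s); rewrite sqrrB exprMn; lra.
have H8 := ler_wpM2l (ltW e0) H7.
have d20 := sqr_ge0 d; have s20 := sqr_ge0 s.
have H9 : eps * (B ^+ 2 * d ^+ 2) = d ^+ 2 / 16 - eps * d ^+ 2.
  by have -> : d ^+ 2 / 16 = eps * (16 * (1 + B ^+ 2)) * d ^+ 2 / 16; [rewrite epsB mul1r|field].
have H10 : eps <= 32^-1.
  have : 1 <= B ^+ 2 by exact: exprn_ege1 B_ge1.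
  by move=> /(ler_wpM2l (ltW e0)); move: epsB; lra.
have H11 := ler_wpM2r d20 H10.
by move: H6; rewrite -mulrA mulrDr -!mulrDr -/Pf; lra.
Qed.
End Entropy.
Arguments entropy_bd {R} ell.

(** * Density of the test functions *)

Section SmoothStep.
Context {R : realType}.

(* [flat m] is [x^-m exp(-1/x)] for [x > 0], extended by [0]. *)
Definition flat (m : nat) (x : R) : R := if 0 < x then x^-1 ^+ m * expR (- x^-1) else 0.

Lemma flat_ge0 m x : 0 <= flat m x.
Proof.
by rewrite /flat; case: ifPn => // x0; rewrite mulr_ge0 ?expR_ge0// exprn_ge0// invr_ge0 ltW.
Qed.

(** The term of order [m.+1] in the exponential series at [x^-1]. This linear bound makes every
    [flat m] tend to 0 at 0. *)
Lemma flat_le m x : flat m x <= (m.+1)`!%:R * `|x|.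
Proof.
rewrite /flat; case: ifPn => [x0|_]; last by rewrite mulr_ge0.
have y0 : 0 < x^-1 by rewrite invr_gt0.
have H := expR_ge1Dxn m (ltW y0).
rewrite gtr0_norm// expRN ler_pdivrMr ?expR_gt0// -ler_pdivrMl; last first.
  by rewrite mulr_gt0// ltr0n fact_gt0.
apply: (le_trans _ H); rewrite -[leLHS]add0r lerD// le_eqVlt; apply/orP; left; apply/eqP.
by rewrite invfM [in RHS]exprS -[LHS]mulrA [LHS]mulrC.
Qed.

(** At 0 the Caratheodory criterion is used: the difference quotient of [flat m] is [flat m.+1],
    continuous at 0 by [flat_le]. *)
Lemma is_derive_flat m (x : R) : is_derive x 1 (flat m) (flat m.+2 x - m%:R * flat m.+1 x).
Proof.
have [x0|x0|->] := ltgtP x 0.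
- have e n : flat n x = 0 by rewrite /flat ltNge ltW.
  rewrite !e mulr0 subrr; apply: (near_eq_is_derive (f := fun=> 0)).
  have : \forall y \near x, y < 0 by exact: lt_nbhsl.
  by apply: filterS => y y0; rewrite /flat ltNge ltW.
- have xn : x != 0 by rewrite gt_eqF.
  apply: (@near_eq_is_derive _ _ _ (fun y : R => (y^-1 ^+ m * expR (- y^-1) : R))).
    have : \forall y \near x, 0 < y by exact: lt_nbhsr.
    by apply: filterS => y y0; rewrite /flat y0.
  have dV : is_derive x 1 (fun y : R => y^-1) (- x^-1 ^+ 2).
    have := is_deriveV xn (isd_id x); move=> H; apply: (is_derive_eq H).
    by rewrite /GRing.scale/= mulr1 exprVn.
  have dN : is_derive x 1 (fun y : R => - y^-1) (x^-1 ^+ 2).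
    by apply: (is_derive_eq (is_deriveN dV)); rewrite opprK.
  have dX : is_derive x 1 (fun y : R => y^-1 ^+ m) (- (m%:R * x^-1 ^+ m.+1)).
    elim: (m) => [|k IH].
      by under eq_fun do rewrite expr0; rewrite mul0r oppr0; exact: isd_cst.
    under eq_fun do rewrite exprS.
    by apply: (is_derive_eq (isd_mul dV IH)); rewrite -natr1 !exprS; ring.
  apply: (is_derive_eq (isd_mul dX (isd_comp (is_derive_expR _) dN))).
  by rewrite /flat x0 !exprS; ring.
- have e n : flat n 0 = 0 by rewrite /flat ltxx.
  rewrite !e mulr0 subrr; apply/is_derive1_caratheodory; exists (flat m.+1); split.
  + move=> z; rewrite e !subr0 /flat; case: ifPn => [z0|_]; last by rewrite mul0r.
    by rewrite exprS; field; rewrite gt_eqF.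
  + rewrite /prop_for /continuous_at e.
    pose C : R := (m.+2)`!%:R.
    have cl : C * `|z| @[z --> (0 : R)] --> 0.
      rewrite -[X in _ --> X](mulr0 C) -[X in C * X](@normr0 _ R).
      by apply: cvgM; [exact: cvg_cst|exact: norm_continuous].
    apply: squeeze_cvgr (cvg_cst 0) cl.
    by apply: nearW => z; rewrite flat_ge0 flat_le.
  + by rewrite e.
Qed.

(** The span of the functions [flat m]: it contains [flat 0] and is stable under differentiation, as
    [smooth_comp] demands. *)
Definition flat_comb (h : R -> R) : Prop :=
  exists s : seq (R * nat), h = (fun x => \sum_(i <- s) i.1 * flat i.2 x).

Lemma flat_combP h : flat_comb h -> exists2 h', flat_comb h' & forall x : R, is_derive x 1 h (h' x).
Proof.
move=> [s ->].
exists (fun x => \sum_(i <- flatten [seq [:: (i.1, i.2.+2); (- i.1 * i.2%:R, i.2.+1)] | i <- s]) i.1 * flat i.2 x).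
  by eexists.
move=> x; elim: s => [|i s IH] /=.
  under eq_fun do rewrite big_nil; rewrite big_nil; exact: isd_cst.
under eq_fun do rewrite big_cons; rewrite !big_cons /=.
apply: (is_derive_eq (isd_add (isd_cmul i.1 (is_derive_flat i.2 x)) IH)).
by ring.
Qed.

Lemma smooth_flat (g : R * R -> R) : smooth g -> smooth (fun z => flat 0 (g z)).
Proof.
apply: (smooth_comp flat_combP); exists [:: (1, 0%N)].
by apply/funext => x; rewrite big_cons big_nil addr0 mul1r.
Qed.

Lemma flat0_le1 x : flat 0 x <= 1.
Proof.
rewrite /flat expr0 mul1r; case: ifPn => // x0.
by rewrite -expR0 ler_expR oppr_le0 invr_ge0 ltW.
Qed.

Lemma flat0_npos x : x <= 0 -> flat 0 x = 0.
Proof. by move=> x0; rewrite /flat ltNge x0. Qed.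

Lemma flat0_pos x : 0 < x -> 1 - x^-1 <= flat 0 x.
Proof. by move=> x0; rewrite /flat x0 expr0 mul1r; have := expR_ge1Dx (- x^-1). Qed.

Lemma cvg_flat0 (y : R^nat) (a : R) : 0 < a -> (\forall n \near \oo, a <= y n) ->
  flat 0 (n%:R * y n) @[n --> \oo] --> (1 : R).
Proof.
move=> a0 ya.
have cl : 1 - (2 / a) * n.+1%:R^-1 @[n --> \oo] --> (1 : R).
  rewrite -[X in _ --> X]subr0 -[X in _ - X](mulr0 (2 / a)).
  apply: cvgB; first exact: cvg_cst.
  by apply: cvgM; [exact: cvg_cst|exact: cvg_harmonic].
apply: (@squeeze_cvgr _ _ _ _ (fun n : nat => 1 - 2 / a * n.+1%:R^-1) (fun=> 1)) => //; last exact: cvg_cst.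
have : \forall n \near \oo, (0 < n)%N by exists 1%N.
apply: filterS2 ya => n ny n0; rewrite flat0_le1 andbT.
have n0' : 0 < n%:R :> R by rewrite ltr0n.
have yn : 0 < n%:R * y n by rewrite mulr_gt0// (lt_le_trans a0).
apply: le_trans (flat0_pos yn); rewrite lerD2l lerN2 -mulrA -invfM.
have n1 : 1 <= n%:R :> R by rewrite ler1n.
rewrite ler_pdivlMr ?mulr_gt0// mulrC ler_pdivrMr//.
rewrite -natr1; nra.
Qed.

Lemma trig_derivP (h : R -> R) :
  (exists a b : R, h = (fun x => a * sin x + b * cos x)) ->
  exists2 h', (exists a b : R, h' = (fun x => a * sin x + b * cos x)) & forall x : R, is_derive x 1 h (h' x).
Proof.
move=> [a [b ->]]; exists (fun x => - b * sin x + a * cos x); first by exists (- b), a.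
move=> x; apply: (is_derive_eq (isd_add (isd_cmul a (is_derive_sin x)) (isd_cmul b (is_derive_cos x)))).
by ring.
Qed.

Lemma smooth_sin (g : R * R -> R) : smooth g -> smooth (fun z => sin (g z)).
Proof.
apply: (smooth_comp trig_derivP); exists 1, 0.
by apply/funext => x; rewrite mul1r mul0r addr0.
Qed.
End SmoothStep.

(** * Approximation of square-integrable functions by test functions *)

Section TestDensity.
Import HBNNSimple.
Context {R : realType} {ell : R} (ell_gt0 : 0 < ell).
Local Notation P := (phase_prob ell_gt0).
Local Notation test := (test_function ell).
Local Notation nrm := (nrm2 P).
Local Notation L2fun := (Lfun P 2%:E).
Implicit Types f g : R * R -> R.

Lemma nrm_triangle f g : f \in L2fun -> g \in L2fun -> nrm (fun z => f z + g z) <= nrm f + nrm g.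
Proof.
move=> f2 g2; pose F : L2 ell_gt0 := Lfun_Sub (lee1n 2) f2; pose G : L2 ell_gt0 := Lfun_Sub (lee1n 2) g2.
exact: (ler_LnormD F G).
Qed.

Lemma L2_lin c f g : f \in L2fun -> g \in L2fun -> (fun z => c * f z + g z) \in L2fun.
Proof.
move=> f2 g2; pose F : L2 ell_gt0 := Lfun_Sub (lee1n 2) f2; pose G : L2 ell_gt0 := Lfun_Sub (lee1n 2) g2.
exact: (LfunP (c *: F + G)).
Qed.

Lemma L2_sub f g : f \in L2fun -> g \in L2fun -> (fun z => f z - g z) \in L2fun.
Proof.
move=> f2 g2; have := L2_lin (-1) g2 f2.
by under eq_fun do rewrite mulN1r addrC.
Qed.

Lemma nrm_scale c f : f \in L2fun -> nrm (fun z => c * f z) = `|c| * nrm f.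
Proof.
move=> f2; have cf2 : (fun z => c * f z) \in L2fun.
  have := L2_lin c f2 (moderate_L2 ell_gt0 (moderate_cst 0)).
  by under eq_fun do rewrite addr0.
apply/eqP; rewrite -(eqrXn2 (_ : 0 < 2)%N) ?nrm2_ge0 ?mulr_ge0 ?nrm2_ge0//.
rewrite exprMn !sqr_nrm2// -normrX ger0_norm ?sqr_ge0//.
rewrite -RintegralZl//; last exact: Lfun2_integrableM.
by apply/eqP; apply: eq_Rintegral => z _; rewrite mulrACA expr2.
Qed.

Definition approximable f := f \in L2fun /\ forall e, 0 < e -> exists2 g, test g & nrm (fun z => g z - f z) < e.

Lemma test_L2 g : test g -> g \in L2fun.
Proof. by move=> tg; apply: moderate_L2; apply: bounded_moderate; exact: test_bounded_meas tg. Qed.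

Let test_lin c f g : test f -> test g -> test (fun z => c * f z + g z).
Proof.
move=> [sf pf [K fK]] [sg pg [K' gK]]; split.
- by apply: smoothD => //; apply: smoothM => //; exact: smooth_cst.
- by move=> x v; rewrite pf pg.
- exists (Num.max K K') => x v; rewrite gt_max => /andP[h1 h2].
  by rewrite fK// gK// mulr0 addr0.
Qed.

Lemma approx_test f : test f -> approximable f.
Proof.
move=> tf; split=> [|e e0]; first exact: test_L2.
exists f => //; rewrite (_ : (fun z => f z - f z) = (fun z => 0 * f z)).
  by rewrite nrm_scale ?normr0 ?mul0r//; exact: test_L2.
by apply/funext => z; rewrite subrr mul0r.
Qed.

Lemma approx_lin c f g : approximable f -> approximable g -> approximable (fun z => c * f z + g z).
Proof.
move=> [f2 Hf] [g2 Hg]; split=> [|e e0]; first exact: L2_lin.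
have e1 : 0 < e / 2 / (`|c| + 1) by rewrite !divr_gt0// ltr_wpDl.
have [f' tf' Hf'] := Hf _ e1; have [g' tg' Hg'] := Hg (e / 2) (divr_gt0 e0 (ltr0Sn _ _)).
exists (fun z => c * f' z + g' z); first exact: test_lin.
have s1 := L2_sub (test_L2 tf') f2; have s2 := L2_sub (test_L2 tg') g2.
have cs1 : (fun z => c * (f' z - f z)) \in L2fun.
  have := L2_lin c s1 (moderate_L2 ell_gt0 (moderate_cst 0)).
  by under eq_fun do rewrite addr0.
rewrite (_ : (fun z => _) = (fun z => c * (f' z - f z) + (g' z - g z))); last first.
  by apply/funext => z; ring.
apply: le_lt_trans (nrm_triangle cs1 s2) _; rewrite nrm_scale// [e]splitr.
apply: ler_ltD => //; apply: le_trans (ler_wpM2l (normr_ge0 _) (ltW Hf')) _.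
by rewrite mulrA ler_pdivrMr ?ltr_wpDl// mulrC ler_wpM2l ?lerDl// ltW// divr_gt0.
Qed.

Lemma approx_lim (u : (R * R -> R)^nat) f : (forall n, approximable (u n)) -> f \in L2fun ->
  nrm (fun z => u n z - f z) @[n --> \oo] --> 0 -> approximable f.
Proof.
move=> au f2 cu; split=> // e e0.
have e1 : 0 < e / 2 by rewrite divr_gt0.
have [n] : exists n, nrm (fun z => u n z - f z) < e / 2.
  have /cvgr0Pnorm_lt/(_ _ e1) := cu.
  by case=> n _ /(_ n (leqnn n)); rewrite ger0_norm ?nrm2_ge0//; exists n.
have [u2 /(_ _ e1)[g tg gu]] := au n => un.
exists g => //; rewrite (_ : (fun z => g z - f z) = (fun z => (g z - u n z) + (u n z - f z))); last first.
  by apply/funext => z; rewrite subrKA.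
apply: le_lt_trans (nrm_triangle (L2_sub (test_L2 tg) u2) (L2_sub u2 f2)) _.
by rewrite [e]splitr ltrD.
Qed.

Lemma approx_dominated (u : (R * R -> R)^nat) f (k : R * R -> R) : (forall n, approximable (u n)) -> f \in L2fun ->
  (forall z, u n z @[n --> \oo] --> f z) -> k \in L2fun ->
  (forall n z, `|u n z - f z| <= k z) -> approximable f.
Proof.
move=> au f2 cu k2 uk; apply: (approx_lim au f2).
have u2 n : (fun z => u n z - f z) \in L2fun by apply: L2_sub => //; case: (au n).
have : nrm (fun z => u n z - f z) ^+ 2 @[n --> \oo] --> \int[P]_z (0 : R).
  under eq_fun do rewrite sqr_nrm2//.
  apply: (@dominated_Rintegral _ _ _ P (fun n z => (u n z - f z) * (u n z - f z)) (fun=> 0) (fun z => k z * k z)).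
  - by move=> n; apply: measurable_funM; exact: Lfun2_measurable (u2 n).
  - exact: measurable_cst.
  - move=> z; rewrite -[X in _ --> X](mulr0 0).
    by apply: cvgM; rewrite -[X in _ --> X](subrr (f z)); apply: cvgB => //; exact: cvg_cst.
  - exact: Lfun2_integrableM.
  - by move=> n z; rewrite normrM ler_pM.
rewrite (Rintegral_probability_cst P) => c2; apply/cvgr0Pnorm_lt => e e0.
have e20 : 0 < e ^+ 2 by rewrite exprn_gt0.
have /cvgr0Pnorm_lt/(_ _ e20) := c2.
apply: filterS => n; rewrite normrX => H.
by rewrite -(@ltr_pXn2r _ 2)// nnegrE// ltW.
Qed.

Lemma approx_interior f g : approximable f -> g \in L2fun -> bounded_meas f -> bounded_meas g ->
  (forall x v, 0 < x < ell -> f (x, v) = g (x, v)) -> approximable g.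
Proof.
move=> [f2 Hf] g2 bf bg fg; apply: (@approx_lim (fun=> f)) => //.
suff -> : nrm (fun z => f z - g z) = 0 by exact: cvg_cst.
have b1 := boundedB bf bg.
apply/eqP; rewrite -sqrf_eq0 sqr_nrm2; last exact: L2_sub.
rewrite (@eq_mean_interior _ _ ell_gt0 _ (fun=> 0)) ?(Rintegral_probability_cst P)//.
- by apply: bounded_growth4; exact: boundedM.
- by apply: bounded_growth4; exact: bounded_cst.
- by move=> x v x01; rewrite fg// subrr mul0r.
Qed.

Let bounded_L2 f : bounded_meas f -> f \in L2fun.
Proof. by move=> bf; apply: moderate_L2; exact: bounded_moderate. Qed.

Lemma approx0 : approximable (fun=> 0).
Proof.
apply: approx_test; split.
- exact: smooth_cst.
- by [].
- by exists 0.
Qed.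

Let indic_meas d (T : measurableType d) (p : R * R -> T) (w : R * R -> R) A :
  measurable_fun setT p -> bounded_meas w -> measurable A -> bounded_meas (fun z => \1_A (p z) * w z).
Proof.
move=> mp [mw [M wM]] mA; split.
  by apply: measurable_funM => //; apply: measurableT_comp mp; exact: measurable_indic.
exists M => z; rewrite normrM -[leRHS]mul1r ler_pM//.
by rewrite indicE; case: (_ \in _); rewrite ?normr1 ?normr0.
Qed.

(** The good sets form a Dynkin system: complements by linearity from [w], disjoint unions by
    dominated convergence under [|w|]. The projection [p] and the weight [w] allow one coordinate to
    be treated while the other is frozen. *)
Lemma approx_dynkin d (T : measurableType d) (G : set (set T)) (p : R * R -> T) (w : R * R -> R) :
  @measurable _ T = <<s G >> -> setI_closed G -> measurable_fun setT p -> bounded_meas w -> approximable w ->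
  (forall A, G A -> approximable (fun z => \1_A (p z) * w z)) ->
  forall A, measurable A -> approximable (fun z => \1_A (p z) * w z).
Proof.
move=> GE GI mp bw aw Gw A mA.
have wL2 := aw.1.
pose C (A : set T) := approximable (fun z => \1_A (p z) * w z).
have H : forall S, <<s G >> S -> C S; last by apply: H; rewrite -GE.
apply: dynkin_induction => //.
- by rewrite /C indicT; under eq_fun do rewrite mul1r.
- move=> S _ CS; have := approx_lin (-1) CS aw.
  rewrite /C; congr approximable; apply/funext => z.
  by rewrite !indicE in_setC; case: (_ \in _) => /=; ring.
- move=> F mF tF CF; rewrite /C.
  pose U n : set T := \big[setU/set0]_(k < n) F k.
  have mU n : measurable (U n) by exact: bigsetU_measurable.
  have UE n : U n = \bigcup_(k < n) F k by rewrite /U bigcup_mkord.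
  have CU n : C (U n).
    elim: n => [|n IH].
      rewrite /C /U big_ord0 indic0; under eq_fun do rewrite mul0r; exact: approx0.
    have := approx_lin 1 IH (CF n); rewrite /C; congr approximable; apply/funext => z.
    rewrite /U big_ord_recr/= -/(U n) !indicE in_setU.
    case: (boolP (p z \in U n)) => [pU|_]; last by rewrite /= mulr0n mul0r mulr0 add0r.
    suff /negbTE -> : p z \notin F n by rewrite /= mul0r addr0 mul1r.
    apply/negP; rewrite inE => pn; move: pU; rewrite inE UE => -[k kn pk].
    have kE : k = n by apply: (tF k n I I); exists (p z).
    by move: kn; rewrite kE /= ltnn.
  have bU : measurable (\bigcup_k F k) by exact: bigcupT_measurable.
  apply: (@approx_dominated (fun n z => \1_(U n) (p z) * w z) _ (fun z => `|w z|)) => //.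
  + exact/bounded_L2/indic_meas.
  + move=> z; apply: cvgM; last exact: cvg_cst.
    rewrite indicE; case: (boolP (p z \in _)) => [|pn].
      rewrite inE => -[k _ pk]; apply: cvg_near_cst.
      exists k.+1 => // n /= kn; rewrite indicE mem_set// UE.
      by exists k.
    apply: cvg_near_cst; apply: nearW => n; rewrite indicE memNset// UE => -[k _ pk].
    by move/negP: pn; apply; rewrite inE; exists k.
  + case: bw => mw [M wM]; apply: bounded_L2; split; first exact: measurableT_comp.
    by exists M => z; rewrite normr_id.
  + move=> n z; rewrite -mulrBl normrM -[leRHS]mul1r ler_wpM2r// !indicE.
    by do 2 case: (_ \in _); rewrite /= ?subrr ?subr0 ?sub0r ?normrN ?normr1 ?normr0.
Qed.

(** Both sines change sign under a shift by [ell], so the product is periodic. On []0, ell[] the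
    second is positive and the first has the sign of [x - a]: a smooth periodic function that is
    positive there exactly for [x > a]. *)
Let tent (a x : R) : R := sin (pi / ell * (x - a)) * sin (pi / ell * (ell - x)).

Let tent_gt0 a x : 0 <= a < ell -> 0 < x < ell -> (0 < tent a x) = (a < x).
Proof.
move=> /andP[a0 al] /andP[x0 xl].
have w0 : 0 < pi / ell :> R by rewrite divr_gt0// pi_gt0.
have wl : pi / ell * ell = pi :> R by rewrite mulfVK// gt_eqF.
have s2 : 0 < sin (pi / ell * (ell - x)).
  by apply: sin_gt0_pi; rewrite mulr_gt0 ?subr_gt0//= -[ltRHS]wl ltr_pM2l// gtrBl.
rewrite /tent pmulr_lgt0//; have [ax|xa] := ltP a x.
  apply: sin_gt0_pi; rewrite mulr_gt0 ?subr_gt0//= -[ltRHS]wl ltr_pM2l//.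
  by rewrite ltrBlDr ltr_wpDr.
apply/negbTE; rewrite -leNgt -oppr_ge0 -sinN -mulrN opprB.
apply: sin_ge0_pi; apply/andP; split; first by rewrite mulr_ge0 ?subr_ge0// ltW.
by rewrite -[leRHS]wl ler_pM2l// lerBlDr (le_trans (ltW al))// lerDl ltW.
Qed.

Let tent_per a x : tent a (x + ell) = tent a x.
Proof.
have ln : ell != 0 by rewrite gt_eqF.
rewrite /tent (_ : pi / ell * (x + ell - a) = pi / ell * (x - a) + pi); last by field.
rewrite (_ : pi / ell * (ell - x) = pi / ell * (ell - (x + ell)) + pi); last by field.
by rewrite !sinDpi mulNr mulrN.
Qed.

(** Positive exactly on []c, c + n[]: each [flat 0] of it has bounded support, and the windows fill
    []c, +oo[] as [n] grows. *)
Let window (c : R) (n : nat) (v : R) : R := (v - c) * (c + n%:R - v).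

Let smooth_cM (b : R) g : smooth g -> smooth (fun z : R * R => b * g z).
Proof. by move=> sg; apply: smoothM => //; exact: smooth_cst. Qed.

Let smoothN g : smooth g -> smooth (fun z : R * R => - g z).
Proof. by move=> sg; under eq_fun do rewrite -mulN1r; exact: smooth_cM. Qed.

Let smooth_tent a : smooth (fun z : R * R => tent a z.1).
Proof.
apply: smoothM; apply: smooth_sin; apply: smooth_cM.
- by apply: smoothD; [exact: smooth_fst|exact: smooth_cst].
- by apply: smoothD; [exact: smooth_cst|apply: smoothN; exact: smooth_fst].
Qed.

Let smooth_window c n : smooth (fun z : R * R => window c n z.2).
Proof.
apply: smoothM.
- by apply: smoothD; [exact: smooth_snd|exact: smooth_cst].
- by apply: smoothD; [exact: smooth_cst|apply: smoothN; exact: smooth_snd].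
Qed.

Let box_test a c n : test (fun z => flat 0 (n%:R * tent a z.1) * flat 0 (n%:R * window c n z.2)).
Proof.
split.
- apply: smoothM; apply: smooth_flat; apply: smooth_cM; [exact: smooth_tent|exact: smooth_window].
- by move=> x v /=; rewrite tent_per.
- exists (`|c| + n%:R) => x v /= vK; rewrite [X in _ * X]flat0_npos ?mulr0// mulr_ge0_le0//.
  have n0 : 0 <= n%:R :> R by [].
  have c1 := ler_norm c; have c2 := lerNnormlW (lexx `|c|).
  rewrite /window; have [v0|v0] := leP 0 v.
    by rewrite (ger0_norm v0) in vK; rewrite mulr_ge0_le0//; lra.
  by rewrite (ltr0_norm v0) in vK; rewrite mulr_le0_ge0//; lra.
Qed.

Let openC (c : R) : measurable (`]c, +oo[%classic : set R).
Proof. exact: measurable_itv. Qed.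

Let indic_gt (c x : R) : \1_(`]c, +oo[%classic : set R) x = (c < x)%R%:R :> R.
Proof. by rewrite indicE mem_setE/= in_itv/= andbT. Qed.

Let indic_fst_meas A : measurable A -> bounded_meas (fun z : R * R => \1_A z.1 : R).
Proof.
move=> mA; have := @indic_meas _ _ fst (fun=> 1) A (@measurable_fst _ _ _ _) (bounded_cst 1) mA.
by under eq_fun do rewrite mulr1.
Qed.

Let indic_snd_meas A : measurable A -> bounded_meas (fun z : R * R => \1_A z.2 : R).
Proof.
move=> mA; have := @indic_meas _ _ snd (fun=> 1) A (@measurable_snd _ _ _ _) (bounded_cst 1) mA.
by under eq_fun do rewrite mulr1.
Qed.

(** The products in [box_test] stay between 0 and 1 and converge to the indicator [F] of positive
    [tent] and [c < v]. [F] agrees with the quadrant only for [0 < x < ell], hence the appeal to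
    [approx_interior]. *)
Let approx_quadrant0 a c : 0 <= a < ell ->
  approximable (fun z => \1_(`]a, +oo[%classic : set R) z.1 * \1_(`]c, +oo[%classic : set R) z.2).
Proof.
move=> a01.
pose F z : R := \1_(`]0, +oo[%classic : set R) (tent a z.1) * \1_(`]c, +oo[%classic : set R) z.2.
have mt : measurable_fun setT (fun z : R * R => tent a z.1).
  apply: continuous_plane_measurable.
  exact: (smooth_tent a 0%N).
have bF : bounded_meas F by apply: indic_meas => //; exact: indic_snd_meas.
apply: (approx_interior (f := F)) => //.
- apply: (@approx_dominated (fun n z => flat 0 (n%:R * tent a z.1) * flat 0 (n%:R * window c n z.2)) _ (fun=> 1)).
  + by move=> n; apply: approx_test; exact: box_test.
  + exact: bounded_L2.
  + move=> [x v]; rewrite /F !indic_gt/=; have [t0|t0] := ltP 0 (tent a x); last first.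
      rewrite mul0r; apply: cvg_near_cst; apply: nearW => n.
      by rewrite flat0_npos ?mul0r// mulr_ge0_le0.
    have [vc|vc] := ltP c v; last first.
      rewrite mulr0; apply: cvg_near_cst; apply: nearW => n.
      rewrite [X in _ * X]flat0_npos ?mulr0// mulr_ge0_le0//.
      rewrite /window mulr_le0_ge0 ?subr_le0// subr_ge0 (le_trans vc)// lerDl//.
    apply: cvgM; first by apply: (cvg_flat0 t0); exact: nearW.
    have d0 : 0 < v - c by rewrite subr_gt0.
    apply: (cvg_flat0 d0).
    near=> n; rewrite /window ler_peMr ?(ltW d0)//.
    have : v - c + 1 <= n%:R by near: n; exact: nbhs_infty_ger.
    lra.
  + by apply: bounded_L2; exact: bounded_cst.
  + move=> n z; rewrite /F !indic_gt.
    set u := flat 0 _; set w := flat 0 _.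
    have [u0 u1] : 0 <= u /\ u <= 1 by rewrite flat_ge0 flat0_le1.
    have [w0 w1] : 0 <= w /\ w <= 1 by rewrite flat_ge0 flat0_le1.
    by rewrite ler_norml; case: (_ < _)%R; case: (_ < _)%R => /=; rewrite ?mulr1 ?mulr0; nra.
- by apply: bounded_L2; apply: boundedM; [exact: indic_fst_meas|exact: indic_snd_meas].
- by apply: boundedM; [exact: indic_fst_meas|exact: indic_snd_meas].
- by move=> x v x01; rewrite /F !indic_gt/= tent_gt0.
Unshelve. all: by end_near. Qed.

Let approx_quadrant a c :
  approximable (fun z => \1_(`]a, +oo[%classic : set R) z.1 * \1_(`]c, +oo[%classic : set R) z.2).
Proof.
have bq a' : bounded_meas (fun z => \1_(`]a', +oo[%classic : set R) z.1 * \1_(`]c, +oo[%classic : set R) z.2 : R).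
  by apply: boundedM; [exact: indic_fst_meas|exact: indic_snd_meas].
have [a0|a0] := ltP a 0.
  apply: (approx_interior (approx_quadrant0 (a := 0) c _)) => //; first by rewrite lexx.
    exact: bounded_L2.
  by move=> x v /andP[x0 _]; rewrite !indic_gt/= x0 (lt_trans a0 x0).
have [al|la] := ltP a ell; first by apply: approx_quadrant0; rewrite a0.
apply: (approx_interior approx0) => //; first exact: bounded_L2.
  exact: bounded_cst.
by move=> x v /andP[_ xl]; rewrite !indic_gt/= ltNge (ltW (lt_le_trans xl la)) mul0r.
Qed.

Let RGenI : setI_closed (@RGenOInfty.G R).
Proof.
move=> _ _ [x ->] [y ->]; exists (Num.max x y).
apply/seteqP; split => z /=; rewrite !in_itv/= !andbT gt_max; last by move=> /andP[].
by move=> [-> ->].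
Qed.

Let approx_strip c A : measurable A ->
  approximable (fun z => \1_A z.1 * \1_(`]c, +oo[%classic : set R) z.2).
Proof.
apply: (@approx_dynkin _ _ (@RGenOInfty.G R) fst (fun z => \1_(`]c, +oo[%classic : set R) z.2)).
- exact: RGenOInfty.measurableE.
- exact: RGenI.
- exact: measurable_fst.
- exact: indic_snd_meas.
- apply: (approx_interior (approx_quadrant 0 c)).
  + by apply: bounded_L2; exact: indic_snd_meas.
  + by apply: boundedM; [exact: indic_fst_meas|exact: indic_snd_meas].
  + exact: indic_snd_meas.
  + by move=> x v /andP[x0 _]; rewrite !indic_gt/= x0 mul1r.
- by move=> _ [a ->]; exact: approx_quadrant.
Qed.

(** Second Dynkin argument, in [v]. The weight [\1_A] is itself approximable as the limit of strips
    over the half-lines []- n, +oo[]. *)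
Let approx_rectangle A B : measurable A -> measurable B -> approximable (fun z => \1_B z.2 * \1_A z.1).
Proof.
move=> mA; move: B; apply: (@approx_dynkin _ _ (@RGenOInfty.G R) snd (fun z => \1_A z.1)).
- exact: RGenOInfty.measurableE.
- exact: RGenI.
- exact: measurable_snd.
- exact: indic_fst_meas.
- apply: (approx_dominated (fun n : nat => approx_strip (- n%:R) mA) (k := fun=> 1)).
  + by apply: bounded_L2; exact: indic_fst_meas.
  + move=> z; rewrite -[X in _ --> X]mulr1; apply: cvgM; first exact: cvg_cst.
    apply: cvg_near_cst; near=> n; rewrite indic_gt.
    suff -> : - n%:R < z.2 by [].
    rewrite ltrNl; near: n; exact: nbhs_infty_gtr.
  + by apply: bounded_L2; exact: bounded_cst.
  + move=> n z; rewrite indic_gt indicE.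
    by case: (_ \in _); case: (_ < _)%R; rewrite /= ?mulr0 ?mul0r ?mulr1 ?subrr ?sub0r ?normrN ?normr0 ?normr1.
- move=> _ [c ->]; have := approx_strip c mA; congr approximable.
  by apply/funext => z; rewrite mulrC.
Unshelve. all: by end_near. Qed.

Lemma approx_indic (D : set (R * R)) : measurable D -> approximable (\1_D : R * R -> R).
Proof.
have mT := @measurableT _ R.
have a1 : approximable (fun=> 1).
  by have := approx_rectangle mT mT; congr approximable; apply/funext => z; rewrite indicT mulr1.
move=> mD.
have -> : \1_D = (fun z : R * R => \1_D (id z) * 1 : R) by apply/funext => z; rewrite mulr1.
move: D mD; apply: (@approx_dynkin _ _ [set A `*` B | A in (measurable : set (set R)) & B in (measurable : set (set R))]) => //.
- exact: measurable_prod_measurableType.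
- move=> X Y [X1 mX1 [X2 mX2 <-{X}]] [Y1 mY1 [Y2 mY2 <-{Y}]].
  exists (X1 `&` Y1); first exact: measurableI.
  by exists (X2 `&` Y2); [exact: measurableI|rewrite setXI].
- exact: bounded_cst.
- move=> _ [A mA [B mB <-]]; have := approx_rectangle mA mB; congr approximable.
  apply/funext => -[x v]; rewrite mulr1 !indicE in_setX/=.
  by do 2 case: (_ \in _); rewrite /= ?mulr0 ?mul0r ?mulr1.
Qed.

Let approx_sum n (c : 'I_n -> R) (F : 'I_n -> R * R -> R) : (forall i, approximable (F i)) ->
  approximable (fun z => \sum_(i < n) c i * F i z).
Proof.
elim: n c F => [|n IH] c F aF; first by under eq_fun do rewrite big_ord0; exact: approx0.
under eq_fun do rewrite big_ord_recl; apply: approx_lin => //.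
by apply: (IH (fun i => c (lift ord0 i)) (fun i => F (lift ord0 i))) => i.
Qed.

Let approx_nnsfun (h : {nnsfun (R * R)%type >-> R}) : approximable h.
Proof.
rewrite (funext (fimfunEord h)); apply: approx_sum => i; exact: approx_indic.
Qed.

Lemma approx_nonneg f : f \in L2fun -> (forall z, 0 <= f z) -> approximable f.
Proof.
move=> f2 f0; have mf := Lfun2_measurable f2.
have mE : measurable_fun setT (EFin \o f) by exact/measurable_EFinP.
pose h n : {nnsfun (R * R)%type >-> R} := nnsfun_approx measurableT mE n.
have h0 n z : 0 <= h n z by [].
have hf n z : h n z <= f z.
  by rewrite -lee_fin /h nnsfun_approxE; apply: (le_approx _ (f := EFin \o f)) => // x _; rewrite lee_fin.
apply: (approx_dominated (fun n => approx_nnsfun (h n)) f2 _ f2).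
- move=> z; have c : (EFin \o (fun n => h n z)) @ \oo --> (f z)%:E.
    by apply: (cvg_nnsfun_approx measurableT mE) => // x _; rewrite lee_fin.
  exact: (fine_cvg c).
- by move=> n z; rewrite ler0_norm ?subr_le0// opprB lerBlDr lerDl.
Qed.

Lemma test_dense f e : f \in L2fun -> 0 < e -> exists2 g, test g & nrm (fun z => g z - f z) < e.
Proof.
move=> f2; have mf := Lfun2_measurable f2.
suff : approximable f by move=> [_]; exact.
have n2 : (fun z => `|f z|) \in L2fun.
  apply: Lfun2P; first exact: measurableT_comp.
  have := Lfun2_integrableM f2 f2; congr integrable.
  by apply/funext => z /=; rewrite -expr2 -[in RHS]expr2 real_normK ?num_real.
have a1 : approximable (fun z => f z + `|f z|).
  apply: approx_nonneg => [|z].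
    by have := L2_lin 1 f2 n2; under eq_fun do rewrite mul1r.
  by have := lerNnormlW (lexx `|f z|); lra.
have := approx_lin (-1) (approx_nonneg n2 (fun=> normr_ge0 _)) a1.
by congr approximable; apply/funext => z; ring.
Qed.
End TestDensity.

(** * From test functions to the semigroup *)

Lemma ecvg0_lt {R : realType} {T : Type} {F : set_system T} {FF : Filter F} (u : T -> \bar R) (w : T -> R) :
  (forall t, u t = (w t)%:E) -> (forall t, 0 <= w t) ->
  u @ F --> 0%E <-> (forall e, 0 < e -> \forall t \near F, w t < e).
Proof.
move=> uw w0; have -> : u = EFin \o w by apply/funext => t; exact: uw.
split=> [/fine_cvg /cvgr0Pnorm_lt H e e0|H].
  by apply: filterS (H e e0) => t /=; rewrite ger0_norm.
apply: cvg_EFin => /=; first exact: nearW.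
apply/cvgr0Pnorm_lt => e e0; apply: filterS (H e e0) => t /=.
by rewrite ger0_norm.
Qed.

Section KineticDecay.
Context {R : realType} {ell : R} (ell_gt0 : 0 < ell).
Local Notation P := (phase_prob ell_gt0).
Local Notation test := (test_function ell).
Local Notation nrm := (nrm2 P).
Local Notation L2fun := (Lfun P 2%:E).
Local Notation V := (L2 ell_gt0).
Implicit Types f g : R * R -> R.

Let L2V (F : V) : (F : R * R -> R) \in L2fun.
Proof. exact: LfunP. Qed.

Let kin_L2 c g : test g -> kinetic_op c g \in L2fun.
Proof. by move=> tg; apply: moderate_L2; apply: bounded_moderate; exact: (kinetic_bounded ell_gt0). Qed.

Lemma L2normE f : f \in L2fun -> L2norm ell_gt0 f = (nrm f)%:E.
Proof. exact: Lfun2_Lnorm. Qed.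

Lemma graph_test c (F G : V) e : kinetic_graph c F G -> 0 < e ->
  exists phi, [/\ test phi, nrm (fun z => phi z - F z) < e & nrm (fun z => kinetic_op c phi z - G z) < e].
Proof.
move=> [phi [tphi c1 c2]] e0.
have n1 n : L2norm ell_gt0 (phi n \- F) = (nrm (fun z => phi n z - F z))%:E.
  by apply: L2normE; apply: L2_sub => //; exact: test_L2.
have n2 n : L2norm ell_gt0 (kinetic_op c (phi n) \- G) = (nrm (fun z => kinetic_op c (phi n) z - G z))%:E.
  by apply: L2normE; apply: L2_sub => //; exact: kin_L2.
have H1 : \forall n \near \oo, nrm (fun z => phi n z - F z) < e.
  exact: ((ecvg0_lt n1 (fun n => nrm2_ge0 _ _)).1 c1 e e0).
have H2 : \forall n \near \oo, nrm (fun z => kinetic_op c (phi n) z - G z) < e.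
  exact: ((ecvg0_lt n2 (fun n => nrm2_ge0 _ _)).1 c2 e e0).
have [N _ /(_ N (leqnn N))[h1 h2]] := filterI H1 H2.
by exists (phi N).
Qed.

Lemma graph_of_test c (F G : V) : test F -> kinetic_op c F = G -> kinetic_graph c F G.
Proof.
move=> tF FG; exists (fun=> F).
have z f : L2norm ell_gt0 (f \- f) = 0%E.
  by rewrite /L2norm (_ : _ \o _ = cst 0%E) ?Lnorm0//; apply/funext => y /=; rewrite subrr.
by split => //; rewrite ?FG z; exact: cvg_cst.
Qed.

Lemma nrm_ae0 (F G : V) : (F : _ -> R) = G %[ae P] -> nrm (F - G : V) = 0.
Proof.
move=> FG; have d2 := L2V (F - G).
apply/eqP; rewrite -sqrf_eq0 sqr_nrm2//; apply/eqP.
rewrite -[RHS](Rintegral_probability_cst P); congr fine.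
have := Lfun2_integrableM d2 d2 => /integrableP[m2 _].
apply: ae_eq_integral => //.
apply: filterS FG => z + _ => /(_ I) fg.
change (((F z - G z) * (F z - G z))%:E = 0%:E).
by rewrite fg subrr mulr0.
Qed.

Lemma nrm_limit (F : R -> V) :
  (L2norm ell_gt0 (F h) @[h --> 0^'+] --> 0%E) <-> (forall e, 0 < e -> \forall h \near 0^'+, nrm (F h) < e).
Proof.
by apply: ecvg0_lt => h; [apply: L2normE; exact: L2V|exact: nrm2_ge0].
Qed.

Record bounded_form (B : (R * R -> R) -> (R * R -> R) -> R) (K : R) : Prop := {
  form_lin : forall c f f' g, f \in L2fun -> f' \in L2fun -> g \in L2fun ->
    B (fun z => c * f z + f' z) g = c * B f g + B f' g;
  form_sym : forall f g, B f g = B g f;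
  form_bound : forall f g, f \in L2fun -> g \in L2fun -> `|B f g| <= K * (nrm f * nrm g) }.

(** Continuity in both arguments at once, because the closed graph approximates [f] and [P f] by the
    same test function. *)
Definition loc_lipschitz (Phi : (R * R -> R) -> (R * R -> R) -> R) :=
  forall f g, f \in L2fun -> g \in L2fun -> exists M, forall e f' g', f' \in L2fun -> g' \in L2fun ->
    0 < e -> e <= 1 -> nrm (fun z => f' z - f z) < e -> nrm (fun z => g' z - g z) < e ->
    `|Phi f' g' - Phi f g| <= M * e.

Lemma form_lipschitz B K : 0 <= K -> bounded_form B K -> loc_lipschitz B.
Proof.
move=> K0 [Bl Bs Bb] f g f2 g2; exists (K * (nrm f + nrm g + 1)) => e f' g' f'2 g'2 e0 e1 ff gg.
have E u w h : u \in L2fun -> w \in L2fun -> h \in L2fun -> B (fun z => u z - w z) h = B u h - B w h.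
  move=> u2 w2 h2; have := Bl (-1) w u h w2 u2 h2; rewrite mulN1r addrC => <-; congr B.
  by apply/funext => z; ring.
have -> : B f' g' - B f g = B (fun z => f' z - f z) g' + B f (fun z => g' z - g z).
  by rewrite (E f' f g')// (Bs f (fun z => g' z - g z)) (E g' g f)// (Bs g' f) (Bs g f) subrKA.
have df := L2_sub f'2 f2; have dg := L2_sub g'2 g2.
have n' : nrm g' <= nrm g + e.
  rewrite (_ : g' = (fun z => (g' z - g z) + g z)); last by apply/funext => z; rewrite subrK.
  by apply: le_trans (nrm_triangle dg g2) _; rewrite addrC lerD2l ltW.
have nf := nrm2_ge0 P f; have ng := nrm2_ge0 P g'.
have H1 := Bb _ _ df g'2; have H2 := Bb _ _ f2 dg.
apply: le_trans (ler_normD _ _) _.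
have H3 : nrm (fun z => f' z - f z) * nrm g' <= e * (nrm g + 1).
  by apply: ler_pM (nrm2_ge0 _ _) ng (ltW ff) _; apply: (le_trans n'); rewrite lerD2l.
have H4 : nrm f * nrm (fun z => g' z - g z) <= nrm f * e by rewrite ler_wpM2l// ltW.
apply: le_trans (lerD H1 H2) _; rewrite -mulrDr -mulrA ler_wpM2l//.
apply: le_trans (lerD H3 H4) _.
by rewrite [nrm f * e]mulrC -mulrDr [e * _]mulrC [nrm g + 1 + _]addrC addrA.
Qed.

Lemma lipschitz_lin c Phi Psi : loc_lipschitz Phi -> loc_lipschitz Psi ->
  loc_lipschitz (fun f g => c * Phi f g + Psi f g).
Proof.
move=> H1 H2 f g f2 g2; have [M HM] := H1 f g f2 g2; have [N HN] := H2 f g f2 g2.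
exists (`|c| * M + N) => e f' g' f'2 g'2 e0 e1 ff gg.
rewrite (_ : _ - _ = c * (Phi f' g' - Phi f g) + (Psi f' g' - Psi f g)); last by ring.
apply: le_trans (ler_normD _ _) _; rewrite normrM mulrDl -mulrA.
by apply: lerD; [rewrite ler_wpM2l//; exact: HM|exact: HN].
Qed.

Lemma lipschitz_diag Phi : loc_lipschitz Phi -> loc_lipschitz (fun f _ => Phi f f).
Proof.
move=> H f g f2 g2; have [M HM] := H f f f2 f2.
by exists M => e f' g' f'2 _ e0 e1 ff _; exact: HM.
Qed.

(** The vehicle that carries an inequality between forms from test functions to their closure. *)
Lemma lipschitz_ge0 Phi f g : loc_lipschitz Phi -> f \in L2fun -> g \in L2fun ->
  (forall e, 0 < e -> exists f' g', [/\ f' \in L2fun, g' \in L2fun, nrm (fun z => f' z - f z) < e,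
    nrm (fun z => g' z - g z) < e & 0 <= Phi f' g']) -> 0 <= Phi f g.
Proof.
move=> H f2 g2 A; have [M HM] := H f g f2 g2; apply/ler_addgt0Pr => d d0.
have M0 : 0 < `|M| + 1 by rewrite ltr_wpDl.
pose e := Num.min 1 (d / (`|M| + 1)).
have e0 : 0 < e by rewrite lt_min ltr01 divr_gt0.
have [f' [g' [f'2 g'2 ff gg p]]] := A e e0.
have e1 : e <= 1 by rewrite ge_min lexx.
have := HM e f' g' f'2 g'2 e0 e1 ff gg.
have : e * (`|M| + 1) <= d by rewrite -ler_pdivlMr// ge_min lexx orbT.
have := ler_norm M; have := ler_norm (Phi f' g' - Phi f g).
by have := ler_wpM2r (ltW e0) (ler_norm M); lra.
Qed.

Section Decay.
Context (c : collision) (S : R -> V -> V) (B : (R * R -> R) -> (R * R -> R) -> R) (K k : R).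
Hypothesis kS : kinetic_semigroup c S.
Hypothesis K_ge0 : 0 <= K.
Hypothesis bB : bounded_form B K.
Hypothesis B_ge0 : forall f, f \in L2fun -> 0 <= B f f.
Hypothesis k_ge0 : 0 <= k.
Hypothesis B_diss : forall phi, test phi -> k * B phi phi <= B phi (kinetic_op c phi).

Let is_genP (F G : V) : is_gen (fun H : V => nrm H) S F G <-> kinetic_graph c F (- G).
Proof.
have [_ gS] := kS; rewrite -gS opprK; exact: iff_sym (nrm_limit _).
Qed.

(** Stated for a general form, being applied both to the entropy and to the product of the means.
    Dissipation on test functions extends to the generator because its graph is the closed graph of
    [- P], and test functions make its domain dense. *)
Lemma kinetic_form_decay (F : V) t : 0 <= t -> B (S t F) (S t F) <= expR (- (2 * k) * t) * B F F.
Proof.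
have [[Slin Sbnd Sid Scomp Scont] _] := kS; have [Bl Bs Bb] := bB => t0.
apply: (@semigroup_decay R V (fun H : V => nrm H) S _ _ _ _ _ _ _ _ (fun F G => B F G) K k) => //.
- by move=> H; exact: nrm2_ge0.
- by move=> H H'; exact: (nrm_triangle (L2V H) (L2V H')).
- by move=> a H; exact: (nrm_scale a (L2V H)).
- by move=> s s0 a H H'; apply: nrm_ae0; exact: Slin.
- move=> s s0; have [M HM] := Sbnd s s0; exists M => H.
  by have := HM H; rewrite (L2normE (L2V _)) (L2normE (L2V H)) -EFinM lee_fin.
- by move=> H; apply: nrm_ae0; exact: Sid.
- by move=> s s' s0 s'0 H; apply: nrm_ae0; exact: Scomp.
- by move=> H e e0; exact: (nrm_limit (fun h => S h H - H)).1 (Scont H) e e0.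
- by move=> a H H' H''; exact: (Bl a _ _ _ (L2V H) (L2V H') (L2V H'')).
- by move=> H; exact: (B_ge0 (L2V H)).
- by move=> H H'; exact: (Bb _ _ (L2V H) (L2V H')).
- move=> H G /is_genP gr.
  suff : 0 <= - k * B H H + B H (- G : V).
    have -> : B H (- G : V) = - B H G.
      (* Linearity is available in the shape [c * f + f'], so [- G] is written as [-2 * G + G]. *)
      rewrite (Bs H (- G : V)) (Bs H G); have := Bl (-2) _ _ _ (L2V G) (L2V G) (L2V H).
      have -> : (fun z => -2 * G z + G z) = (- G : V) :> (_ -> R).
        by apply/funext => z; rewrite [RHS]/(- (G z)) mulNr mulr_natl mulr2n opprD subrK.
      by move=> ->; ring.
    by rewrite subr_ge0.
  apply: (lipschitz_ge0 (Phi := fun f g => - k * B f f + B f g) _ (L2V H) (L2V (- G))).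
    apply: lipschitz_lin; last exact: form_lipschitz bB.
    by apply: lipschitz_diag; exact: form_lipschitz bB.
  move=> e e0; have [phi [tphi h1 h2]] := graph_test gr e0.
  exists phi, (kinetic_op c phi); split=> //; [exact: test_L2|exact: kin_L2|].
  by rewrite mulNr addrC subr_ge0; exact: B_diss.
- move=> H e e0; have [phi tphi ph] := test_dense (L2V H) e0.
  pose H' : V := Lfun_Sub (lee1n 2) (test_L2 ell_gt0 tphi).
  pose G' : V := Lfun_Sub (lee1n 2) (kin_L2 c tphi).
  exists H', (- G'); split; last exact: ph.
  by apply/is_genP; rewrite opprK; exact: graph_of_test.
Qed.
End Decay.

Definition mean_form f g : R := (\int[P]_z f z) * (\int[P]_z g z).

Lemma mean_form_bounded : bounded_form mean_form 1.
Proof.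
split=> [a f f' g f2 f'2 g2|f g|f g f2 g2]; rewrite /mean_form.
- by rewrite mean_lin// mulrDl mulrA.
- exact: mulrC.
- by rewrite normrM mul1r ler_pM//; exact: mean_bound.
Qed.

Lemma entropy_bounded : bounded_form (entropy ell_gt0) (entropy_bd ell).
Proof.
split=> [a f f' g f2 f'2 g2|f g|f g f2 g2].
- exact: entropy_lin.
- exact: entropy_sym.
- exact: entropy_bound.
Qed.

Lemma ip_bounded : bounded_form (fun f g => \int[P]_z (f z * g z)) 1.
Proof.
split=> [a f f' g f2 f'2 g2|f g|f g f2 g2].
- have i1 := Lfun2_integrableM f2 g2; have i2 := Lfun2_integrableM f'2 g2.
  rewrite -RintegralZl// -RintegralD//; last exact: (integrableZl measurableT a i1).
  by apply: eq_mean => z; rewrite mulrDl mulrA.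
- by apply: eq_mean => z; rewrite mulrC.
- by rewrite mul1r; exact: cauchy_schwarz2.
Qed.

Lemma entropy_lower f : f \in L2fun -> \int[P]_z (f z * f z) - (\int[P]_z f z) ^+ 2 <= 2 * entropy ell_gt0 f f.
Proof.
move=> f2.
pose Phi f g : R := 2 * entropy ell_gt0 f g + ((-1) * \int[P]_z (f z * g z) + mean_form f g).
have PhiE (a b m : R) : (b - m ^+ 2 <= 2 * a) = (0 <= 2 * a + (-1 * b + m * m)).
  by rewrite -subr_ge0; congr (0 <= _); ring.
rewrite PhiE; change (0 <= Phi f f).
have LP : loc_lipschitz Phi.
  apply: lipschitz_lin; first by apply: form_lipschitz entropy_bounded; exact: entropy_bd_ge0.
  apply: lipschitz_lin; [exact: form_lipschitz ip_bounded|exact: form_lipschitz mean_form_bounded].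
apply: (lipschitz_ge0 LP) => // e e0.
have [g tg gf] := test_dense f2 e0.
exists g, g; split=> //; [exact: test_L2|exact: test_L2|].
by have := entropy_test_lower ell_gt0 tg; rewrite PhiE.
Qed.

Lemma entropy_ge0 f : f \in L2fun -> 0 <= entropy ell_gt0 f f.
Proof.
move=> f2; have := entropy_lower f2; have := mean_bound f2.
rewrite -sqr_nrm2// => mb; have : (\int[P]_z f z) ^+ 2 <= nrm f ^+ 2.
  by rewrite -real_normK ?num_real// lerXn2r// nnegrE// nrm2_ge0.
rewrite -subr_ge0 => h /(le_trans h); rewrite pmulr_rge0//.
Qed.
End KineticDecay.

Theorem theorem1p1 (R : realType) (ell : R) (ell_gt0 : 0 < ell)
    (c : collision) :
  exists kappa C : R, 0 < kappa /\ 0 < C /\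
    forall S : R -> L2 ell_gt0 -> L2 ell_gt0, kinetic_semigroup c S ->
    forall f0 : L2 ell_gt0, mean ell_gt0 f0 = 0 ->
    forall t : R, 0 <= t ->
      (L2norm ell_gt0 (S t f0)
        <= (C * expR (- kappa * t))%:E * L2norm ell_gt0 f0)%E.
Proof.
have k0 : 0 < entropy_eps ell / 4 by rewrite divr_gt0// entropy_eps_gt0.
have K0 := entropy_bd_ge0 ell_gt0.
(* With [K = entropy_bd ell], the squared norm is at most [2 * K] times the decayed initial one, and
   [2 * K <= (2 * K + 1) ^+ 2]. The form decays at rate [2 * k], so the norm decays at rate [k]. *)
exists (entropy_eps ell / 4), (2 * entropy_bd ell + 1); split=> //; split.
  by rewrite ltr_wpDl// mulr_ge0.
move=> S kS f0 m0 t t0.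
have L2f (F : L2 ell_gt0) : (F : _ -> R) \in Lfun (phase_prob ell_gt0) 2%:E by exact: LfunP.
(* For [k = 0] the squared mean does not increase, and it is 0 at the start. *)
have mS : \int[phase_prob ell_gt0]_z (S t f0) z = 0.
  have := kinetic_form_decay kS ler01 (mean_form_bounded ell_gt0) _ (lexx 0) _ f0 t0.
  rewrite /mean_form [X in _ <= _ * (X * _)](_ : _ = 0)// mul0r mulr0 => H.
  have : (\int[phase_prob ell_gt0]_z (S t f0) z) * (\int[phase_prob ell_gt0]_z (S t f0) z) <= 0.
    apply: H => [f _|phi tphi]; first by rewrite -expr2 sqr_ge0.
    by rewrite mul0r (mean_kinetic ell_gt0 c tphi) mulr0.
  by rewrite -expr2 => H'; apply/eqP; rewrite -sqrf_eq0 eq_le H' sqr_ge0.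
have D := kinetic_form_decay kS K0 (entropy_bounded ell_gt0) (@entropy_ge0 _ _ ell_gt0) (ltW k0)
  (fun phi tphi => entropy_test_diss ell_gt0 c tphi) f0 t0.
have := entropy_lower (L2f (S t f0)); rewrite mS -(sqr_nrm2 (L2f _)) => L.
have := entropy_bound (L2f f0) (L2f f0) => U.
rewrite (L2normE (L2f _)) (L2normE (L2f f0)) -EFinM lee_fin.
set a := nrm2 _ _; set b := nrm2 _ _; move: D L U; rewrite -/a -/b.
set k := entropy_eps ell / 4; set K := entropy_bd ell.
have a0 : 0 <= a by exact: nrm2_ge0.
have b0 : 0 <= b by exact: nrm2_ge0.
have -> : expR (- (2 * k) * t) = expR (- k * t) ^+ 2 by rewrite -expRM_natl; congr expR; ring.
have E0 : 0 < expR (- k * t) by exact: expR_gt0.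
move=> D L /ler_normlW U; rewrite expr0n/= subr0 in L.
have L2 : a ^+ 2 <= (2 * K) * (expR (- k * t) * b) ^+ 2.
  apply: (le_trans L); rewrite -mulrA ler_pM2l//; apply: (le_trans D).
  by rewrite exprMn mulrCA ler_pM2l ?exprn_gt0// expr2.
have C0 : 0 <= (2 * K + 1) * expR (- k * t) * b.
  by rewrite mulr_ge0// mulr_ge0 ?expR_ge0// addr_ge0// mulr_ge0.
rewrite -(@ler_pXn2r _ 2)// ?nnegrE//.
apply: (le_trans L2); rewrite -[X in _ <= X ^+ 2]mulrA [leRHS]exprMn ler_wpM2r ?sqr_ge0//.
by rewrite expr2; have := mulr_ge0 K0 K0; rewrite -/K in K0 *; nra.
Qed.
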